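(* Let $\Gamma_1=1$, $\Gamma_2\in(-1,1]\setminus\{0\}$, $\Gamma=\Gamma_1+\Gamma_2$, $M\ge3$. With $\Omega^E_a,\Psi^E_a,\Lambda^E,\Lambda^{E,\star},X$ and the pseudo-momenta $\varrho^e_a,\varrho^o_a$, the number $\lambda^e_a$ and the remainders $\mathrm R^{e,z}_a,\mathrm R^{e,s}_a,\mathrm R^{o,s}_a$ as in the context, put $\mathrm R^E_a=\{\Psi^E_a,\Omega^E_a\}_V$ (which is $\mathcal O_{\mathcal Z}(\varepsilon^{M+1})$) and $$f^o_a=\{\varrho^o_a,\Omega^E_a\}_V,\qquad f^e_a=\{\varrho^e_a,\Omega^E_a\}_V=X\Omega^E_a+\mathrm R^{e,z}_a .$$ Then $$\Lambda^Ef^e_a=X\mathrm R^E_a+\Lambda^E[\mathrm R^{e,z}_a]=\mathcal O_{\mathcal Z}(\varepsilon^{M+1}),$$ $$\Lambda^Ef^o_a=-\lambda^e_af^e_a-\{\mathrm R^{o,s}_a,\Omega^E_a\}_V+\{\varrho^o_a,\mathrm R^E_a\}_V=-\lambda^e_af^e_a+\mathcal O_{\mathcal Z}(\varepsilon^{M+1}),$$ $$\Lambda^{E,\star}\varrho^e_a=\mathrm R^{e,s}_a,\qquad\Lambda^{E,\star}\varrho^o_a=\lambda^e_a\varrho^e_a+\mathrm R^{o,s}_a .$$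
   Context: $\xi=(\xi_1,\xi_2)\in\mathbb R^2$; $Y_1=(1,1)^T$, $Y_2=(\Gamma_2,-\Gamma_1)^T$; $\mathbf e_1=(1,0)$; $G(\xi)=\frac1{4\pi}e^{-|\xi|^2/4}$; $1^\star=2,2^\star=1$; $\kappa_1=1,\kappa_2=-1$; $\Delta_\xi^{-1}f(\xi)=\frac1{2\pi}\int\log|\xi-\eta|f(\eta)d\eta$; $\{f,g\}=\partial_1f\partial_2g-\partial_2f\partial_1g$, and for $\mathbb R^2$-valued functions $\{f,g\}_V=(\{f_1,g_1\},\{f_2,g_2\})^T$; $\mathcal Lf=\Delta_\xi f+\frac\xi2\cdot\nabla f+f$; $M[f]=\int\xi f\,d\xi$. $\mathcal S_\star$: smooth functions all of whose derivatives have at most polynomial growth; $\mathcal Z=G\mathcal S_\star$. $f=\mathcal O_{\mathcal S_\star}(\delta)$ means that for every $\beta$ there are $C,N$ independent of the small parameters $\nu,\varepsilon$ with $|\partial^\beta f|\le C(1+|\xi|)^N\delta$; $f=\mathcal O_{\mathcal Z}(\delta)$ means $G^{-1}f=\mathcal O_{\mathcal S_\star}(\delta)$ (componentwise for vectors). $\mathcal Y=L^2(\mathbb R^2;G^{-1}d\xi)$, $P_0$ is the orthogonal projection of $\mathcal Y$ onto radial functions. $\Lambda f=\{\Delta_\xi^{-1}G,f\}+\{\Delta_\xi^{-1}f,G\}$, with kernel in $\mathcal Y$ (radial functions)$\,\oplus\,\mathrm{span}\{\partial_1G,\partial_2G\}$. Residual: with $\varepsilon=\sqrt{\nu t}$,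 $\Phi_i=\Delta^{-1}_\xi\Omega_i$, $\alpha(t)=1+\int_0^t\dot\alpha$, $$\mathrm R_i[\Omega,\dot\alpha,\dot\theta]=t\partial_t\Omega_i-\mathcal L\Omega_i+\frac1\nu\Bigl\{\Phi_i(\xi)+\Phi_{i^\star}(\xi+\kappa_i\varepsilon^{-1}\alpha\mathbf e_1)+\frac{\varepsilon^2}2\dot\theta|\xi|^2+\frac{\varepsilon\kappa_i\Gamma_{i^\star}}{\Gamma}(\dot\theta\alpha\xi_1+\dot\alpha\xi_2),\Omega_i\Bigr\}.$$ Approximate solution (recursion; all coefficients independent of $\nu,t$). $\Omega^E_{i,0}=\Gamma_iG$, $\Omega^{NS}_{i,0}=\Omega^E_{i,1}=\Omega^{NS}_{i,1}=0$, $\dot\theta^E_0=-\Gamma/(2\pi)$, $\dot\theta^{NS}_0=\dot\alpha^{NS}_0=0$. For $n\ge1$, given $\Omega$-coefficients of index $\le n$ and $\dot\theta,\dot\alpha$-coefficients of index $\le n-1$, the numbers $\dot\theta^E_n,\dot\theta^{NS}_n,\dot\alpha^{NS}_n$ are the unique ones such that, for $\Omega_i=\sum_{k\le n}\varepsilon^k(\Omega^E_{i,k}+\nu\Omega^{NS}_{i,k})$, $\dot\theta=\sum_{k\le n}\varepsilon^k(\dot\theta^E_k+\nu\dot\theta^{NS}_k)$, $\dot\alpha=\nu\sum_{k\le n}\varepsilon^k\dot\alpha^{NS}_k$, one has $\mathrm R_i=\nu^{-1}\varepsilon^{n+1}H^i_0+\varepsilon^{n+1}H^i_1+\mathcal O_{\mathcal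 Z}(\nu^{-1}\varepsilon^{n+2}+\nu\varepsilon^2)$ with $H^i_0,H^i_1\in\mathcal Z$ independent of $\nu,t$ and $M[H^i_0]=M[H^i_1]=0$. Then $\Omega^E_{i,n+1}=A_i+B_i$, where $A_i\in\mathcal Z$ is radial with $(\frac{n+1}2-\mathcal L)A_i=-P_0H^i_1$, and $B_i,\Omega^{NS}_{i,n+1}\in\mathcal Z$ are the $\mathcal Y$-orthogonal-to-$\ker\Lambda$ solutions of $\Gamma_i\Lambda B_i=-H^i_0$ and $\Gamma_i\Lambda\Omega^{NS}_{i,n+1}=-(1-P_0)H^i_1-(\frac{n+1}2-\mathcal L)B_i$. The recursion is well defined. Order-$M$ Eulerian objects: $\Omega^E_a=(\Omega^E_{1,a},\Omega^E_{2,a})^T$ with $\Omega^E_{i,a}=\sum_{k=0}^M\varepsilon^k\Omega^E_{i,k}$, $\dot\theta^E_a=\sum_{k=0}^{M-1}\varepsilon^k\dot\theta^E_k$, $\alpha_a=1+\sum_{k=2}^{M+1}\frac{2\varepsilon^k}k\dot\alpha^{NS}_{k-2}$; $(\mathcal B_a\omega)_i=\Delta_\xi^{-1}\omega_i(\xi)+(\Delta_\xi^{-1}\omega_{i^\star})(\xi+\kappa_i\varepsilon^{-1}\alpha_a\mathbf e_1)$; $$\Psi^E_a=\mathcal B_a\Omega^E_a+\frac{\varepsilon^2}2\dot\theta^E_a|\xi|^2Y_1+\frac\varepsilon\Gamma\dot\theta^E_a\alpha_a\xi_1Y_2+\frac1{2\pi}\log|\varepsilon/\alpha_a|\,(\Gamma_2,\Gamma_1)^T;$$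 $\Lambda^E\omega=\{\Psi^E_a,\omega\}_V+\{\mathcal B_a\omega,\Omega^E_a\}_V$; $\Lambda^{E,\star}\varrho=-\{\Psi^E_a,\varrho\}_V-\mathcal B_a\{\varrho,\Omega^E_a\}_V$; $\hat X=\xi_1Y_2+\frac{\varepsilon\Gamma}{2\alpha_a}|\xi|^2Y_1$, $X\Omega=\{\hat X,\Omega\}_V$. Pseudo-momenta: $\varrho^e_a,\varrho^o_a\in\mathcal S_\star^2$ and $\lambda^e_a\in\mathbb R$ (depending on small $\varepsilon$) are such that $\varrho^e_a$ is $\xi_2$-even, $\varrho^o_a$ is $\xi_2$-odd, $\{\varrho^e_a,\Omega^E_a\}_V=X\Omega^E_a+\mathrm R^{e,z}_a$, $\Lambda^{E,\star}\varrho^e_a=\mathrm R^{e,s}_a$, $\Lambda^{E,\star}\varrho^o_a=\lambda^e_a\varrho^e_a+\mathrm R^{o,s}_a$, with $\mathrm R^{e,z}_a=\mathcal O_{\mathcal Z}(\varepsilon^{M+1})$, $\mathrm R^{e,s}_a=\mathcal O_{\mathcal S_\star}(\varepsilon^{M+1})$, $\mathrm R^{o,s}_a=\mathcal O_{\mathcal S_\star}(\varepsilon^{M+1})+\vec C(t)$ for a $\xi$-independent vector $\vec C(t)$, and $\varrho^o_a=\xi_2Y_2+\mathcal O_{\mathcal S_\star}(\varepsilon)$, $\varrho^e_a=\xi_1Y_2+\mathcal O_{\mathcal S_\star}(\varepsilon)$, $\lambda^e_a=\frac\Gamma\pi\varepsilon^2+\mathcal O(\varepsilon^3)$. (Such objects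 exist.) *)

(* Defs.v *)
From HB Require Import structures.
From mathcomp Require Import all_boot all_order all_algebra.
From mathcomp Require Import all_classical all_reals all_analysis.
Set Implicit Arguments.
Unset Strict Implicit.
Unset Printing Implicit Defensive.
Import Order.TTheory GRing.Theory Num.Theory.
Import numFieldNormedType.Exports.
Local Open Scope classical_set_scope.
Local Open Scope ring_scope.

Section Plane.
Context {R : realType}.

Definition plane : Type := (R * R)%type.

(* R * R carries the sup norm; this is the Euclidean one. *)
Definition enorm (x : plane) : R := Num.sqrt (x.1 ^+ 2 + x.2 ^+ 2).

Definition shift1 (a : R) (x : plane) : plane := (x.1 + a, x.2).

Definition d1 (f : plane -> R) (x : plane) : R :=
  'D_((1, 0) : (R * R)%type) (f : (R * R)%type -> R) x.
Definition d2 (f : plane -> R) (x : plane) : R :=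
  'D_((0, 1) : (R * R)%type) (f : (R * R)%type -> R) x.

(* beta lists the successive directions of differentiation (false for xi_1,
   true for xi_2); for a smooth f the order is irrelevant, so that dmulti
   ranges over the usual multi-index derivatives. *)
Definition dmulti (beta : seq bool) (f : plane -> R) : plane -> R :=
  foldr (fun b g => if b then d2 g else d1 g) f beta.

Definition smooth (f : plane -> R) : Prop :=
  forall (beta : seq bool) (x : R * R),
    differentiable (dmulti beta f : (R * R)%type -> R) x.

Definition lap (f : plane -> R) (x : plane) : R := d1 (d1 f) x + d2 (d2 f) x.

Definition bracket (f g : plane -> R) (x : plane) : R :=
  d1 f x * d2 g x - d2 f x * d1 g x.

Definition Lop (f : plane -> R) (x : plane) : R :=
  lap f x + (x.1 * d1 f x + x.2 * d2 f x) / 2 + f x.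

Definition leb2 := (@lebesgue_measure R \x @lebesgue_measure R)%E.

Definition int2 (f : plane -> R) : R := (\int[leb2]_x f x)%R.

Definition invlap (f : plane -> R) (x : plane) : R :=
  (2 * pi)^-1 * int2 (fun y => ln (enorm (x.1 - y.1, x.2 - y.2)) * f y).

Definition moment (f : plane -> R) : R * R :=
  (int2 (fun x => x.1 * f x), int2 (fun x => x.2 * f x)).

Definition Gauss (x : plane) : R := (4 * pi)^-1 * expR (- (enorm x ^+ 2 / 4)).

Definition inS (f : plane -> R) : Prop :=
  smooth f /\
  forall beta, exists (C : R) (N : nat),
    forall x, `|dmulti beta f x| <= C * (1 + enorm x) ^+ N.

Definition inZ (f : plane -> R) : Prop :=
  exists2 h, inS h & forall x, f x = Gauss x * h x.

(* The parameter p ranges over a small set A of the filter F, the same for all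
   beta; the constants C and N do not depend on p. *)
Definition bigOS {I : Type} (F : set_system I) (f : I -> plane -> R)
    (delta : I -> R) : Prop :=
  exists2 A : set I, F A &
    (forall p, A p -> smooth (f p)) /\
    (forall beta, exists (C : R) (N : nat), forall p, A p -> forall x,
       `|dmulti beta (f p) x| <= C * (1 + enorm x) ^+ N * delta p).

Definition bigOZ {I : Type} (F : set_system I) (f : I -> plane -> R)
    (delta : I -> R) : Prop :=
  bigOS F (fun p x => (Gauss x)^-1 * f p x) delta.

(* The space Y = L^2(G^{-1} dxi). *)
Definition inY (f : plane -> R) : Prop :=
  measurable_fun setT (f : measurableTypeR R * measurableTypeR R -> R) /\
  leb2.-integrable setT (EFin \o (fun x => f x ^+ 2 / Gauss x)).

Definition dotY (f g : plane -> R) : R := int2 (fun x => f x * g x / Gauss x).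

Definition radial (f : plane -> R) : Prop :=
  forall x y, enorm x = enorm y -> f x = f y.

(* g is (a representative of) P_0 f, the orthogonal projection of f onto the
   radial functions of Y. *)
Definition is_P0 (f g : plane -> R) : Prop :=
  [/\ radial g, inY g &
      forall h, radial h -> inY h -> dotY (fun x => f x - g x) h = 0].

Definition Lambda (f : plane -> R) (x : plane) : R :=
  bracket (invlap Gauss) f x + bracket (invlap f) Gauss x.

(* The kernel of Lambda as an operator in Y. *)
Definition kerLambda (h : plane -> R) : Prop :=
  exists (r : plane -> R) (a b : R), [/\ radial r, inY r &
    forall x, h x = r x + a * d1 Gauss x + b * d2 Gauss x].

Definition orth_kerLambda (f : plane -> R) : Prop :=
  forall h, kerLambda h -> dotY f h = 0.

(* Pairs are indexed by 'I_2: ord0 and ord_max stand for the indices 1 and 2,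
   and rev_ord for the exchange of 1 and 2. *)
Definition vfun : Type := 'I_2 -> plane -> R.

Definition vec2 (a b : R) (i : 'I_2) : R := if i == ord0 then a else b.

Definition kappa : 'I_2 -> R := vec2 1 (-1).

Definition bracketV (f g : vfun) : vfun := fun i => bracket (f i) (g i).

Definition Bop (eps al : R) (w : vfun) : vfun := fun i x =>
  invlap (w i) x + invlap (w (rev_ord i)) (shift1 (kappa i * eps^-1 * al) x).

End Plane.
Arguments plane R : clear implicits.
Arguments vfun R : clear implicits.

Section Flow.
Context {R : realType}.
(* The circulations (Gamma_1, Gamma_2). *)
Variable Gam : 'I_2 -> R.

Definition Gtot : R := Gam ord0 + Gam ord_max.
Definition Y1 : 'I_2 -> R := vec2 1 1.
Definition Y2 : 'I_2 -> R := vec2 (Gam ord_max) (- Gam ord0).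

(* The unknowns Om, dal, dth (the latter two standing for the derivatives of
   alpha and theta) are functions of the time t. *)
Definition resid (nu : R) (Om : R -> vfun R) (dal dth : R -> R)
    (i : 'I_2) (t : R) (x : plane R) : R :=
  let eps := Num.sqrt (nu * t) in
  let al := 1 + (\int[lebesgue_measure]_(s in `[0, t]) dal s)%R in
  t * derive1 (fun s : R => Om s i x) t - Lop (Om t i) x
  + nu^-1 * bracket (fun y =>
      invlap (Om t i) y
      + invlap (Om t (rev_ord i)) (shift1 (kappa i * eps^-1 * al) y)
      + eps ^+ 2 / 2 * dth t * enorm y ^+ 2
      + eps * kappa i * Gam (rev_ord i) / Gtot
        * (dth t * al * y.1 + dal t * y.2)) (Om t i) x.

Record coefficients := Coefficients {
  OmE : nat -> vfun R;
  OmNS : nat -> vfun R;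
  dthE : nat -> R;
  dthNS : nat -> R;
  dalNS : nat -> R
}.

Variable c : coefficients.

(* Partial sums up to order n, at time t (so that eps = sqrt (nu t)). *)
Definition Om_sum (nu : R) (n : nat) (t : R) : vfun R := fun i x =>
  \sum_(k < n.+1) Num.sqrt (nu * t) ^+ k * (OmE c k i x + nu * OmNS c k i x).
Definition dth_sum (nu : R) (n : nat) (t : R) : R :=
  \sum_(k < n.+1) Num.sqrt (nu * t) ^+ k * (dthE c k + nu * dthNS c k).
Definition dal_sum (nu : R) (n : nat) (t : R) : R :=
  nu * \sum_(k < n.+1) Num.sqrt (nu * t) ^+ k * dalNS c k.

(* The small parameters are p = (nu, eps), and t = eps^2 / nu. *)
Definition resid_expansion (n : nat) (H0 H1 : vfun R) : Prop :=
  forall i : 'I_2,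
  [/\ inZ (H0 i), inZ (H1 i), moment (H0 i) = (0, 0), moment (H1 i) = (0, 0) &
      bigOZ (filter_prod (0 : R)^'+ (0 : R)^'+)
        (fun (p : R * R) x =>
           resid p.1 (Om_sum p.1 n) (dal_sum p.1 n) (dth_sum p.1 n)
                 i (p.2 ^+ 2 / p.1) x
           - (p.1^-1 * p.2 ^+ n.+1 * H0 i x + p.2 ^+ n.+1 * H1 i x))
        (fun p => p.1^-1 * p.2 ^+ n.+2 + p.1 * p.2 ^+ 2)].

Definition next_order (n : nat) (H0 H1 : vfun R) : Prop :=
  let m : R := n.+1%:R / 2 in
  forall i : 'I_2, exists A B P0H1 : plane R -> R,
    is_P0 (H1 i) P0H1 /\
    [/\ inZ A, radial A & forall x, m * A x - Lop A x = - P0H1 x] /\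
    [/\ inZ B, orth_kerLambda B & forall x, Gam i * Lambda B x = - H0 i x] /\
    (forall x, OmE c n.+1 i x = A x + B x) /\
    [/\ inZ (OmNS c n.+1 i), orth_kerLambda (OmNS c n.+1 i) &
        forall x, Gam i * Lambda (OmNS c n.+1 i) x
          = - (H1 i x - P0H1 x) - (m * B x - Lop B x)].

Record approx_solution : Prop := ApproxSolution {
  OmE_0 : forall i x, OmE c 0 i x = Gam i * Gauss x;
  OmNS_0 : forall i x, OmNS c 0 i x = 0;
  OmE_1 : forall i x, OmE c 1 i x = 0;
  OmNS_1 : forall i x, OmNS c 1 i x = 0;
  dthE_0 : dthE c 0 = - (Gtot / (2 * pi));
  dthNS_0 : dthNS c 0 = 0;
  dalNS_0 : dalNS c 0 = 0;
  approx_step : forall n, (1 <= n)%N ->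
    exists H0 H1 : vfun R, resid_expansion n H0 H1 /\ next_order n H0 H1
}.

Variable M : nat.

Definition OmEa (eps : R) : vfun R := fun i x =>
  \sum_(k < M.+1) eps ^+ k * OmE c k i x.
Definition dthEa (eps : R) : R := \sum_(k < M) eps ^+ k * dthE c k.
Definition ala (eps : R) : R :=
  1 + \sum_(2 <= k < M.+2) 2 * eps ^+ k / k%:R * dalNS c (k - 2).

Definition Ba (eps : R) (w : vfun R) : vfun R := Bop eps (ala eps) w.

Definition PsiEa (eps : R) : vfun R := fun i x =>
  Ba eps (OmEa eps) i x
  + eps ^+ 2 / 2 * dthEa eps * enorm x ^+ 2 * Y1 i
  + eps / Gtot * dthEa eps * ala eps * x.1 * Y2 i
  + (2 * pi)^-1 * ln `|eps / ala eps| * vec2 (Gam ord_max) (Gam ord0) i.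

Definition LambdaE (eps : R) (w : vfun R) : vfun R := fun i x =>
  bracketV (PsiEa eps) w i x + bracketV (Ba eps w) (OmEa eps) i x.

Definition LambdaEstar (eps : R) (rho : vfun R) : vfun R := fun i x =>
  - bracketV (PsiEa eps) rho i x - Ba eps (bracketV rho (OmEa eps)) i x.

Definition hatX (eps : R) : vfun R := fun i x =>
  x.1 * Y2 i + eps * Gtot / (2 * ala eps) * enorm x ^+ 2 * Y1 i.

Definition Xop (eps : R) (w : vfun R) : vfun R := bracketV (hatX eps) w.

Definition REa (eps : R) : vfun R := bracketV (PsiEa eps) (OmEa eps).

(* All these objects are functions of eps = sqrt (nu t), which is small and
   positive; so is the xi-independent vector C(t). *)
Record pseudo_momenta (rhoe rhoo : R -> vfun R) (lame : R -> R)
    (Rez Res Ros : R -> vfun R) : Prop := PseudoMomenta {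
  rhoe_S : \forall e \near (0 : R)^'+, forall i, inS (rhoe e i);
  rhoo_S : \forall e \near (0 : R)^'+, forall i, inS (rhoo e i);
  rhoe_even : \forall e \near (0 : R)^'+,
    forall i a b, rhoe e i (a, - b) = rhoe e i (a, b);
  rhoo_odd : \forall e \near (0 : R)^'+,
    forall i a b, rhoo e i (a, - b) = - rhoo e i (a, b);
  rhoe_bracket : \forall e \near (0 : R)^'+, forall i x,
    bracketV (rhoe e) (OmEa e) i x = Xop e (OmEa e) i x + Rez e i x;
  rhoe_star : \forall e \near (0 : R)^'+, forall i x,
    LambdaEstar e (rhoe e) i x = Res e i x;
  rhoo_star : \forall e \near (0 : R)^'+, forall i x,
    LambdaEstar e (rhoo e) i x = lame e * rhoe e i x + Ros e i x;
  Rez_O : forall i, bigOZ (0 : R)^'+ (fun e => Rez e i) (fun e => e ^+ M.+1);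
  Res_O : forall i, bigOS (0 : R)^'+ (fun e => Res e i) (fun e => e ^+ M.+1);
  Ros_O : exists C : R -> 'I_2 -> R, forall i,
    bigOS (0 : R)^'+ (fun e x => Ros e i x - C e i) (fun e => e ^+ M.+1);
  rhoo_lead : forall i,
    bigOS (0 : R)^'+ (fun e x => rhoo e i x - x.2 * Y2 i) (fun e => e);
  rhoe_lead : forall i,
    bigOS (0 : R)^'+ (fun e x => rhoe e i x - x.1 * Y2 i) (fun e => e);
  lame_lead :
    (fun e : R => lame e - Gtot / pi * e ^+ 2) =O_ ((0 : R)^'+)
    (fun e : R => e ^+ 3)
}.

End Flow.

(* Main.v *)
Require Import Defs.
From HB Require Import structures.
From mathcomp Require Import all_boot all_order all_algebra.
From mathcomp Require Import all_classical all_reals all_analysis.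
From mathcomp Require Import measurable_realfun lebesgue_integral ring lra zify.
Set Implicit Arguments.
Unset Strict Implicit.
Unset Printing Implicit Defensive.
Import Order.TTheory GRing.Theory Num.Theory.
Import numFieldNormedType.Exports.
Local Open Scope classical_set_scope.
Local Open Scope ring_scope.

(* Everything reduces to the calculus of the logarithmic potential of rapidly
   decaying functions: it commutes with derivatives and, the kernel being
   radial, with the rotation field, and its gradient is bounded in terms of a
   weighted norm of the density, uniformly in space (hence insensitive to the
   shift by alpha / epsilon).
   Translation and rotation invariance give {Psi, hatX} + B{hatX, Omega} = 0,
   so that the two identities for Lambda^E follow from the Jacobi identity.
   The bound on the Eulerian residual comes from the expansion of the full
   residual R: at fixed epsilon, nu R is a quadratic polynomial in nu, whose
   constant coefficient is extrapolated from nu = epsilon^M, 2 epsilon^M and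
   3 epsilon^M. *)


(** * Squares of the plane and dyadic sums of their indicators *)

Section MeasurePlane.
Context {R : realType}.
Implicit Types (x z h : plane R).

Notation mplane := (measurableTypeR R * measurableTypeR R)%type.

(** The obstacle is the shift [kappa i * eps^-1 * al], which goes to infinity: a shifted potential
    has size log(1/eps), and polynomial bounds are not uniform under such shifts. A bracket,
    however, sees only gradients, and boundedness of a gradient on the whole plane is translation
    invariant. Hence, besides growth ([OS]) and decay ([RD]), a class of bounded functions ([BD])
    and a class [GOS] that constrains the gradient alone, so that constants in xi such as
    ln|eps/alpha| and C(t) disappear. The invariance of B is not that of each component about its
    own origin: [hatX] generates, in the coordinates of either vortex, the rotation about the common
    centre of vorticity, and the shift carries one description into the other. In the residual, the
    coefficients of nu and nu^2 are never estimated. A fixed combination of three values eliminates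
    them exactly; being finite, it stays in the O-class with all derivatives, and no limit nu -> 0
    has to be exchanged with a derivative. What remains is to compare two truncations of theta and
    alpha. *)

Definition rdist x z : R := Num.max `|z.1 - x.1| `|z.2 - x.2|.

Definition box x (r : R) : set mplane :=
  `[x.1 - r, x.1 + r]%classic `*` `[x.2 - r, x.2 + r]%classic.

Lemma boxP x r z : reflect (box x r z) (rdist x z <= r).
Proof.
rewrite /box /rdist ge_max !ler_norml; apply: (iffP idP) => /=.
  by move=> /andP[/andP[? ?] /andP[? ?]]; split; rewrite /= in_itv /=; apply/andP; split; lra.
by rewrite !in_itv /= => -[/andP[? ?] /andP[? ?]]; apply/andP; split; apply/andP; split; lra.
Qed.

Lemma measurable_box x r : measurable (box x r).
Proof. by apply: measurableX; exact: measurable_itv. Qed.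

Lemma leb2_box x r : 0 <= r -> leb2 (box x r) = (4 * r ^+ 2)%:E.
Proof.
move=> r0; rewrite /leb2 product_measure1E //= !lebesgue_measure_itv /=.
move: r0; rewrite le_eqVlt => /orP[/eqP <-|r0].
  by rewrite !subr0 !addr0 !lte_fin !ltxx mule0 expr0n mulr0.
rewrite !lte_fin !ifT; [|lra|lra].
by rewrite -!EFinB -EFinM; congr EFin; ring.
Qed.

(** A substitute for polar coordinates: the integral is a series in areas of squares, geometric for
    suitable [a] and [r], while the value at a point dominates the weight of any single square that
    contains it. *)
Definition bumps (a r : nat -> R) x (z : mplane) : \bar R :=
  (\sum_(n <oo) (a n * \1_(box x (r n)) z)%:E)%E.

Lemma bump_ge0 (a r : nat -> R) x (z : mplane) n : (forall n, 0 <= a n) ->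
  (0 <= (a n * \1_(box x (r n)) z)%:E)%E.
Proof. by move=> a0; rewrite lee_fin mulr_ge0. Qed.

Lemma bumps_ge0 (a r : nat -> R) x z : (forall n, 0 <= a n) ->
  (0 <= bumps a r x z)%E.
Proof. by move=> a0; apply: nneseries_ge0 => n _ _; exact: bump_ge0. Qed.

Lemma measurable_bump (a r : nat -> R) x n :
  measurable_fun setT ((fun z => (a n * \1_(box x (r n)) z)%:E) : mplane -> \bar R).
Proof.
apply/measurable_EFinP; apply: measurable_funM => //.
by apply: measurable_indic; exact: measurable_box.
Qed.

Lemma measurable_bumps (a r : nat -> R) x : (forall n, 0 <= a n) ->
  measurable_fun setT (bumps a r x : mplane -> \bar R).
Proof.
move=> a0; apply: ge0_emeasurable_sum => //.
  by move=> n z _ _; exact: bump_ge0.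
by move=> n _; exact: measurable_bump.
Qed.

Lemma integral_bumps (a r : nat -> R) x (K q : R) : (forall n, 0 <= a n) ->
  (forall n, 0 <= r n) -> 0 <= q < 1 ->
  (forall n, a n * (4 * r n ^+ 2) = K * q ^+ n) ->
  (\int[leb2]_z bumps a r x z)%E = (K / (1 - q))%:E.
Proof.
move=> a0 r0 /andP[q0 q1] arE; rewrite /bumps integral_nneseries //; last 2 first.
- by move=> n; exact: measurable_bump.
- by move=> n z _; exact: bump_ge0.
have intE n : (\int[leb2]_z (a n * \1_(box x (r n)) z)%:E)%E = (K * q ^+ n)%:E.
  under eq_integral do rewrite EFinM.
  rewrite ge0_integralZl_EFin //; last first.
    by apply/measurable_EFinP; apply: measurable_indic; exact: measurable_box.
  rewrite integral_indic //; last exact: measurable_box.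
  by rewrite setIT [X in (_ * X)%E](leb2_box x (r0 n)) -EFinM arE.
under eq_eseriesr do rewrite intE.
have /cvg_lim <- // : (\sum_(0 <= i < k) (K * q ^+ i)%:E)%E @[k --> \oo] --> (K / (1 - q))%:E.
apply: cvg_EFin; first by apply: nearW => k; rewrite sumEFin.
have := @cvg_geometric_series R K q; rewrite ger0_norm // => /(_ q1).
apply: cvg_trans; apply: near_eq_cvg; apply: nearW => k /=.
by rewrite sumEFin.
Qed.

Lemma bumps_ge (a r : nat -> R) x z n : (forall n, 0 <= a n) ->
  rdist x z <= r n -> ((a n)%:E <= bumps a r x z)%E.
Proof.
move=> a0 xz; rewrite /bumps.
apply: le_trans (@nneseries_lim_ge _ _ xpredT 0 n.+1 _); last first.
  by move=> k _ _; exact: bump_ge0.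
rewrite big_nat_recr //= indicE.
have -> : (z \in box x (r n)) = true by apply/mem_set/boxP.
rewrite mulr1 leeDr //; apply: sume_ge0 => k _; exact: bump_ge0.
Qed.

Lemma dyadic_near (s : R) : 0 < s <= 1 ->
  exists n, 2^-1 ^+ n.+1 < s <= 2^-1 ^+ n.
Proof.
move=> /andP[s0 s1].
have [N _ /(_ N (leqnn N)) HN] := near_infty_natSinv_expn_lt (PosNum s0).
have ex : exists n, 2^-1 ^+ n < s.
  by exists N; rewrite exprVn; move: HN => /=; rewrite mul1r -natrX.
case: (ex_minnP ex) => -[|n] Hn Hmin; first by rewrite expr0 in Hn; lra.
exists n; rewrite Hn /= leNgt; apply/negP => /Hmin; by rewrite ltnn.
Qed.

Lemma dyadic_far (s : R) : 1 < s -> exists n, 2 ^+ n <= s <= 2 ^+ n.+1.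
Proof.
move=> s1; have s0 : 0 < s^-1 by rewrite invr_gt0; lra.
have [|n /andP[H1 H2]] := @dyadic_near s^-1.
  by rewrite s0 /= invf_le1; lra.
have p k : 0 < 2 ^+ k :> R by rewrite exprn_gt0.
exists n; move: H1 H2; rewrite !exprVn ltf_pV2 ?posrE ?lef_pV2 ?posrE //; try lra.
Qed.

End MeasurePlane.

(** * Measurability on the plane and an integrable majorant of the singular kernel *)

Section LogKernel.
Context {R : realType}.
Implicit Types (x y z h u v : plane R).

Notation mplane := (measurableTypeR R * measurableTypeR R)%type.

(** An open set is the union of the squares with rational centre and radius 1/(N+1) that it
    contains. In this way continuity yields measurability for the product structure on which [leb2]
    lives. *)
Lemma open_measurable_plane (A : set (R * R)) : open A -> measurable (A : set mplane).
Proof.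
move=> oA.
pose F (i : rat * rat * nat) : set mplane :=
  let b := box (ratr i.1.1, ratr i.1.2) (i.2.+1%:R^-1 : R) in
  if `[< b `<=` A >] then b else set0.
suff -> : A = \bigcup_i F i.
  apply: countable_bigcupT_measurable; first exact: countableP.
  by move=> i; rewrite /F; case: ifP => // _; exact: measurable_box.
apply/seteqP; split => [x Ax|x [i _]]; last first.
  by rewrite /F; case: ifP => // /asboolP; apply.
have [e /= e0 eA] : nbhs_ball x A by apply/nbhs_ballP; exact: open_nbhs_nbhs.
have e2 : 0 < e / 2 by lra.
have [N _ /(_ N (leqnn N)) /= HN] := near_infty_natSinv_lt (PosNum e2).
have r0 : 0 < N.+1%:R^-1 :> R by rewrite invr_gt0 ltr0n.
have ex (a : R) : exists q : rat, `|a - ratr q| < N.+1%:R^-1.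
  have lt : a - N.+1%:R^-1 < a + N.+1%:R^-1.
    by rewrite ltrD2l; apply: lt_trans r0; rewrite oppr_lt0.
  have [q] := rat_in_itvoo lt.
  by rewrite in_itv /= => /andP[? ?]; exists q; rewrite ltr_distlC; apply/andP.
have [q1 h1] := ex x.1; have [q2 h2] := ex x.2.
exists ((q1, q2), N) => //; rewrite /F /= ifT; last first.
  apply/asboolP => z /boxP; rewrite /rdist /= ge_max => /andP[b1 b2].
  have tri (u v q r : R) : `|u - q| < r -> `|v - q| <= r -> r < e / 2 -> `|u - v| < e.
    by have := ler_distD q u v; rewrite (distrC q v); lra.
  apply: eA; split; rewrite /ball /=; [exact: tri h1 b1 HN|exact: tri h2 b2 HN].
by apply/boxP; rewrite /rdist /= ge_max; apply/andP; split; apply: ltW.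
Qed.

Lemma continuous_measurable_plane (f : R * R -> R) : continuous f ->
  measurable_fun setT (f : mplane -> R).
Proof.
move=> /continuousP cf; apply: (measurability _ (RGenOpens.measurableE R)).
move=> /= _ [_ [a [b ->]] <-]; rewrite setTI; apply: open_measurable_plane.
by apply: cf; exact: interval_open.
Qed.

Definition nsq z : R := z.1 ^+ 2 + z.2 ^+ 2.
Definition norm1 z : R := `|z.1| + `|z.2|.
(** The weight in which decay is measured. A density bounded by [dec ^+ 3] has a logarithmic
    potential: one power pays for the growth of the logarithm, two for integrability. *)
Definition dec z : R := (1 + nsq z)^-1.
Definition logk z : R := ln (enorm z).
Definition psub x y : plane R := (x.1 - y.1, x.2 - y.2).
Definition padd x y : plane R := (x.1 + y.1, x.2 + y.2).

Lemma nsq_ge0 z : 0 <= nsq z.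
Proof. by rewrite /nsq addr_ge0 ?sqr_ge0. Qed.

Lemma enorm_ge0 z : 0 <= enorm z.
Proof. exact: sqrtr_ge0. Qed.

Lemma enorm_sqr z : enorm z ^+ 2 = nsq z.
Proof. by rewrite sqr_sqrtr // nsq_ge0. Qed.

Lemma norm1_ge0 z : 0 <= norm1 z.
Proof. by rewrite addr_ge0. Qed.

Lemma norm1_sqr z : norm1 z ^+ 2 <= 2 * nsq z.
Proof.
rewrite /norm1 /nsq -(real_normK (num_real z.1)) -(real_normK (num_real z.2)).
have := sqr_ge0 (`|z.1| - `|z.2|); nra.
Qed.

Lemma enorm_le_norm1 z : enorm z <= norm1 z.
Proof.
rewrite -(ler_pXn2r (ltn0Sn 1)) ?nnegrE ?enorm_ge0 ?norm1_ge0 // enorm_sqr /norm1 /nsq.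
rewrite -(real_normK (num_real z.1)) -(real_normK (num_real z.2)).
have := normr_ge0 z.1; have := normr_ge0 z.2; nra.
Qed.

Lemma norm_le_enorm z : `|z.1| <= enorm z /\ `|z.2| <= enorm z.
Proof.
split; rewrite -(ler_pXn2r (ltn0Sn 1)) ?nnegrE ?enorm_ge0 // enorm_sqr real_normK ?num_real //.
  by rewrite /nsq lerDl sqr_ge0.
by rewrite /nsq lerDr sqr_ge0.
Qed.

Lemma norm1_le_nsq z : norm1 z <= 1 + nsq z.
Proof.
rewrite /norm1 /nsq -(real_normK (num_real z.1)) -(real_normK (num_real z.2)).
have := sqr_ge0 (`|z.1| - 2^-1); have := sqr_ge0 (`|z.2| - 2^-1); nra.
Qed.

Lemma rdist_le_enorm x y : rdist x y <= enorm (psub x y).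
Proof.
by have [? ?] := norm_le_enorm (psub x y); rewrite /rdist ge_max distrC [`|y.2 - _|]distrC; apply/andP.
Qed.

Lemma dec_gt0 z : 0 < dec z.
Proof. by rewrite invr_gt0; have := nsq_ge0 z; lra. Qed.

Lemma dec_le1 z : dec z <= 1.
Proof. by rewrite invf_le1; have := nsq_ge0 z; lra. Qed.

Lemma dec_eq z : (1 + nsq z) * dec z = 1.
Proof. by rewrite mulfV //; have := nsq_ge0 z; lra. Qed.

(** Weight 2^n on the square of radius 2^-n: the sum is of order 1/|x - z| near [x], and the n-th
    square contributes 4 * 2^-n to the integral. In [far_bumps] the n-th contribution is 64 *
    4^-n. *)
Definition near_bumps x := bumps (fun n => 2 ^+ n) (fun n => 2^-1 ^+ n : R) x.
Definition far_bumps := bumps (fun n => 16 * 16^-1 ^+ n) (fun n => 2 ^+ n : R) 0.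

(** [c] plays the role of 1/|x - z| and is free when [z = x]. If 2^n <= c <= 2^(n+1), then [z] lies
    in the square of radius 2^-n, whence the factor 2; the summand 1 covers c <= 1. *)
Lemma near_bumps_ge x z (c : R) : 0 <= c -> rdist x z * c <= 1 ->
  (c%:E <= 2%:E * near_bumps x z + 1)%E.
Proof.
have p2 n : 0 <= 2 ^+ n :> R by rewrite exprn_ge0.
have nb0 : (0 <= near_bumps x z)%E by exact: bumps_ge0.
move=> c0 xzc; have d0 : 0 <= rdist x z by rewrite /rdist le_max normr_ge0.
have [c1|c1] := leP c 1.
  apply: (@le_trans _ _ (1%:E)); first by rewrite lee_fin.
  by rewrite leeDr // mule_ge0.
suff [n xn cn] : exists2 n, rdist x z <= 2^-1 ^+ n & c <= 2 * 2 ^+ n.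
  apply: (@le_trans _ _ (2 * 2 ^+ n)%:E); first by rewrite lee_fin.
  apply: (@le_trans _ _ (2%:E * near_bumps x z)%E); last by rewrite leeDl.
  by rewrite EFinM lee_pmul2l // bumps_ge.
have [n /andP[H1 H2]] := dyadic_far c1; exists n; last by rewrite -exprS.
have q0 : 0 < 2 ^+ n :> R by rewrite exprn_gt0.
by rewrite exprVn -(ler_pM2r q0) mulVf ?gt_eqF //; nra.
Qed.

Lemma far_bumps_ge z : ((dec z ^+ 2)%:E <= far_bumps z)%E.
Proof.
have p2 n : 0 <= 16 * 16^-1 ^+ n :> R by rewrite mulr_ge0 ?exprn_ge0.
have := dec_gt0 z; have := dec_le1 z; move=> d1 d0.
have sq t : 0 <= t -> t <= rdist 0 z -> t ^+ 2 <= nsq z.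
  move=> t0; rewrite /rdist le_max /= !subr0 /nsq => /orP[] tz.
    by rewrite -(real_normK (num_real z.1)); have := sqr_ge0 z.2; nra.
  by rewrite -(real_normK (num_real z.2)); have := sqr_ge0 z.1; nra.
suff [n xn cn] : exists2 n, rdist 0 z <= 2 ^+ n & dec z ^+ 2 <= 16 * 16^-1 ^+ n.
  apply: (@le_trans _ _ (16 * 16^-1 ^+ n)%:E); first by rewrite lee_fin.
  exact: bumps_ge.
have [c1|c1] := leP (rdist 0 z) 1.
  by exists 0; rewrite ?expr0 //; nra.
(* Here 2^n <= rdist 0 z <= 2^(n+1), so [z] lies in the square of index n + 1 and dec z <= 4^-n. The
   prefactor 16 of [far_bumps] compensates this index shift. *)
have [n /andP[H1 H2]] := dyadic_far c1; exists n.+1 => //.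
have q0 : 0 < 2 ^+ n :> R by rewrite exprn_gt0.
have := sq _ (ltW q0) H1 => H.
have -> : 16 * (16^-1 : R) ^+ n.+1 = ((2 ^+ n) ^+ 2)^-1 ^+ 2.
  rewrite exprS mulrA mulfV // mul1r (_ : 16 = 2 ^+ 4); last by rewrite -natrX.
  by rewrite -!exprVn -!exprM; congr (_ ^+ _); lia.
have n0 := nsq_ge0 z.
rewrite ler_pXn2r ?nnegrE ?invr_ge0 ?sqr_ge0 ?(ltW d0) //; last by lra.
by rewrite /dec lef_pV2 ?posrE ?exprn_gt0 //; have := nsq_ge0 z; lra.
Qed.

(* Integrable majorant, uniformly in [x], of [dec ^+ 2] times the singular
   kernel [1 / |x - z|]. *)
Definition kernel_maj x z : \bar R := (2%:E * near_bumps x z + far_bumps z)%E.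

Lemma kernel_maj_ge0 x z : (0 <= kernel_maj x z)%E.
Proof.
by rewrite adde_ge0 ?mule_ge0 // bumps_ge0 // => n; rewrite ?mulr_ge0 ?exprn_ge0.
Qed.

Lemma kernel_maj_ge x z (c : R) : 0 <= c -> rdist x z * c <= 1 ->
  ((c * dec z ^+ 2)%:E <= kernel_maj x z)%E.
Proof.
move=> c0 xzc; rewrite EFinM.
have d2 : (0 <= (dec z ^+ 2)%:E)%E by rewrite lee_fin sqr_ge0.
apply: (le_trans (lee_wpmul2r d2 (near_bumps_ge c0 xzc))).
have nb0 : (0 <= near_bumps x z)%E by apply: bumps_ge0 => n; rewrite exprn_ge0.
rewrite ge0_muleDl ?mule_ge0 // mul1e leeD //; last exact: far_bumps_ge.
rewrite -[leRHS]mule1 lee_wpmul2l ?mule_ge0 // lee_fin.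
by have := dec_gt0 z; have := dec_le1 z; nra.
Qed.

Lemma kernel_maj_ge_dec x z : ((dec z ^+ 2)%:E <= kernel_maj x z)%E.
Proof.
apply: (le_trans (far_bumps_ge z)); rewrite leeDr // mule_ge0 //.
by apply: bumps_ge0 => n; rewrite exprn_ge0.
Qed.

Lemma measurable_kernel_maj x :
  measurable_fun setT (kernel_maj x : mplane -> \bar R).
Proof.
apply: emeasurable_funD.
  by apply: measurable_funeM; apply: measurable_bumps => n; rewrite exprn_ge0.
by apply: measurable_bumps => n; rewrite mulr_ge0 ?exprn_ge0.
Qed.

(** The near part contributes 2 * 8 and the far part 64 * 4/3. Nothing depends on [x], because the
    squares around different points are translates of one another. *)
Lemma integral_kernel_maj x : (\int[leb2]_z kernel_maj x z <= 102%:E)%E.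
Proof.
have p n : 0 <= 2 ^+ n :> R by rewrite exprn_ge0.
have p' n : 0 <= 2^-1 ^+ n :> R by rewrite exprn_ge0.
have p16 n : 0 <= 16 * 16^-1 ^+ n :> R by rewrite mulr_ge0 ?exprn_ge0.
rewrite ge0_integralD //; last 4 first.
- by move=> z _; rewrite mule_ge0 // bumps_ge0.
- by apply: measurable_funeM; exact: measurable_bumps.
- by move=> z _; rewrite bumps_ge0.
- exact: measurable_bumps.
rewrite ge0_integralZl_EFin //; last 2 first.
- by move=> z _; rewrite bumps_ge0.
- exact: measurable_bumps.
rewrite (@integral_bumps _ _ _ x 4 2^-1) //; last 2 first.
- by apply/andP; split; lra.
- by move=> n; rewrite !exprVn; field; rewrite expf_neq0.
rewrite (@integral_bumps _ _ _ 0 64 4^-1) //; last 2 first.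
- by apply/andP; split; lra.
- move=> n; rewrite (_ : 16 = 4 * 4) // ?invfM ?exprMn; last by rewrite -natrM.
  rewrite (_ : 2 ^+ n ^+ 2 = 4 ^+ n :> R) ?exprVn; last by rewrite -exprM mulnC exprM -natrX.
  by field; rewrite expf_neq0.
have e1 : (1 - 2^-1)^-1 = 2 :> R by rewrite (_ : 1 - 2^-1 = 2^-1) ?invrK //; lra.
have e2 : (1 - 4^-1)^-1 = 4 / 3 :> R by rewrite (_ : 1 - 4^-1 = 3 / 4) ?invf_div //; lra.
by rewrite e1 e2 -EFinM -EFinD lee_fin; lra.
Qed.

Lemma int2_majorized (g : mplane -> R) (B : mplane -> \bar R) (c : R) :
  measurable_fun setT g -> measurable_fun setT B ->
  (forall z, (`|g z|%:E <= B z)%E) -> (\int[leb2]_z B z <= c%:E)%E ->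
  leb2.-integrable setT (EFin \o g) /\ `|int2 g| <= c.
Proof.
move=> mg mB gB Bc.
have le_c : (\int[leb2]_z `|g z|%:E <= c%:E)%E.
  apply: le_trans Bc; apply: ge0_le_integral => //.
  by apply/measurable_EFinP; apply: measurableT_comp.
have ig : leb2.-integrable setT (EFin \o g).
  apply/integrableP; split; first exact/measurable_EFinP.
  by apply: le_lt_trans le_c _; rewrite ltry.
split=> //; apply: (le_trans (le_normr_Rintegral _ ig)) => //.
rewrite /Rintegral -lee_fin fineK // ge0_fin_numE; last exact: integral_ge0.
by apply: le_lt_trans le_c _; rewrite ltry.
Qed.

(** Two centres serve differences of logarithms based at [x] and at [y]; the case x = y serves a
    single logarithm. Each centre costs 102. *)
Lemma int2_kernel_maj (g : mplane -> R) x y (c : R) : 0 <= c ->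
  measurable_fun setT g ->
  (forall z, (`|g z|%:E <= c%:E * (kernel_maj x z + kernel_maj y z))%E) ->
  leb2.-integrable setT (EFin \o g) /\ `|int2 g| <= 204 * c.
Proof.
move=> c0 mg gB; have m := measurable_kernel_maj.
apply: (@int2_majorized _ _ _ mg _ gB).
  by apply: measurable_funeM; apply: emeasurable_funD.
rewrite ge0_integralZl_EFin //; last 2 first.
- by move=> z _; rewrite adde_ge0 // kernel_maj_ge0.
- exact: emeasurable_funD.
rewrite ge0_integralD //; try by move=> z _; rewrite kernel_maj_ge0.
have -> : 204 * c = c * (102 + 102) by lra.
by rewrite EFinM EFinD; apply: lee_wpmul2l => //; apply: leeD; exact: integral_kernel_maj.
Qed.

End LogKernel.

(** * Size and Lipschitz bounds for logarithmic integrals *)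

Section LogKernelBounds.
Context {R : realType}.
Implicit Types (x y z h u v : plane R).

Notation mplane := (measurableTypeR R * measurableTypeR R)%type.

Lemma enorm_eq0 z : enorm z = 0 -> z = 0.
Proof.
have [] := norm_le_enorm z; case: z => a b /= + + e; rewrite e !normr_le0 => /eqP -> /eqP ->.
by [].
Qed.

Lemma enorm0 : enorm (0 : plane R) = 0.
Proof. by rewrite /enorm /= expr0n /= addr0 sqrtr0. Qed.

Lemma enorm_dist u v : `|enorm u - enorm v| <= norm1 (psub u v).
Proof.
have [[u1 u2] [v1 v2]] := (norm_le_enorm u, norm_le_enorm v).
have := enorm_ge0 u; have := enorm_ge0 v.
rewrite le_eqVlt => /orP[/eqP e _|].
  have v0 := enorm_eq0 (esym e); rewrite v0 enorm0 subr0 ger0_norm ?enorm_ge0 //.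
  by rewrite (le_trans (enorm_le_norm1 u)) // /norm1 /psub /= !subr0.
move=> v0 u0; have s0 : 0 < enorm u + enorm v by lra.
rewrite -(ler_pM2r s0) -{1}(gtr0_norm s0) -normrM.
rewrite (_ : _ * _ = (u.1 - v.1) * (u.1 + v.1) + (u.2 - v.2) * (u.2 + v.2)); last first.
  by rewrite -subr_sqr !enorm_sqr /nsq; ring.
apply: (le_trans (ler_normD _ _)); rewrite !normrM /norm1 /psub /= mulrDl.
by apply: lerD; apply: ler_wpM2l => //; apply: (le_trans (ler_normD _ _)); lra.
Qed.

Lemma ln_diff_le (a b : R) : 0 < a -> 0 < b -> ln a - ln b <= `|a - b| * b^-1.
Proof.
move=> a0 b0; rewrite -ln_div ?posrE //.
have -> : a / b = 1 + (a - b) / b by field; lra.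
apply: (@le_trans _ _ ((a - b) / b)).
  apply: le_ln1Dx; have : 0 < a / b by rewrite divr_gt0.
  by rewrite mulrBl divff ?gt_eqF //; lra.
by apply: ler_wpM2r; [rewrite invr_ge0; lra|exact: ler_norm].
Qed.

(** Sublinearity of the logarithm at [a] and at 1/a; at 0 both sides vanish by the default values of
    [ln] and of the inverse. *)
Lemma normr_ln (a : R) : 0 <= a -> `|ln a| <= a + a^-1.
Proof.
rewrite le_eqVlt => /orP[/eqP <-|a0]; first by rewrite ln0 // normr0 invr0 addr0.
have ai : 0 < a^-1 by rewrite invr_gt0.
have := ln_sublinear a0; have := ln_sublinear ai.
by rewrite lnV ?posrE // ler_norml => ? ?; apply/andP; split; lra.
Qed.

Lemma rdist_enormV x y : rdist x y * (enorm (psub x y))^-1 <= 1.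
Proof.
have := enorm_ge0 (psub x y); rewrite le_eqVlt => /orP[/eqP <-|e0].
  by rewrite invr0 mulr0.
by rewrite ler_pdivrMr // mul1r rdist_le_enorm.
Qed.

Lemma psub_eq0 x y : psub x y = 0 -> rdist x y = 0.
Proof.
case: x y => [a b] [c d] /= [/subr0_eq -> /subr0_eq ->].
by rewrite /rdist /= !subrr normr0 maxxx.
Qed.

(* The weights [c1] and [c2] stand for [1 / |x - z|] and [1 / |y - z|]; they
   are left unspecified at the poles [z = x] and [z = y]. *)
Lemma logk_diff x y z : exists c1 c2 : R,
  [/\ 0 <= c1, 0 <= c2, rdist x z * c1 <= 1, rdist y z * c2 <= 1 &
      `|logk (psub x z) - logk (psub y z)| <= norm1 (psub x y) * (c1 + c2)].
Proof.
have hxy : psub (psub x z) (psub y z) = psub x y by rewrite /psub /=; congr pair; ring.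
have := enorm_dist (psub x z) (psub y z); rewrite hxy => D.
set h := norm1 _ in D *; have h0 : 0 <= h by exact: norm1_ge0.
have i0 u : 0 <= (enorm u)^-1 by rewrite invr_ge0 enorm_ge0.
pose c := `|logk (psub x z) - logk (psub y z)| / h.
have c0 : 0 <= c by rewrite divr_ge0.
have hc : h != 0 -> h * c = `|logk (psub x z) - logk (psub y z)|.
  by move=> hn; rewrite /c mulrC mulfVK.
have [ex|ex] := eqVneq (enorm (psub x z)) 0.
  have x0 := psub_eq0 (enorm_eq0 ex).
  exists c, 0; rewrite x0 mul0r mulr0 addr0; split=> //.
  have [e|/hc -> //] := eqVneq h 0; rewrite e mul0r.
  have := D; rewrite e normr_le0 subr_eq0 => /eqP e'.
  by rewrite /logk e' subrr normr0.
have [ey|ey] := eqVneq (enorm (psub y z)) 0.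
  have x0 := psub_eq0 (enorm_eq0 ey).
  exists 0, c; rewrite x0 mul0r mulr0 add0r; split=> //.
  have [e|/hc -> //] := eqVneq h 0; rewrite e mul0r.
  have := D; rewrite e normr_le0 subr_eq0 => /eqP e'.
  by rewrite /logk e' subrr normr0.
exists (enorm (psub x z))^-1, (enorm (psub y z))^-1.
split; rewrite ?rdist_enormV //.
have px : 0 < enorm (psub x z) by rewrite lt_neqAle eq_sym ex enorm_ge0.
have py : 0 < enorm (psub y z) by rewrite lt_neqAle eq_sym ey enorm_ge0.
have := ln_diff_le px py; have := ln_diff_le py px.
rewrite (distrC (enorm (psub y z))) => A B.
have := i0 (psub x z); have := i0 (psub y z) => a b.
have {}A := le_trans A (ler_wpM2r b D); have {}B := le_trans B (ler_wpM2r a D).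
have ha := mulr_ge0 h0 a; have hb := mulr_ge0 h0 b.
by rewrite /logk ler_norml mulrDr; apply/andP; split; lra.
Qed.

Lemma continuous_enorm : continuous (fun z : R * R => enorm z).
Proof.
move=> z; rewrite /enorm; apply: continuous_comp; last exact: sqrt_continuous.
by apply: cvgD; [apply: (cvgM cvg_fst cvg_fst)|apply: (cvgM cvg_snd cvg_snd)].
Qed.

Lemma measurable_logk : measurable_fun setT (fun z : mplane => logk z).
Proof.
have me := continuous_measurable_plane continuous_enorm.
exact: (measurableT_comp (@measurable_ln R) me).
Qed.

Lemma measurable_psub x : measurable_fun setT (fun z : mplane => psub x z : mplane).
Proof. by apply: measurable_fun_pair; apply: measurable_funB. Qed.

Lemma measurable_logk_psub x (f : mplane -> R) : measurable_fun setT f ->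
  measurable_fun setT (fun z : mplane => logk (psub x z) * f z).
Proof.
move=> mf; apply: measurable_funM => //.
exact: (measurableT_comp measurable_logk (measurable_psub x)).
Qed.

Lemma logk_int2_bound x (f : mplane -> R) (K : R) : measurable_fun setT f ->
  0 <= K -> (forall z, `|f z| <= K * dec z ^+ 3) ->
  leb2.-integrable setT (EFin \o (fun z : mplane => logk (psub x z) * f z)) /\
  `|int2 (fun z => logk (psub x z) * f z)| <= 204 * (K * (1 + norm1 x)).
Proof.
move=> mf K0 fK; have x0 := norm1_ge0 x.
apply: (@int2_kernel_maj _ _ x x) => [||z].
- by rewrite mulr_ge0 ?addr_ge0.
- exact: measurable_logk_psub.
pose e := (enorm (psub x z))^-1.
have e0 : 0 <= e by rewrite invr_ge0 enorm_ge0.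
have d0 := dec_gt0 z; have d1 := dec_le1 z.
have -> : (K * (1 + norm1 x))%:E = (K%:E * (1 + norm1 x)%:E)%E by rewrite EFinM.
apply: (@le_trans _ _ (K * (1 + norm1 x) * (e * dec z ^+ 2 + dec z ^+ 2))%:E); last first.
  rewrite EFinM EFinM; apply: lee_wpmul2l.
    by rewrite -EFinM lee_fin mulr_ge0 ?addr_ge0.
  rewrite EFinD; apply: leeD; last exact: kernel_maj_ge_dec.
  by apply: kernel_maj_ge => //; exact: rdist_enormV.
rewrite lee_fin normrM.
(* One power of the weight absorbs the logarithm: in |ln s| <= s + 1/s with s = |x - z|, the part s
   is at most a multiple of 1 + |z|^2, and 1/s is left to the majorant. *)
have lk : `|logk (psub x z)| * dec z <= (1 + norm1 x) * (e + 1).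
  have := normr_ln (enorm_ge0 (psub x z)); rewrite -/(logk _) -/e => L.
  have T : enorm (psub x z) <= norm1 x + (1 + nsq z).
    apply: (le_trans (enorm_le_norm1 _)); apply: (@le_trans _ _ (norm1 x + norm1 z)).
      rewrite /norm1 /psub /=; have := ler_normB x.1 z.1; have := ler_normB x.2 z.2; lra.
    by rewrite lerD2l norm1_le_nsq.
  apply: (@le_trans _ _ ((norm1 x + (1 + nsq z) + e) * dec z)).
    by apply: ler_wpM2r; [exact: ltW|lra].
  rewrite 2!mulrDl dec_eq; nra.
have := ler_pM (mulr_ge0 (normr_ge0 (logk (psub x z))) (ltW d0)) _ lk (lexx (K * dec z ^+ 2)).
rewrite mulr_ge0 ?sqr_ge0 // => /(_ isT) P.
apply: (@le_trans _ _ (`|logk (psub x z)| * (K * dec z ^+ 3))).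
  exact: ler_wpM2l.
by move: P; rewrite !exprS expr0 !mulr1; lra.
Qed.

(** The constant depends on neither point, whereas the integral itself grows with [x]. This is the
    source of all gradient bounds that survive the shift. *)
Lemma logk_int2_lipschitz x y (f : mplane -> R) (K : R) : measurable_fun setT f ->
  0 <= K -> (forall z, `|f z| <= K * dec z ^+ 3) ->
  `|int2 (fun z => logk (psub x z) * f z) - int2 (fun z => logk (psub y z) * f z)|
    <= 204 * K * norm1 (psub x y).
Proof.
move=> mf K0 fK.
have [ix _] := logk_int2_bound x mf K0 fK; have [iy _] := logk_int2_bound y mf K0 fK.
rewrite /int2 -RintegralB // -mulrA.
apply: (proj2 (@int2_kernel_maj _ _ x y (K * norm1 (psub x y)) _ _ _)) => [||z].
- by rewrite mulr_ge0 ?norm1_ge0.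
- by apply: measurable_funB; exact: measurable_logk_psub.
have [c1 [c2 [c10 c20 xc yc L]]] := logk_diff x y z.
have d0 := dec_gt0 z; have d1 := dec_le1 z.
apply: (@le_trans _ _ (K * norm1 (psub x y) * (c1 * dec z ^+ 2 + c2 * dec z ^+ 2))%:E); last first.
  rewrite EFinM; apply: lee_wpmul2l; first by rewrite lee_fin mulr_ge0 ?norm1_ge0.
  by rewrite EFinD; apply: leeD; exact: kernel_maj_ge.
rewrite lee_fin -mulrBl normrM.
apply: (@le_trans _ _ (norm1 (psub x y) * (c1 + c2) * (K * dec z ^+ 2))).
  apply: ler_pM => //; apply: (le_trans (fK z)); apply: ler_wpM2l => //.
  by rewrite exprS; have := sqr_ge0 (dec z); nra.
by rewrite le_eqVlt; apply/orP; left; apply/eqP; ring.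
Qed.

End LogKernelBounds.

(** * Area-preserving affine maps and change of variables *)

Section PreservingMaps.
Context {R : realType}.
Implicit Types (x y z h u v : plane R).

Notation mplane := (measurableTypeR R * measurableTypeR R)%type.
Notation mu := (@lebesgue_measure R).

(** Lebesgue measure is determined by half-open intervals, so only ]a, b] is checked; for s = -1 its
    preimage is closed at the other end, which leaves the length unchanged. *)
Lemma lebesgue_preimage_affine (s c : R) : s = 1 \/ s = -1 ->
  forall A : set (measurableTypeR R), measurable A ->
  mu ((fun t : measurableTypeR R => c + s * t : measurableTypeR R) @^-1` A) = mu A.
Proof.
move=> hs A mA; set T := (fun t : measurableTypeR R => c + s * t : measurableTypeR R).
have mT : measurable_fun setT T.
  by apply: measurable_funD => //; apply: measurable_funM.
pose nu : {measure set (measurableTypeR R) -> \bar R} :=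
  [the {measure set (measurableTypeR R) -> \bar R} of pushforward mu T].
rewrite -[LHS]/(pushforward mu T A); symmetry.
have := @lebesgue_measure_unique R (pushforward mu T) _ A mA; apply.
move=> _ [[a b] _ <-]; rewrite -[RHS]/(mu (T @^-1` `]a, b]%classic)) -[LHS]/(mu `]a, b]%classic).
case: hs => hs.
  have -> : T @^-1` `]a, b]%classic = `]a - c, b - c]%classic.
    by apply/seteqP; split => t; rewrite /T /= !in_itv /= hs => /andP[? ?]; apply/andP; split; lra.
  rewrite !lebesgue_measure_itv /= !lte_fin ltrD2r.
  by case: ifP => // _; rewrite -!EFinB; congr EFin; ring.
have -> : T @^-1` `]a, b]%classic = `[c - b, c - a[%classic.
  by apply/seteqP; split => t; rewrite /T /= !in_itv /= hs => /andP[? ?]; apply/andP; split; lra.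
rewrite !lebesgue_measure_itv /= !lte_fin ltrD2l ltrN2.
by case: ifP => // _; rewrite -!EFinB; congr EFin; ring.
Qed.

Definition preserves_leb2 (T : mplane -> mplane) : Prop :=
  measurable_fun setT T /\
  forall A, measurable A -> leb2 (T @^-1` A) = leb2 A.

Lemma preserves_leb2_comp (S T : mplane -> mplane) :
  preserves_leb2 S -> preserves_leb2 T -> preserves_leb2 (S \o T).
Proof.
move=> [mS pS] [mT pT]; split; first exact: measurableT_comp.
move=> A mA; rewrite comp_preimage pT ?pS //.
by rewrite -[X in measurable X]setTI; exact: mS.
Qed.

Lemma int2_preserved (T : mplane -> mplane) (f : mplane -> R) :
  preserves_leb2 T -> measurable_fun setT f ->
  leb2.-integrable setT (EFin \o (f \o T)) -> int2 (f \o T) = int2 f.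
Proof.
move=> [mT pT] mf iT; rewrite /int2 /Rintegral; congr fine.
have mf' : measurable_fun setT (EFin \o f) by exact/measurable_EFinP.
have iT' : leb2.-integrable (T @^-1` setT) ((EFin \o f) \o T) by rewrite preimage_setT.
have E := integral_pushforward mT mf' iT' measurableT.
rewrite preimage_setT in E; apply: etrans (esym E) _.
by apply: eq_measure_integral => A mA _; exact: pT.
Qed.

Lemma preserves_leb2_psub x : preserves_leb2 (psub x : mplane -> mplane).
Proof.
split; first exact: measurable_psub.
move=> A mA; symmetry.
have mT := measurable_psub x.
rewrite -[RHS]/(pushforward leb2 (psub x : mplane -> mplane) A).
apply: product_measure_unique => // B C mB mC.
rewrite -[LHS]/(leb2 ((psub x : mplane -> mplane) @^-1` (B `*` C))).
have -> : (psub x : mplane -> mplane) @^-1` (B `*` C) =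
  ((fun t : measurableTypeR R => x.1 + (-1) * t : measurableTypeR R) @^-1` B) `*`
  ((fun t : measurableTypeR R => x.2 + (-1) * t : measurableTypeR R) @^-1` C).
  by apply/seteqP; split => -[t1 t2] /=; rewrite /psub /= !mulN1r.
have mS c : measurable_fun setT (fun t : measurableTypeR R => c + (-1) * t : measurableTypeR R).
  by apply: measurable_funD => //; apply: measurable_funM.
rewrite [LHS]product_measure1E; last 2 first.
- by rewrite -[X in measurable X]setTI; exact: mS.
- by rewrite -[X in measurable X]setTI; exact: mS.
by congr (_ * _)%E; apply: lebesgue_preimage_affine => //; right.
Qed.

Definition shear2 (a : R) z : plane R := (z.1, z.2 + a * z.1).
Definition shear1 (a : R) z : plane R := (z.1 + a * z.2, z.2).

(** The product measure integrates the measures of vertical sections, and a vertical shear merely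
    translates each of these sections. *)
Lemma preserves_leb2_shear2 a : preserves_leb2 (shear2 a : mplane -> mplane).
Proof.
have mT : measurable_fun setT (shear2 a : mplane -> mplane).
  apply: measurable_fun_pair => //; apply: measurable_funD => //.
  by apply: measurable_funM.
split=> // A mA; rewrite /leb2 /product_measure1 /=.
apply: eq_integral => t _ /=.
have -> : xsection (shear2 a @^-1` A) t =
  (fun s : measurableTypeR R => a * t + 1 * s : measurableTypeR R) @^-1` xsection A t.
  by apply/seteqP; split => s; rewrite /xsection /= !inE /shear2 /= mul1r addrC.
by apply: lebesgue_preimage_affine; [left|exact: measurable_xsection].
Qed.

Lemma preserves_leb2_shear1 a : preserves_leb2 (shear1 a : mplane -> mplane).
Proof.
have mT : measurable_fun setT (shear1 a : mplane -> mplane).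
  apply: measurable_fun_pair => //; apply: measurable_funD => //.
  by apply: measurable_funM.
(* A horizontal shear translates horizontal sections, so the other order of integration is needed;
   both orders agree on rectangles, hence everywhere. *)
have sw (A : set mplane) : measurable A -> leb2 A = (mu \x^ mu)%E A.
  move=> mA; apply: product_measure_unique => // B C mB mC.
  exact: product_measure2E.
split=> // A mA; rewrite !sw //; last by rewrite -[X in measurable X]setTI; exact: mT.
rewrite /product_measure2 /=.
apply: eq_integral => t _ /=.
have -> : ysection (shear1 a @^-1` A) t =
  (fun s : measurableTypeR R => a * t + 1 * s : measurableTypeR R) @^-1` ysection A t.
  by apply/seteqP; split => s; rewrite /ysection /= !inE /shear1 /= mul1r addrC.
by apply: lebesgue_preimage_affine; [left|exact: measurable_ysection].
Qed.

End PreservingMaps.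

(** * Differential calculus on the plane *)

Section PlaneCalculus.
Context {R : realType}.
Implicit Types (x y z h u v : plane R) (f g : plane R -> R) (b : bool).

Definition dir b : plane R := if b then (0, 1) else (1, 0).
Definition dd b f : plane R -> R := if b then d2 f else d1 f.
Definition diffable f : Prop :=
  forall x : R * R, differentiable (f : R * R -> R) x.

Lemma ddE b f x : dd b f x = 'D_(dir b : R * R) (f : R * R -> R) x.
Proof. by case: b. Qed.

Lemma diffE_plane f x u : differentiable (f : R * R -> R) x ->
  'd (f : R * R -> R) x u = u.1 * d1 f x + u.2 * d2 f x.
Proof.
move=> df; rewrite /d1 /d2 !deriveE //.
have -> : u = (u.1 *: ((1, 0) : R * R) + u.2 *: ((0, 1) : R * R) : R * R).
  rewrite -[RHS]/(u.1 * 1 + u.2 * 0, u.1 * 0 + u.2 * 1) !mulr0 !mulr1 add0r addr0.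
  by case: (u).
by rewrite linearD !linearZ /= /GRing.scale /= !(mulr1, mulr0, addr0, add0r).
Qed.

Section LinearForm.
Variables a c : R.
Let lf (u : R * R) : R := u.1 * a + u.2 * c.
Let lf_linear : linear lf.
Proof. by move=> k u v; rewrite /lf /= /GRing.scale /=; ring. Qed.
HB.instance Definition _ := GRing.isLinear.Build R (R * R)%type R _ lf lf_linear.

(** A quadratic remainder near [x] implies Frechet differentiability and identifies the partial
    derivatives. The criterion suits potentials: a Taylor bound on the density integrates to exactly
    such a remainder. *)
Lemma differentiable_quadratic f x (C r : R) : 0 < r ->
  (forall h, norm1 h <= r ->
     `|f (padd x h) - f x - (h.1 * a + h.2 * c)| <= C * norm1 h ^+ 2) ->
  [/\ differentiable (f : R * R -> R) x, d1 f x = a & d2 f x = c].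
Proof.
move=> r0 H.
have cont : continuous (lf : R * R -> R).
  move=> u; apply: cvgD.
    by apply: cvgM; [exact: cvg_fst|exact: cvg_cst].
  by apply: cvgM; [exact: cvg_snd|exact: cvg_cst].
have n1 h : norm1 h <= 2 * `|h : R * R|.
  have : `|h.1| <= `|h : R * R| by rewrite [leRHS]/Num.norm /= le_max lexx.
  have : `|h.2| <= `|h : R * R| by rewrite [leRHS]/Num.norm /= le_max lexx orbT.
  by rewrite /norm1; lra.
have E : (f : R * R -> R) \o shift (x : R * R) = cst (f x) + (lf : R * R -> R) +o_ (0 : R * R) id.
  apply/eqaddoP => e e0.
  have C0 : 0 < `|C| + 1 by have := normr_ge0 C; lra.
  (* Since [norm1 h] is at most twice the sup norm of [h], the first entry makes the hypothesis
     applicable and the second gives 4 (|C| + 1) |h|^2 <= e |h|. *)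
  pose d := Num.min (r / 2) (e / (4 * (`|C| + 1))).
  have d0 : 0 < d by rewrite lt_min !divr_gt0 // mulr_gt0.
  have := @nbhsx_ballx R (R * R)%type 0 d d0; apply: filterS => h.
  rewrite -ball_normE /ball_ /= sub0r normrN => hd.
  have hn := n1 h; have h0 := norm1_ge0 h.
  have [dr de] : d <= r / 2 /\ d <= e / (4 * (`|C| + 1)).
    by rewrite /d !ge_min !lexx orbT.
  have /H Hh : norm1 h <= r by lra.
  have -> : ((f : R * R -> R) \o shift (x : R * R) - (cst (f x) + (lf : R * R -> R))) h =
    f (padd x h) - f x - (h.1 * a + h.2 * c).
    have -> : padd x h = (h : R * R) + (x : R * R).
      by rewrite -[RHS]/(h.1 + x.1, h.2 + x.2) /padd addrC [x.2 + _]addrC.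
    rewrite -[LHS]/(f ((h : R * R) + (x : R * R)) - (f x + (h.1 * a + h.2 * c))); ring.
  apply: (le_trans Hh); move: de; rewrite ler_pdivlMr ?mulr_gt0 // => de.
  have Cn := ler_norm C; have hh := normr_ge0 (h : R * R).
  have A1 : C * norm1 h ^+ 2 <= (`|C| + 1) * norm1 h ^+ 2.
    by apply: ler_wpM2r; [exact: sqr_ge0|lra].
  have A2 : norm1 h ^+ 2 <= (2 * `|h : R * R|) ^+ 2.
    by rewrite ler_pXn2r ?nnegrE // mulr_ge0.
  have A3 : `|h : R * R| * (4 * (`|C| + 1)) <= e.
    by apply: le_trans de; apply: ler_wpM2r; [rewrite mulr_ge0; lra|exact: ltW].
  apply: (le_trans A1); apply: (@le_trans _ _ ((`|C| + 1) * (2 * `|h : R * R|) ^+ 2)).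
    by apply: ler_wpM2l => //; lra.
  have := ler_wpM2r hh A3; rewrite /id; lra.
have D := diff_unique cont E.
have dx : differentiable (f : R * R -> R) x by apply/diff_locallyP; rewrite D.
by split => //; rewrite /d1 /d2 deriveE // D /= /lf /= !(mul1r, mul0r, addr0, add0r).
Qed.

End LinearForm.

Lemma is_derive_line f z u (t : R) :
  differentiable (f : R * R -> R) (padd z (t * u.1, t * u.2)) ->
  is_derive t 1 (fun s : R => f (padd z (s * u.1, s * u.2)))
    (u.1 * d1 f (padd z (t * u.1, t * u.2)) + u.2 * d2 f (padd z (t * u.1, t * u.2))).
Proof.
move=> df; set p : R * R := padd z (t * u.1, t * u.2); set F := (fun s : R => _).
have FE : (fun h : R => h^-1 *: ((F \o shift t) (h *: (1 : R)) - F t)) =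
    (fun h : R => h^-1 *: (((f : R * R -> R) \o shift p) (h *: (u : R * R)) - f p)).
  apply/funext => h; congr (_ *: (_ - _)); rewrite /= /F; congr (f _).
  rewrite -[RHS]/(h * u.1 + (z.1 + t * u.1), h * u.2 + (z.2 + t * u.2)).
  by rewrite -[h *: 1]/(h * 1) mulr1 /padd /=; congr pair; ring.
rewrite -diffE_plane // -deriveE //.
have : derivable (f : R * R -> R) p (u : R * R) by exact: diff_derivable.
rewrite /derivable -FE => dF.
by apply: DeriveDef => //; rewrite /derive FE.
Qed.

Lemma is_derive_comb (p q : R -> R) (a e t p' q' : R) :
  is_derive t 1 p p' -> is_derive t 1 q q' ->
  is_derive t 1 (fun s => a * p s + e * q s) (a * p' + e * q').
Proof. by move=> dp dq; apply: is_deriveD. Qed.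

Lemma quadratic_form_bound (B a e p q r s : R) :
  `|p| <= B -> `|q| <= B -> `|r| <= B -> `|s| <= B ->
  `|a * (a * p + e * q) + e * (a * r + e * s)| <= (`|a| + `|e|) * ((`|a| + `|e|) * B).
Proof.
move=> hp hq hr hs.
have two (f1 f2 C : R) : `|f1| <= C -> `|f2| <= C -> `|a * f1 + e * f2| <= (`|a| + `|e|) * C.
  move=> h1 h2; rewrite mulrDl; apply: (le_trans (ler_normD _ _)); rewrite !normrM.
  by apply: lerD; exact: ler_wpM2l.
by apply: (two); exact: (two).
Qed.

(** The mean value theorem, applied along the segment to [f] and then to its directional derivative.
    Second derivatives enter only through their bound on that segment, which is where the decay of a
    density is inserted. *)
Lemma taylor2 f z u (B : R) : diffable f -> (forall b, diffable (dd b f)) ->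
  (forall t b c, 0 <= t <= 1 -> `|dd b (dd c f) (padd z (t * u.1, t * u.2))| <= B) ->
  `|f (padd z u) - f z - (u.1 * d1 f z + u.2 * d2 f z)| <= B * norm1 u ^+ 2.
Proof.
move=> df ddf HB.
pose p t : plane R := padd z (t * u.1, t * u.2).
pose F (t : R) := f (p t).
pose F1 (t : R) := u.1 * d1 f (p t) + u.2 * d2 f (p t).
pose F2 (t : R) := u.1 * (u.1 * d1 (d1 f) (p t) + u.2 * d2 (d1 f) (p t)) +
                   u.2 * (u.1 * d1 (d2 f) (p t) + u.2 * d2 (d2 f) (p t)).
have dF (t : R) : is_derive t 1 F (F1 t) by exact: is_derive_line.
have dF1 (t : R) : is_derive t 1 F1 (F2 t).
  have H1 := @is_derive_line (d1 f) z u t (ddf false _).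
  have H2 := @is_derive_line (d2 f) z u t (ddf true _).
  exact: (is_derive_comb u.1 u.2 H1 H2).
have c (G G' : R -> R) (a b : R) : (forall t : R, is_derive t 1 G (G' t)) -> {within `[a, b], continuous G}.
  by move=> dG; apply: continuous_subspaceT => t; apply: differentiable_continuous; apply/derivable1_diffP.
have [t1] := @MVT_segment R F F1 0 1 ler01 (fun t _ => dF t) (c _ _ 0 1 dF).
rewrite in_itv /= subr0 mulr1 => /andP[t10 t11] E1.
have [t2] := @MVT_segment R F1 F2 0 t1 t10 (fun t _ => dF1 t) (c _ _ 0 t1 dF1).
rewrite in_itv /= subr0 => /andP[t20 t21] E2.
have p0 : p 0 = z by rewrite /p !mul0r /padd /= !addr0; case: (z).
have p1 : p 1 = padd z u by rewrite /p !mul1r; case: (u).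
have -> : f (padd z u) = F 1 by rewrite /F p1.
have -> : f z = F 0 by rewrite /F p0.
rewrite E1.
have -> : u.1 * d1 f z + u.2 * d2 f z = F1 0 by rewrite /F1 p0.
rewrite E2 normrM (ger0_norm t10).
have t2' : 0 <= t2 <= 1 by apply/andP; split; lra.
have N (i j : bool) : `|dd i (dd j f) (p t2)| <= B by exact: HB.
have N1 := N false false; have N2 := N true false; have N3 := N false true; have N4 := N true true.
have := quadratic_form_bound u.1 u.2 N1 N2 N3 N4; rewrite -/(F2 t2) -/(norm1 u).
move=> F2B; apply: (@le_trans _ _ (`|F2 t2| * 1)); first exact: ler_wpM2l.
by rewrite mulr1 (le_trans F2B) // mulrA -expr2 mulrC.
Qed.

Section Rules.
Variables (f g : plane R -> R) (x : plane R).
Hypotheses (df : differentiable (f : R * R -> R) x)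
  (dg : differentiable (g : R * R -> R) x).

Lemma differentiableD_plane : differentiable ((fun y => f y + g y) : R * R -> R) x.
Proof. exact: differentiableD. Qed.

Lemma ddD b : dd b (fun y => f y + g y) x = dd b f x + dd b g x.
Proof. by rewrite !ddE deriveD //; exact: diff_derivable. Qed.

Lemma differentiableM_plane : differentiable ((fun y => f y * g y) : R * R -> R) x.
Proof. exact: differentiableM. Qed.

Lemma ddM b : dd b (fun y => f y * g y) x = dd b f x * g x + f x * dd b g x.
Proof.
rewrite !ddE deriveM; [|exact: diff_derivable|exact: diff_derivable].
by rewrite /GRing.scale /= addrC mulrC.
Qed.

End Rules.

Lemma differentiable_cst_plane (k : R) x : differentiable ((fun _ => k) : R * R -> R) x.
Proof. exact: differentiable_cst. Qed.

Lemma dd_cst b (k : R) x : dd b (fun _ => k) x = 0.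
Proof. by rewrite ddE derive_cst. Qed.

Lemma differentiableZ_plane (k : R) f x : differentiable (f : R * R -> R) x ->
  differentiable ((fun y => k * f y) : R * R -> R) x.
Proof. by move=> df; apply: differentiableM_plane => //; exact: differentiable_cst. Qed.

Lemma ddZ b (k : R) f x : differentiable (f : R * R -> R) x ->
  dd b (fun y => k * f y) x = k * dd b f x.
Proof.
by move=> df; rewrite ddM ?dd_cst ?mul0r ?add0r //; exact: differentiable_cst.
Qed.

Lemma hasD_coord1 x : [/\ differentiable ((fun y => y.1) : R * R -> R) x,
  d1 (fun y => y.1) x = 1 & d2 (fun y => y.1) x = 0].
Proof.
apply: (@differentiable_quadratic 1 0 _ _ 0 1) => // h _.
by rewrite mul0r normr_le0 /padd /= mulr1 mulr0; apply/eqP; ring.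
Qed.

Lemma hasD_coord2 x : [/\ differentiable ((fun y => y.2) : R * R -> R) x,
  d1 (fun y => y.2) x = 0 & d2 (fun y => y.2) x = 1].
Proof.
apply: (@differentiable_quadratic 0 1 _ _ 0 1) => // h _.
by rewrite mul0r normr_le0 /padd /= mulr1 mulr0; apply/eqP; ring.
Qed.

Lemma hasD_comp (F : R -> R) (F' : R) f x : is_derive (f x) 1 F F' ->
  differentiable (f : R * R -> R) x ->
  differentiable ((fun y => F (f y)) : R * R -> R) x /\
  forall b, dd b (fun y => F (f y)) x = F' * dd b f x.
Proof.
move=> dF df.
have dF1 : differentiable F (f x) by apply/derivable1_diffP; exact: ex_derive.
have dc : differentiable (F \o (f : R * R -> R)) x by exact: differentiable_comp.
have dE (v : R) : 'd F (f x) v = F' * v.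
  rewrite -{1}[v]mulr1 -[v * 1]/(v *: (1 : R)) linearZ /= -deriveE //.
  by rewrite (@derive_val _ _ _ _ _ _ _ dF) /GRing.scale /= mulrC.
by split => // b; rewrite !ddE [LHS]deriveE // diff_comp //= dE -deriveE.
Qed.

Lemma hasD_shift1 (a : R) f x : differentiable (f : R * R -> R) (shift1 a x) ->
  differentiable ((fun y => f (shift1 a y)) : R * R -> R) x /\
  forall b, dd b (fun y => f (shift1 a y)) x = dd b f (shift1 a x).
Proof.
move=> df.
have hE (w : R * R) : shift1 a (w + (x : R * R)) = w + (shift1 a x : R * R).
  rewrite -[RHS]/(w.1 + (x.1 + a), w.2 + x.2) -[LHS]/((w.1 + x.1) + a, w.2 + x.2).
  by rewrite addrA.
split; last first.
  move=> b; rewrite !ddE /derive.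
  have -> // : (fun h : R => h^-1 *: ((((fun y => f (shift1 a y)) : R * R -> R) \o
      shift (x : R * R)) (h *: (dir b : R * R)) - f (shift1 a x))) =
    (fun h : R => h^-1 *: (((f : R * R -> R) \o
      shift (shift1 a x : R * R)) (h *: (dir b : R * R)) - f (shift1 a x))).
  by apply/funext => h; rewrite /= hE.
apply/diff_locallyP; set g := (fun y => _); have gE : (g : R * R -> R) \o shift (x : R * R) =
    (f : R * R -> R) \o shift (shift1 a x : R * R).
  by apply/funext => w /=; rewrite /g hE.
have [cd fE] := (diff_locallyP (shift1 a x : R * R) (f : R * R -> R)).1 df.
have gE' : (g : R * R -> R) \o shift (x : R * R) = cst (g x) +
    'd (f : R * R -> R) (shift1 a x : R * R) +o_ (0 : R * R) id by rewrite gE.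
by rewrite (diff_unique cd gE').
Qed.

End PlaneCalculus.

(** * The logarithmic potential: linearity and differentiability *)

Section LogPotential.
Context {R : realType}.
Implicit Types (x y z h u v : plane R) (f g : plane R -> R) (b : bool) (n : nat).

Notation mplane := (measurableTypeR R * measurableTypeR R)%type.

Definition dec_bound n (K : R) f : Prop := forall z, `|f z| <= K * dec z ^+ n.

Definition tame f : Prop :=
  measurable_fun setT (f : mplane -> R) /\ exists2 K, 0 <= K & dec_bound 3 K f.

Lemma dec_expr_le n m z : (n <= m)%N -> dec z ^+ m <= dec z ^+ n.
Proof. by move=> nm; apply: ler_wiXn2l => //; [exact: ltW (dec_gt0 z)|exact: dec_le1]. Qed.

Lemma diffable_measurable f : diffable f -> measurable_fun setT (f : mplane -> R).
Proof.
by move=> df; apply: continuous_measurable_plane => x; apply: differentiable_continuous.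
Qed.

Lemma tame_dec f n K : (3 <= n)%N -> measurable_fun setT (f : mplane -> R) ->
  0 <= K -> dec_bound n K f -> tame f.
Proof.
move=> n3 mf K0 fK; split=> //; exists K => // z.
by apply: (le_trans (fK z)); apply: ler_wpM2l => //; exact: dec_expr_le.
Qed.

Lemma tameD f g : tame f -> tame g -> tame (fun z => f z + g z).
Proof.
move=> [mf [K K0 fK]] [mg [L L0 gL]]; split; first exact: measurable_funD.
exists (K + L); first by rewrite addr_ge0.
by move=> z; rewrite mulrDl (le_trans (ler_normD _ _)) // lerD ?fK ?gL.
Qed.

Lemma tameZ (c : R) f : tame f -> tame (fun z => c * f z).
Proof.
move=> [mf [K K0 fK]]; split; first exact: measurable_funM.
exists (`|c| * K); first by rewrite mulr_ge0.
by move=> z; rewrite normrM -mulrA ler_wpM2l.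
Qed.

Lemma invlapE f x : invlap f x = (2 * pi)^-1 * int2 (fun z => logk (psub x z) * f z).
Proof. by []. Qed.

Lemma tame_integrable f x : tame f ->
  leb2.-integrable setT (EFin \o (fun z : mplane => logk (psub x z) * f z)).
Proof. by move=> [mf [K K0 fK]]; have [] := logk_int2_bound x mf K0 fK. Qed.

Lemma invlapD f g x : tame f -> tame g ->
  invlap (fun z => f z + g z) x = invlap f x + invlap g x.
Proof.
move=> tf tg; rewrite !invlapE -mulrDr; congr (_ * _).
rewrite /int2 -RintegralD //; try exact: tame_integrable.
by apply: eq_Rintegral => z _; rewrite mulrDr.
Qed.

Lemma invlapZ (c : R) f x : tame f -> invlap (fun z => c * f z) x = c * invlap f x.
Proof.
move=> tf; rewrite !invlapE mulrCA; congr (_ * _).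
rewrite /int2 -RintegralZl //; last exact: tame_integrable.
by apply: eq_Rintegral => z _; ring.
Qed.

(** Peetre's inequality for the weight 1 + |z|^2. *)
Lemma nsq_psub_le x z : 1 + nsq z <= 2 * (1 + nsq x) * (1 + nsq (psub x z)).
Proof.
rewrite /nsq /psub /=; set a := x.1; set b := x.2; set c := z.1; set d := z.2.
have h1 := sqr_ge0 (2 * a - c); have h2 := sqr_ge0 (2 * b - d).
have h3 := mulr_ge0 (sqr_ge0 a) (sqr_ge0 (a - c)); have h4 := mulr_ge0 (sqr_ge0 a) (sqr_ge0 (b - d)).
have h5 := mulr_ge0 (sqr_ge0 b) (sqr_ge0 (a - c)); have h6 := mulr_ge0 (sqr_ge0 b) (sqr_ge0 (b - d)).
nra.
Qed.

Lemma dec_psub x z : dec (psub x z) <= 2 * (1 + nsq x) * dec z.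
Proof.
have [p q] := (nsq_ge0 z, nsq_ge0 (psub x z)).
rewrite /dec ler_pdivlMr; last lra.
by rewrite mulrC ler_pdivrMr ?nsq_psub_le; lra.
Qed.

Lemma nsq_small h z : norm1 h <= 2^-1 -> nsq h <= (1 + nsq z) / 4.
Proof.
move=> h2; have h0 := norm1_ge0 h; have z0 := nsq_ge0 z.
have : nsq h <= norm1 h ^+ 2.
  by rewrite -enorm_sqr ler_pXn2r ?nnegrE ?enorm_ge0 // enorm_le_norm1.
have : norm1 h ^+ 2 <= 4^-1.
  by rewrite (_ : 4^-1 = 2^-1 ^+ 2) ?ler_pXn2r ?nnegrE // exprVn -natrX.
lra.
Qed.

(** An increment with |u|^2 <= (1 + |z|^2)/4 cannot bring the segment close enough to the origin to
    change the weight by more than a factor 4. The smallness is relative to [z] so as to cover twist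
    steps as well, whose length is proportional to |z|. *)
Lemma dec_segment z u t : nsq u <= (1 + nsq z) / 4 -> 0 <= t <= 1 ->
  dec (padd z (t * u.1, t * u.2)) <= 4 * dec z.
Proof.
move=> uz /andP[t0 t1]; set w := padd _ _.
have [p q] := (nsq_ge0 z, nsq_ge0 w).
rewrite /dec ler_pdivlMr; last lra.
rewrite mulrC ler_pdivrMr; last lra.
have : (t * u.1) ^+ 2 <= u.1 ^+ 2 by rewrite exprMn ler_piMl ?sqr_ge0 // expr_le1.
have : (t * u.2) ^+ 2 <= u.2 ^+ 2 by rewrite exprMn ler_piMl ?sqr_ge0 // expr_le1.
have := sqr_ge0 (z.1 + 2 * (t * u.1)); have := sqr_ge0 (z.2 + 2 * (t * u.2)).
move: uz; rewrite /w /nsq /padd /=; set s1 := t * u.1; set s2 := t * u.2; nra.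
Qed.

Lemma logkN z : logk (psub 0 z) = logk z.
Proof. by rewrite /logk /enorm /psub /= !sub0r !sqrrN. Qed.

Lemma int2_logk_bound f (K : R) : measurable_fun setT (f : mplane -> R) ->
  0 <= K -> dec_bound 3 K f ->
  leb2.-integrable setT (EFin \o (fun z : mplane => logk z * f z)) /\
  `|int2 (fun z => logk z * f z)| <= 204 * K.
Proof.
move=> mf K0 fK; have := logk_int2_bound 0 mf K0 fK.
have -> : (fun z : mplane => logk (psub 0 z) * f z) = (fun z => logk z * f z).
  by apply/funext => z; rewrite logkN.
by rewrite /norm1 /= normr0 !addr0 mulr1.
Qed.

Lemma tame_psub f x : tame f -> tame (fun z => f (psub x z)).
Proof.
move=> [mf [K K0 fK]]; split.
  exact: (measurableT_comp mf (measurable_psub x)).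
have x0 := nsq_ge0 x.
exists (K * (2 * (1 + nsq x)) ^+ 3).
  by rewrite mulr_ge0 // exprn_ge0 // mulr_ge0 //; lra.
move=> z; apply: (le_trans (fK _)); rewrite -mulrA; apply: ler_wpM2l => //.
rewrite -exprMn lerXn2r ?nnegrE ?dec_psub //; first exact: ltW (dec_gt0 _).
by apply: le_trans (dec_psub x z); exact: ltW (dec_gt0 _).
Qed.

Lemma int2_logkD f g : tame f -> tame g -> int2 (fun z => logk z * (f z + g z)) =
  int2 (fun z => logk z * f z) + int2 (fun z => logk z * g z).
Proof.
move=> [mf [K K0 fK]] [mg [L L0 gL]].
rewrite /int2 -RintegralD //.
- by apply: eq_Rintegral => z _; rewrite mulrDr.
- exact: (proj1 (int2_logk_bound mf K0 fK)).
- exact: (proj1 (int2_logk_bound mg L0 gL)).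
Qed.

Lemma int2_logkZ (c : R) f : tame f ->
  int2 (fun z => logk z * (c * f z)) = c * int2 (fun z => logk z * f z).
Proof.
move=> [mf [K K0 fK]]; rewrite /int2 -RintegralZl //.
  by apply: eq_Rintegral => z _; ring.
exact: (proj1 (int2_logk_bound mf K0 fK)).
Qed.

(** The pattern is that of a first-order Taylor remainder, p - q - (a r + c s); the other uses pad
    it with zero coefficients. *)
Lemma int2_logk_comb (p q r s : plane R -> R) (a c : R) :
  tame p -> tame q -> tame r -> tame s ->
  int2 (fun z => logk z * (p z + (-1) * (q z + (a * r z + c * s z)))) =
  int2 (fun z => logk z * p z) - int2 (fun z => logk z * q z) -
  (a * int2 (fun z => logk z * r z) + c * int2 (fun z => logk z * s z)).
Proof.
move=> tp tq tr ts; have ta := tameZ a tr; have tc := tameZ c ts.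
have tac := tameD ta tc; have tqac := tameD tq tac.
rewrite (int2_logkD tp (tameZ (-1) tqac)) (int2_logkZ _ tqac) (int2_logkD tq tac).
rewrite (int2_logkD ta tc) (int2_logkZ _ tr) (int2_logkZ _ ts).
set A := int2 _; set B := int2 _; set C := int2 _; set D := int2 _; ring.
Qed.

(** The area-preserving map z -> x - z moves the dependence on [x] from the singular kernel to the
    smooth density. *)
Lemma invlap_psub f x : tame f ->
  invlap f x = (2 * pi)^-1 * int2 (fun z => logk z * f (psub x z)).
Proof.
move=> tf; rewrite invlapE; congr (_ * _).
have pp z : psub x (psub x z) = z.
  by case: z => a c; rewrite /psub /=; congr pair; ring.
have gE : (fun z : mplane => logk (psub x z) * f z) \o psub x =
    (fun z => logk z * f (psub x z)) by apply/funext => z /=; rewrite pp.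
rewrite -gE (int2_preserved (preserves_leb2_psub x)) //.
  by apply: measurable_logk_psub; case: tf.
rewrite gE; have [mg [K K0 gK]] := tame_psub x tf.
by have [] := int2_logk_bound mg K0 gK.
Qed.

Definition decC2 n (K : R) f : Prop :=
  [/\ diffable f, forall b, diffable (dd b f), dec_bound n K f,
      forall b, dec_bound n K (dd b f) & forall b c, dec_bound n K (dd b (dd c f))].

Lemma dec_bound_ge0 n K f : dec_bound n K f -> 0 <= K.
Proof.
move=> /(_ 0); have -> : dec (0 : plane R) = 1 by rewrite /dec /nsq /= expr0n /= !addr0 invr1.
by rewrite expr1n mulr1; apply: le_trans.
Qed.

Lemma decC2_tame n K f : (3 <= n)%N -> decC2 n K f -> tame f /\ forall b, tame (dd b f).
Proof.
move=> n3 [df ddf fK dfK _]; have K0 := dec_bound_ge0 fK.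
split=> [|b]; apply: (tame_dec n3 _ K0) => //; exact: diffable_measurable.
Qed.

(** Once [x] sits in the density, only the density is expanded. Its Taylor remainder is |h|^2 times
    a function bounded by [dec ^+ 3], and integration against the logarithm keeps the order
    |h|^2. *)
Lemma invlap_diff K f x : decC2 3 K f ->
  [/\ differentiable (invlap f : R * R -> R) x,
      d1 (invlap f) x = invlap (d1 f) x & d2 (invlap f) x = invlap (d2 f) x].
Proof.
move=> Hf; have [tf tdf] := decC2_tame (leqnn 3) Hf.
have [df ddf fK dfK ddfK] := Hf; have K0 := dec_bound_ge0 fK.
have x0 := nsq_ge0 x.
(* [4 ^+ 3] is the loss of weight along the segment, the last factor the loss in passing from x - z
   to z. The dependence on [x] is harmless, differentiability being a local matter. *)
pose B := K * 4 ^+ 3 * (2 * (1 + nsq x)) ^+ 3.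
have B0 : 0 <= B.
  by apply: mulr_ge0; [apply: mulr_ge0|apply: exprn_ge0; lra].
apply: (@differentiable_quadratic _ (invlap (d1 f) x) (invlap (d2 f) x) _ x
   ((2 * pi)^-1 * (204 * B)) (2^-1)); first lra.
move=> h h2.
pose phi z := f (psub (padd x h) z) + (-1) * (f (psub x z) +
   (h.1 * d1 f (psub x z) + h.2 * d2 f (psub x z))).
have t1 := tame_psub (padd x h) tf; have t2 := tame_psub x tf.
have t3 := tame_psub x (tdf false); have t4 := tame_psub x (tdf true).
have tphi : tame phi := tameD t1 (tameZ (-1) (tameD t2 (tameD (tameZ h.1 t3) (tameZ h.2 t4)))).
have E := int2_logk_comb h.1 h.2 t1 t2 t3 t4; rewrite -/phi in E.
rewrite (invlap_psub _ tf) (invlap_psub x tf).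
rewrite (invlap_psub x (tdf false)) (invlap_psub x (tdf true)).
have pi0 : 0 <= (2 * pi)^-1 :> R by rewrite invr_ge0 mulr_ge0 // pi_ge0.
have -> : forall a c d e : R, (2 * pi)^-1 * a - (2 * pi)^-1 * c -
   (h.1 * ((2 * pi)^-1 * d) + h.2 * ((2 * pi)^-1 * e)) =
   (2 * pi)^-1 * (a - c - (h.1 * d + h.2 * e)) by move=> a c d e; ring.
rewrite -E normrM ger0_norm // -mulrA -[204 * B * _]mulrA; apply: ler_wpM2l => //.
suff phiB : dec_bound 3 (B * norm1 h ^+ 2) phi.
  by case: tphi => mphi _; have [] := int2_logk_bound mphi (dec_bound_ge0 phiB) phiB.
move=> z.
have hu := nsq_small (psub x z) h2.
have -> : phi z = f (padd (psub x z) h) - f (psub x z) -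
    (h.1 * d1 f (psub x z) + h.2 * d2 f (psub x z)).
  rewrite /phi mulN1r opprD addrA; congr (f _ - _ - _).
  by rewrite /padd /psub /=; congr pair; ring.
apply: (@le_trans _ _ (K * (4 * (2 * (1 + nsq x) * dec z)) ^+ 3 * norm1 h ^+ 2)); last first.
  by rewrite !exprMn /B le_eqVlt; apply/orP; left; apply/eqP; ring.
apply: taylor2 => // t b c t01; apply: (le_trans (ddfK _ _ _)); apply: ler_wpM2l => //.
have d0 := dec_gt0 (padd (psub x z) (t * h.1, t * h.2)).
have D := le_trans (dec_segment hu t01) (ler_wpM2l _ (dec_psub x z)).
by rewrite lerXn2r ?nnegrE ?D ?(ltW d0) // (le_trans (ltW d0)) // D.
Qed.

End LogPotential.

(** * The uniform gradient bound and approximate rotations *)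

Section PotentialRotation.
Context {R : realType}.
Implicit Types (x y z h u v : plane R) (f g : plane R -> R) (b : bool) (n : nat).

Notation mplane := (measurableTypeR R * measurableTypeR R)%type.

Lemma dd_lipschitz f x (C : R) b : (forall y z, `|f y - f z| <= C * norm1 (psub y z)) ->
  differentiable (f : R * R -> R) x -> `|dd b f x| <= C.
Proof.
move=> lip df; rewrite ddE.
have dv : derivable (f : R * R -> R) x (dir b : R * R) by exact: diff_derivable.
set q := (fun h : R => h^-1 *: (((f : R * R -> R) \o shift (x : R * R)) (h *: (dir b : R * R)) - f x)).
have qC : \forall h \near 0^', `|q h| <= C.
  exists 1 => //= h _ h0; rewrite /q normrM normfV ler_pdivrMl ?normr_gt0 // mulrC.
  apply: (le_trans (lip _ _)).
  have -> : norm1 (psub (h *: (dir b : R * R) + (x : R * R)) x) = `|h|.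
    have -> : psub (h *: (dir b : R * R) + (x : R * R)) x = (h * (dir b).1, h * (dir b).2).
      by congr pair; apply: addrK.
    by rewrite /norm1 /=; case: (b); rewrite /= !(mulr0, mulr1) !(normr0, addr0, add0r).
  by [].
rewrite ler_norml; apply/andP; split.
  by apply: limr_ge => //; apply: filterS qC => h; rewrite ler_norml => /andP[].
by apply: limr_le => //; apply: filterS qC => h; rewrite ler_norml => /andP[].
Qed.

Lemma invlap_lipschitz f (K : R) y z : measurable_fun setT (f : mplane -> R) ->
  dec_bound 3 K f -> `|invlap f y - invlap f z| <= 204 * K * norm1 (psub y z).
Proof.
move=> mf fK; have K0 := dec_bound_ge0 fK.
have L := logk_int2_lipschitz y z mf K0 fK.
have p1 : 1 <= 2 * pi :> R by have := pi_ge2 R; lra.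
rewrite !invlapE -mulrBr normrM ger0_norm; last by rewrite invr_ge0; lra.
rewrite mulrC ler_pdivrMr; last lra.
apply: (le_trans L); rewrite ler_peMr //.
by apply: mulr_ge0 (norm1_ge0 _); exact: mulr_ge0 (ler0n _ _) K0.
Qed.

(** The bound goes through the Lipschitz estimate: writing the derivative as the potential of the
    derivative would only give a multiple of 1 + |x|. *)
Lemma dd_invlap_bound f (K : R) b x : decC2 3 K f -> `|dd b (invlap f) x| <= 204 * K.
Proof.
move=> Hf; apply: dd_lipschitz; last by case: (invlap_diff x Hf).
move=> y z; have [df ddf fK _ _] := Hf; apply: invlap_lipschitz => //.
exact: diffable_measurable.
Qed.

(* Two shears compose to a measure-preserving map that agrees with the rotation
   of angle [h] to first order and changes [|z|^2] only to second order. *)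
Definition twist (t : R) z : plane R := shear1 (- t) (shear2 t z).
Definition twist_step (t : R) z : plane R := (- (t * z.2) - t ^+ 2 * z.1, t * z.1).

Lemma twistE t z : twist t z = padd z (twist_step t z).
Proof. by rewrite /twist /shear1 /shear2 /padd /twist_step /=; congr pair; ring. Qed.

Lemma nsq_twist_step t z : `|t| <= 4^-1 -> nsq (twist_step t z) <= 4 * t ^+ 2 * nsq z.
Proof.
rewrite ler_norml => /andP[t1 t2]; rewrite /nsq /twist_step /=.
set a := z.1; set b := z.2.
have t0 := sqr_ge0 t; have t3 : t ^+ 2 <= 1 by nra.
have E : (- (t * b) - t ^+ 2 * a) ^+ 2 = t ^+ 2 * (b + t * a) ^+ 2 by ring.
have h1 : (b + t * a) ^+ 2 <= 2 * b ^+ 2 + 2 * a ^+ 2.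
  have := sqr_ge0 (b - t * a); have := ler_wpM2r (sqr_ge0 a) t3; nra.
have := ler_wpM2l t0 h1; rewrite E; have := mulr_ge0 t0 (sqr_ge0 a); have := mulr_ge0 t0 (sqr_ge0 b); nra.
Qed.

Lemma nsq_twist_step_small t z : `|t| <= 4^-1 -> nsq (twist_step t z) <= (1 + nsq z) / 4.
Proof.
move=> ht; apply: (le_trans (nsq_twist_step z ht)).
have z0 := nsq_ge0 z; move: ht; rewrite ler_norml => /andP[t1 t2].
have t3 : 4 * t ^+ 2 <= 4^-1 by nra.
by have := ler_wpM2r z0 t3; lra.
Qed.

(** |twist t z|^2 - |z|^2 is t^2 times a quadratic form in [z], so the relative change of |z| is at
    most 3 t^2, even close to the singularity. The constant doubles because |twist t z| >= |z|/2. *)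
Lemma logk_twist t z : `|t| <= 4^-1 -> `|logk (twist t z) - logk z| <= 6 * t ^+ 2.
Proof.
move=> ht; have t0 := sqr_ge0 t.
have [->|z0] := eqVneq z 0.
  have -> : twist t 0 = 0 by rewrite twistE /twist_step /padd /=; congr pair; ring.
  by rewrite subrr normr0 mulr_ge0.
have b0 : 0 < enorm z.
  rewrite lt_neqAle enorm_ge0 andbT eq_sym; apply: contraNN z0 => /eqP /enorm_eq0 ->.
  by rewrite eqxx.
have t3 : t ^+ 2 <= 16^-1 by move: ht; rewrite ler_norml => /andP[t1 t2]; nra.
have a0 := enorm_ge0 (twist t z).
have N : `|enorm (twist t z) ^+ 2 - enorm z ^+ 2| <= 3 * t ^+ 2 * enorm z ^+ 2.
  rewrite !enorm_sqr.
  have -> : nsq (twist t z) - nsq z =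
    t ^+ 2 * ((t ^+ 2 - 1) * z.1 ^+ 2 + z.2 ^+ 2 + 2 * t * z.1 * z.2).
    by rewrite /nsq /twist /shear1 /shear2 /=; ring.
  rewrite (_ : 3 * t ^+ 2 * nsq z = t ^+ 2 * (3 * nsq z)); last by ring.
  rewrite normrM ger0_norm //; apply: ler_wpM2l => //.
  rewrite /nsq; set a := z.1; set c := z.2.
  move: ht; rewrite ler_norml => /andP[t1 t2].
  have h1 := sqr_ge0 (a - t * c); have h2 := sqr_ge0 (a + t * c).
  have h3 := ler_wpM2r (sqr_ge0 c) t3; have h4 := mulr_ge0 t0 (sqr_ge0 a).
  have h5 := ler_wpM2r (sqr_ge0 a) t3; have h6 := sqr_ge0 a; have h7 := sqr_ge0 c.
  have h8 : (t * c) ^+ 2 = t ^+ 2 * c ^+ 2 by ring.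
  rewrite ler_norml; apply/andP; split; nra.
set a := enorm (twist t z) in a0 N *; set c := enorm z in b0 N *.
have ab : `|a - c| <= 3 * t ^+ 2 * c.
  have s0 : 0 < a + c by lra.
  rewrite -(ler_pM2r s0) -{1}(gtr0_norm s0) -normrM -subr_sqr.
  apply: (le_trans N); have w : 0 <= 3 * t ^+ 2 * c.
    by apply: mulr_ge0; [apply: mulr_ge0|exact: ltW].
  have ca : c <= a + c by lra.
  by have := ler_wpM2l w ca; lra.
have ac : c / 2 <= a.
  move: ab; rewrite ler_norml => /andP[h1 h2].
  by have := ler_wpM2r (ltW b0) t3; lra.
have a1 : 0 < a by lra.
have := ln_diff_le a1 b0; have := ln_diff_le b0 a1.
have q1 : `|a - c| * c^-1 <= 6 * t ^+ 2.
  by rewrite ler_pdivrMr //; have := mulr_ge0 t0 (ltW b0); lra.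
have q2 : `|c - a| * a^-1 <= 6 * t ^+ 2.
  rewrite ler_pdivrMr // distrC; have := ler_wpM2l t0 ac; lra.
rewrite /logk -/a -/c ler_norml => h1 h2; apply/andP; split; lra.
Qed.

Lemma preserves_leb2_twist t : preserves_leb2 (twist t : mplane -> mplane).
Proof. exact: (preserves_leb2_comp (preserves_leb2_shear1 (- t)) (preserves_leb2_shear2 t)). Qed.

End PotentialRotation.

(** * The potential commutes with the rotation field *)

Section PotentialOfRotation.
Context {R : realType}.
Implicit Types (x y z h u v : plane R) (f g : plane R -> R) (b : bool) (n : nat).

Notation mplane := (measurableTypeR R * measurableTypeR R)%type.

Lemma dec_bound_psub n K f x : dec_bound n K f ->
  dec_bound n (K * (2 * (1 + nsq x)) ^+ n) (fun z => f (psub x z)).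
Proof.
move=> fK z; have K0 := dec_bound_ge0 fK; apply: (le_trans (fK _)).
rewrite -mulrA; apply: ler_wpM2l => //; rewrite -exprMn.
have d0 := ltW (dec_gt0 (psub x z)).
by rewrite lerXn2r ?nnegrE ?dec_psub // (le_trans d0) // dec_psub.
Qed.

(** A coefficient linear in [z] costs one power of the weight, since (1 + |z|^2) dec z = 1. *)
Lemma dec_absorb n (P : R) z (a c p q : R) : `|a| + `|c| <= 1 + nsq z ->
  0 <= P -> `|p| <= P * dec z ^+ n.+1 -> `|q| <= P * dec z ^+ n.+1 ->
  `|a * p - c * q| <= P * dec z ^+ n.
Proof.
move=> ac P0 hp hq; apply: (le_trans (ler_normB _ _)); rewrite !normrM.
have Pd : 0 <= P * dec z ^+ n.+1 by rewrite mulr_ge0 // exprn_ge0 // ltW // dec_gt0.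
apply: (@le_trans _ _ ((`|a| + `|c|) * (P * dec z ^+ n.+1))).
  by rewrite mulrDl; apply: lerD; apply: ler_wpM2l.
apply: (le_trans (ler_wpM2r Pd ac)).
have e := dec_eq z; rewrite exprS; set D := dec z ^+ n.
have -> : (1 + nsq z) * (P * (dec z * D)) = ((1 + nsq z) * dec z) * (P * D) by ring.
by rewrite e mul1r.
Qed.

Lemma vanish_of_linear_bound (a C : R) : 0 <= C ->
  (forall t, 0 < t <= 4^-1 -> `|a| <= C * t) -> a = 0.
Proof.
move=> C0 H; apply/eqP; rewrite -normr_le0 leNgt; apply/negP => a0.
have C1 : 0 < 2 * (C + 1) by lra.
pose t := Num.min 4^-1 (`|a| / (2 * (C + 1))).
have t0 : 0 < t by rewrite lt_min divr_gt0 // andbT; lra.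
have [t1 t2] : t <= 4^-1 /\ t <= `|a| / (2 * (C + 1)).
  by rewrite /t !ge_min !lexx orbT.
have := H t; rewrite t0 t1 => /(_ isT).
move: t2; rewrite ler_pdivlMr // => t2 h.
have := mulr_ge0 C0 (ltW t0); nra.
Qed.

Lemma int2D (f g : mplane -> R) : leb2.-integrable setT (EFin \o f) ->
  leb2.-integrable setT (EFin \o g) -> int2 (fun z => f z + g z) = int2 f + int2 g.
Proof. by move=> i1 i2; rewrite /int2 RintegralD. Qed.

(** A radial function against an angular derivative. Put g(z) = f(x - z), whose angular derivative
    is minus the factor [r] below. Invariance of the integral of log|z| g(z) under [twist t] gives t
    times the integral of log|z| r(z) = O(t^2), and [t] is arbitrarily small. *)
Lemma int2_logk_rot f x K : decC2 5 K f ->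
  int2 (fun z => logk z * (z.1 * d2 f (psub x z) - z.2 * d1 f (psub x z))) = 0.
Proof.
move=> [df ddf fK dfK ddfK]; have K0 := dec_bound_ge0 fK.
pose P := K * (2 * (1 + nsq x)) ^+ 5.
have fP : dec_bound 5 P (fun z => f (psub x z)) by exact: dec_bound_psub.
have dfP b : dec_bound 5 P (fun z => dd b f (psub x z)) by exact: dec_bound_psub.
have ddfP b c : dec_bound 5 P (fun z => dd b (dd c f) (psub x z)) by exact: dec_bound_psub.
have P0 := dec_bound_ge0 fP.
have mpsub g : diffable g -> measurable_fun setT (fun z : mplane => g (psub x z)).
  move=> dg; exact: (measurableT_comp (diffable_measurable dg) (measurable_psub x)).
pose g z := f (psub x z).
pose r z := z.1 * d2 f (psub x z) - z.2 * d1 f (psub x z).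
have mg : measurable_fun setT (g : mplane -> R) by exact: mpsub.
have mr : measurable_fun setT (r : mplane -> R).
  apply: measurable_funB; apply: measurable_funM => //.
    by apply: mpsub; exact: (ddf true).
  by apply: mpsub; exact: (ddf false).
have rP : dec_bound 4 P r.
  move=> z; apply: dec_absorb => //; [exact: norm1_le_nsq|exact: (dfP true)|exact: (dfP false)].
have tg : tame g by exact: (tame_dec _ mg P0 fP).
have tr : tame r by exact: (tame_dec _ mr P0 rP).
(* 8 * 4^5 * P bounds the Taylor remainder of [g] along the twist, and the extra P the part of the
   twist step that is quadratic in t. The same Q covers [psi], whose constant is 6 * 4^5 * P. *)
rewrite -/r; pose Q := 8 * 4 ^+ 5 * P + P.
have Q0 : 0 <= Q by rewrite /Q; lra.
apply: (@vanish_of_linear_bound _ (408 * Q)); first by lra.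
move=> t /andP[t0 t4].
have ht : `|t| <= 4^-1 by rewrite gtr0_norm.
have tt0 := sqr_ge0 t.
have mT : measurable_fun setT (twist t : mplane -> mplane) by case: (preserves_leb2_twist t).
pose phi z := g (twist t z) - g z + t * r z.
pose psi z := (logk (twist t z) - logk z) * g (twist t z).
have mgT : measurable_fun setT (fun z : mplane => g (twist t z)) by exact: (measurableT_comp mg mT).
have mlk : measurable_fun setT (fun z : mplane => logk (twist t z)).
  exact: (measurableT_comp measurable_logk mT).
have mphi : measurable_fun setT (phi : mplane -> R).
  by apply: measurable_funD; [exact: measurable_funB|exact: measurable_funM].
have mpsi : measurable_fun setT (psi : mplane -> R).
  by apply: measurable_funM => //; apply: measurable_funB => //; exact: measurable_logk.
have segT z s : 0 <= s <= 1 -> dec (padd z (s * (twist_step t z).1, s * (twist_step t z).2)) ^+ 5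
    <= 4 ^+ 5 * dec z ^+ 5.
  move=> s01; have D := dec_segment (nsq_twist_step_small z ht) s01.
  rewrite -exprMn lerXn2r ?nnegrE //; first exact: ltW (dec_gt0 _).
  by rewrite mulr_ge0 // ltW // dec_gt0.
have gT z : `|g (twist t z)| <= P * (4 ^+ 5 * dec z ^+ 5).
  apply: (le_trans (fP _)); apply: ler_wpM2l => //.
  by have := segT z 1; rewrite !mul1r -[(_, _)]surjective_pairing -twistE; apply; rewrite ler01 lexx.
have phiQ : dec_bound 3 (Q * t ^+ 2) phi.
  move=> z; pose u := twist_step t z; pose v : plane R := (- u.1, - u.2).
  have pe s : padd (psub x z) (s * v.1, s * v.2) = psub x (padd z (s * u.1, s * u.2)).
    by rewrite /padd /psub /v /=; congr pair; ring.
  have T := @taylor2 _ f (psub x z) v (P * (4 ^+ 5 * dec z ^+ 5)) df ddf _.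
  have {}T := T ltac:(by move=> s b c s01; rewrite pe; apply: (le_trans (ddfP b c _));
    apply: ler_wpM2l => //; exact: segT).
  have e1 : padd (psub x z) v = psub x (twist t z).
    by have := pe 1; rewrite !mul1r -!surjective_pairing -twistE.
  rewrite e1 in T.
  (* The part of the twist step linear in t is the rotation field, cancelled by [t * r z]; its part
     of order t^2 leaves the last summand. The product [0 * 0] fills the second slot of
     [dec_absorb]. *)
  have -> : phi z = (g (twist t z) - g z - (v.1 * d1 f (psub x z) + v.2 * d2 f (psub x z)))
     + t ^+ 2 * (z.1 * d1 f (psub x z) - 0 * 0).
    by rewrite /phi /r /v /u /twist_step /=; ring.
  apply: (le_trans (ler_normD _ _)).
  have d4 : dec z ^+ 4 <= dec z ^+ 3 by exact: dec_expr_le.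
  have d40 : 0 <= dec z ^+ 4 by rewrite exprn_ge0 // ltW // dec_gt0.
  have B2 : `|t ^+ 2 * (z.1 * d1 f (psub x z) - 0 * 0)| <= t ^+ 2 * (P * dec z ^+ 4).
    rewrite normrM ger0_norm //; apply: ler_wpM2l => //; apply: dec_absorb => //.
    - by rewrite normr0 addr0; apply: le_trans (norm1_le_nsq z); rewrite /norm1 lerDl.
    - exact: (dfP false).
    - by rewrite normr0 mulr_ge0 // exprn_ge0 // ltW // dec_gt0.
  have nv : norm1 v ^+ 2 <= 8 * t ^+ 2 * nsq z.
    have := norm1_sqr v; have -> : nsq v = nsq u by rewrite /nsq /v /= !sqrrN.
    have := nsq_twist_step z ht; rewrite -/u; lra.
  have B1 : P * (4 ^+ 5 * dec z ^+ 5) * norm1 v ^+ 2 <= 8 * 4 ^+ 5 * P * t ^+ 2 * dec z ^+ 4.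
    have w : 0 <= P * (4 ^+ 5 * dec z ^+ 5).
      by rewrite mulr_ge0 // mulr_ge0 // exprn_ge0 // ltW // dec_gt0.
    apply: (le_trans (ler_wpM2l w nv)).
    have e := dec_eq z; have z0 := nsq_ge0 z; have d0 := dec_gt0 z.
    have w' : 0 <= 8 * 4 ^+ 5 * P * t ^+ 2 * dec z ^+ 4.
      by apply: mulr_ge0 => //; apply: mulr_ge0 => //; apply: mulr_ge0.
    rewrite (_ : P * (4 ^+ 5 * dec z ^+ 5) * (8 * t ^+ 2 * nsq z) =
      8 * 4 ^+ 5 * P * t ^+ 2 * dec z ^+ 4 * (nsq z * dec z)); last by ring.
    by apply: ler_piMr => //; move: e; rewrite mulrDl mul1r; lra.
  apply: (@le_trans _ _ (Q * t ^+ 2 * dec z ^+ 4)); last first.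
    by apply: ler_wpM2l => //; rewrite mulr_ge0.
  have := le_trans T B1; move: B2; rewrite /Q.
  set A1 := `|_|; set A2 := `|_|; set D := dec z ^+ 4; set t2 := t ^+ 2; set c := 4 ^+ 5.
  move=> B2 B1'; have := lerD B1' B2; lra.
have psiQ : leb2.-integrable setT (EFin \o (psi : mplane -> R)) /\ `|int2 psi| <= 204 * (Q * t ^+ 2).
  apply: (@int2_kernel_maj _ _ x x) => //; first by rewrite mulr_ge0.
  move=> z; apply: (@le_trans _ _ (Q * t ^+ 2 * (dec z ^+ 2))%:E); last first.
    rewrite EFinM; apply: lee_wpmul2l; first by rewrite lee_fin mulr_ge0.
    apply: (le_trans (kernel_maj_ge_dec x z)); rewrite leeDl //; exact: kernel_maj_ge0.
  have L := logk_twist z ht; have G := gT z.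
  rewrite lee_fin /psi normrM.
  apply: (le_trans (ler_pM (normr_ge0 _) (normr_ge0 _) L G)).
  have d52 : dec z ^+ 5 <= dec z ^+ 2 by exact: dec_expr_le.
  have d50 : 0 <= dec z ^+ 5 by rewrite exprn_ge0 // ltW // dec_gt0.
  apply: (@le_trans _ _ (Q * t ^+ 2 * dec z ^+ 5)); last first.
    by apply: ler_wpM2l => //; rewrite mulr_ge0.
  rewrite (_ : 6 * t ^+ 2 * (P * (4 ^+ 5 * dec z ^+ 5)) = (6 * 4 ^+ 5 * P) * t ^+ 2 * dec z ^+ 5); last by ring.
  apply: ler_wpM2r => //; apply: ler_wpM2r => //; rewrite /Q.
  have c0 : 0 <= 4 ^+ 5 * P by rewrite mulr_ge0 // exprn_ge0.
  by set c := 4 ^+ 5 in c0 *; lra.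
have Q20 : 0 <= Q * t ^+ 2 by rewrite mulr_ge0.
have [iphi phiI] := int2_logk_bound mphi Q20 phiQ.
have [ipsi psiI] := psiQ.
have tphi : tame phi by split => //; exists (Q * t ^+ 2).
have tsum : tame (fun z => g z + (-1) * (0 * phi z + (t * r z + (-1) * phi z))).
  by apply: tameD => //; apply: tameZ; apply: tameD; [exact: tameZ|apply: tameD; exact: tameZ].
have tame_int k : tame k -> leb2.-integrable setT (EFin \o (fun z : mplane => logk z * k z)).
  by move=> [mk [L L0 kL]]; have [] := int2_logk_bound mk L0 kL.
(* [k] is log|z| g(twist t z), written in the pattern of [int2_logk_comb] with one zero coefficient;
   [psi] then collects the change of the logarithm. *)
pose k z := logk z * (g z + (-1) * (0 * phi z + (t * r z + (-1) * phi z))).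
have FT : (fun z => logk z * g z) \o twist t = (fun z => k z + psi z).
  by apply/funext => z; rewrite /k /psi /phi /=; ring.
have ik : leb2.-integrable setT (EFin \o (k : mplane -> R)) by exact: tame_int.
have iFT : leb2.-integrable setT (EFin \o ((fun z : mplane => logk z * g z) \o twist t)).
  by rewrite FT; apply: (integrableD _ ik ipsi).
have mF : measurable_fun setT (fun z : mplane => logk z * g z).
  by apply: measurable_funM => //; exact: measurable_logk.
have E := int2_preserved (preserves_leb2_twist t) mF iFT.
rewrite FT (int2D ik ipsi) /k (int2_logk_comb _ _ tg (tameZ 0 tphi) tr tphi) (int2_logkZ 0 tphi) in E.
move: E phiI psiI.
set I1 := int2 _; set I2 := int2 _; set I3 := int2 _; set I4 := int2 psi => E h2 h4.
(* Invariance leaves t * I3 = I2 + I4, and both integrals on the right are at most 204 Q t^2. *)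
have -> : `|I3| = t^-1 * `|I2 + I4|.
  have -> : I2 + I4 = t * I3 by lra.
  by rewrite normrM gtr0_norm // mulKf ?gt_eqF.
rewrite ler_pdivrMl //; apply: (le_trans (ler_normD _ _)).
by have := lerD h2 h4; rewrite expr2; lra.
Qed.

(** After z -> x - z, the rotation field at x - z is the one at [x] minus the one at [z]. The first
    part gives the rotation of the potential, the second integrates to zero. *)
Lemma invlap_rot f x K : decC2 5 K f ->
  invlap (fun z => z.1 * d2 f z - z.2 * d1 f z) x =
  x.1 * d2 (invlap f) x - x.2 * d1 (invlap f) x.
Proof.
move=> Hf; have H0 := int2_logk_rot x Hf; have [tf tdf] := decC2_tame (isT : (3 <= 5)%N) Hf.
have [df ddf fK dfK ddfK] := Hf; have K0 := dec_bound_ge0 fK.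
have H3 : decC2 3 K f.
  have w n (g : plane R -> R) : dec_bound 5 K g -> dec_bound 3 K g.
    by move=> gK z; apply: (le_trans (gK z)); apply: ler_wpM2l => //; exact: dec_expr_le.
  by split=> //; [exact: (w 0)|move=> b; exact: (w 0)|move=> b c; exact: (w 0)].
have [_ -> ->] := invlap_diff x H3.
have mrot (p q : plane R -> R) : measurable_fun setT (p : mplane -> R) ->
    measurable_fun setT (q : mplane -> R) ->
    measurable_fun setT (fun z : mplane => z.1 * p z - z.2 * q z).
  by move=> mp mq; apply: measurable_funB; apply: measurable_funM.
have trot : tame (fun z => z.1 * d2 f z - z.2 * d1 f z).
  apply: (@tame_dec _ _ 4 K) => //.
    by apply: mrot; apply: diffable_measurable; [exact: (ddf true)|exact: (ddf false)].
  move=> z; apply: dec_absorb => //; [exact: norm1_le_nsq|exact: (dfK true)|exact: (dfK false)].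
have trx : tame (fun z => z.1 * d2 f (psub x z) - z.2 * d1 f (psub x z)).
  have fP b := dec_bound_psub x (dfK b).
  have P0 := dec_bound_ge0 (fP true).
  apply: (@tame_dec _ _ 4 (K * (2 * (1 + nsq x)) ^+ 5)) => //.
    by apply: mrot; apply: (measurableT_comp _ (measurable_psub x));
      apply: diffable_measurable; [exact: (ddf true)|exact: (ddf false)].
  move=> z; apply: dec_absorb => //; [exact: norm1_le_nsq|exact: (fP true)|exact: (fP false)].
have t1 := tame_psub x (tdf false); have t2 := tame_psub x (tdf true).
rewrite (invlap_psub x trot) (invlap_psub x (tdf false)) (invlap_psub x (tdf true)).
have := int2_logk_comb x.2 0 (tameZ x.1 t2) trx t1 t1.
rewrite H0 mul0r (int2_logkZ _ t2) /=.
set J := int2 _ => E.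
have -> : int2 (fun z => logk z * ((psub x z).1 * d2 f (psub x z) - (psub x z).2 * d1 f (psub x z))) = J.
  by rewrite /J; congr int2; apply/funext => z; rewrite /psub /=; ring.
by rewrite E; set A := int2 _; set B := int2 _; ring.
Qed.

End PotentialOfRotation.

(** * Function classes uniform in a parameter *)

Section Classes.
Context {R : realType} {I : Type}.
Implicit Types (F G : I -> plane R -> R) (B : (I -> plane R -> R) -> Prop)
  (d : I -> R) (n : nat) (b : bool) (p : I).

(** [B] bounds a whole family, so uniformity in the parameter is built in. With [B] left abstract,
    sums, products and shifts are treated once for all kinds of bound. *)
Fixpoint cls B n F : Prop :=
  if n is m.+1 then
    [/\ B F, forall p, diffable (F p) & forall b, cls B m (fun p => dd b (F p))]
  else B F.

Lemma cls_bound B n F : cls B n F -> B F.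
Proof. by case: n => [|n] // []. Qed.

Lemma clsW B n F : cls B n.+1 F -> cls B n F.
Proof.
elim: n F => [|n IH] F; first by case.
by move=> [BF dF cF]; split => // b; exact: IH.
Qed.

Lemma cls_sub B B' n F : (forall G, B G -> B' G) -> cls B n F -> cls B' n F.
Proof.
move=> BB'; elim: n F => [|n IH] F /=; first exact: BB'.
by move=> [/BB' BF dF cF]; split => // b; exact: IH.
Qed.

Lemma cls_cst B n (k : I -> R) : B (fun p _ => k p) -> B (fun _ _ => 0) ->
  cls B n (fun p _ => k p).
Proof.
elim: n k => [|n IH] k //= Bk B0; split => // [p x|b]; first exact: differentiable_cst.
have -> : (fun p => dd b (fun _ : plane R => k p)) = (fun _ _ => 0).
  by apply/funext => p; apply/funext => x; rewrite dd_cst.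
exact: IH.
Qed.

Lemma clsD B n F G : (forall F G, B F -> B G -> B (fun p x => F p x + G p x)) ->
  cls B n F -> cls B n G -> cls B n (fun p x => F p x + G p x).
Proof.
move=> BD; elim: n F G => [|n IH] F G /=; first exact: BD.
move=> [BF dF cF] [BG dG cG]; split; first exact: BD.
  by move=> p x; exact: (differentiableD_plane (dF p x) (dG p x)).
move=> b; have -> : (fun p => dd b (fun x => F p x + G p x)) =
    (fun p x => dd b (F p) x + dd b (G p) x).
  by apply/funext => p; apply/funext => x; rewrite (ddD (dF p x) (dG p x)).
exact: IH.
Qed.

Lemma clsM B1 B2 B n F G : (forall F G, B F -> B G -> B (fun p x => F p x + G p x)) ->
  (forall F G, B1 F -> B2 G -> B (fun p x => F p x * G p x)) ->
  cls B1 n F -> cls B2 n G -> cls B n (fun p x => F p x * G p x).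
Proof.
move=> BD BM; elim: n F G => [|n IH] F G /=; first exact: BM.
move=> cF' cG'; have [BF dF cF] := cF'; have [BG dG cG] := cG'; split; first exact: BM.
  by move=> p x; exact: (differentiableM_plane (dF p x) (dG p x)).
move=> b; have -> : (fun p => dd b (fun x => F p x * G p x)) =
    (fun p x => dd b (F p) x * G p x + F p x * dd b (G p) x).
  by apply/funext => p; apply/funext => x; rewrite (ddM (dF p x) (dG p x)).
apply: clsD => //; apply: IH.
- exact: cF.
- exact: (@clsW _ _ G).
- exact: (@clsW _ _ F).
- exact: cG.
Qed.

Lemma cls_shift1 B n (s : I -> R) F :
  (forall F, B F -> B (fun p x => F p (shift1 (s p) x))) ->
  cls B n F -> cls B n (fun p x => F p (shift1 (s p) x)).
Proof.
move=> BS; elim: n F => [|n IH] F /=; first exact: BS.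
move=> [BF dF cF]; split; first exact: BS.
  by move=> p x; case: (hasD_shift1 (dF p (shift1 (s p) x))).
move=> b; have -> : (fun p => dd b (fun x => F p (shift1 (s p) x))) =
    (fun p x => dd b (F p) (shift1 (s p) x)).
  by apply/funext => p; apply/funext => x; case: (hasD_shift1 (dF p (shift1 (s p) x))) => _ ->.
exact: (IH (fun p => dd b (F p)) (cF b)).
Qed.

Definition poly_bound d F : Prop := exists (C : R) (N : nat),
  0 <= C /\ forall p x, `|F p x| <= C * (1 + enorm x) ^+ N * d p.

Definition decay_bound d F : Prop := forall n, exists2 C : R,
  0 <= C & forall p, dec_bound n (C * d p) (F p).

Definition unif_bound d F : Prop := exists2 C : R,
  0 <= C & forall p x, `|F p x| <= C * d p.

(** [OS] is the relation O in S_star; [RD] asks rapid decay of all derivatives, [BD] their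
    boundedness. [BD] is the class stable under arbitrary shifts depending on the parameter. *)
Definition OS d F : Prop := forall n, cls (poly_bound d) n F.
Definition RD d F : Prop := forall n, cls (decay_bound d) n F.
Definition BD d F : Prop := forall n, cls (unif_bound d) n F.
Definition nonneg d : Prop := forall p, 0 <= d p.

Lemma enorm1_ge1 (x : plane R) : 1 <= 1 + enorm x.
Proof. by rewrite lerDl enorm_ge0. Qed.

Lemma poly_boundD d F G : nonneg d -> poly_bound d F -> poly_bound d G ->
  poly_bound d (fun p x => F p x + G p x).
Proof.
move=> d0 [C [N [C0 HF]]] [C' [N' [C0' HG]]]; exists (C + C'), (N + N')%N.
split=> [|p x]; first exact: addr_ge0.
have e1 := enorm1_ge1 x.
apply: (le_trans (ler_normD _ _)); rewrite -mulrA mulrDl.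
apply: lerD.
  apply: (le_trans (HF p x)); rewrite -mulrA; apply: ler_wpM2l => //.
  by apply: ler_wpM2r => //; apply: ler_weXn2l => //; exact: leq_addr.
apply: (le_trans (HG p x)); rewrite -mulrA; apply: ler_wpM2l => //.
by apply: ler_wpM2r => //; apply: ler_weXn2l => //; exact: leq_addl.
Qed.

Lemma poly_boundM d e F G : poly_bound d F -> poly_bound e G ->
  poly_bound (fun p => d p * e p) (fun p x => F p x * G p x).
Proof.
move=> [C [N [C0 HF]]] [C' [N' [C0' HG]]]; exists (C * C'), (N + N')%N.
split=> [|p x]; first exact: mulr_ge0.
rewrite normrM; apply: (le_trans (ler_pM _ _ (HF p x) (HG p x))) => //.
by rewrite exprD le_eqVlt; apply/orP; left; apply/eqP; ring.
Qed.

Lemma enorm1_dec (x : plane R) : (1 + enorm x) * dec x <= 2.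
Proof.
have e0 := enorm_ge0 x; have e2 := enorm_sqr x; have d0 := dec_gt0 x.
have de := dec_eq x.
apply: (@le_trans _ _ (2 * (1 + nsq x) * dec x)); last by rewrite -mulrA de mulr1.
by apply: ler_wpM2r; [exact: ltW|rewrite -e2; have := sqr_ge0 (enorm x - 2^-1); nra].
Qed.

Lemma decay_boundD d F G : decay_bound d F -> decay_bound d G ->
  decay_bound d (fun p x => F p x + G p x).
Proof.
move=> HF HG n; have [C C0 hF] := HF n; have [C' C0' hG] := HG n.
exists (C + C'); first exact: addr_ge0.
move=> p z; apply: (le_trans (ler_normD _ _)); rewrite !mulrDl.
by apply: lerD; [exact: hF|exact: hG].
Qed.

(** Decay of order n + N absorbs growth of order N, because (1 + |x|) dec x <= 2. The scales [d] and
    [e] carry no sign here: the signs that matter are read off from the bounds, whose left sides are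
    absolute values. *)
Lemma decay_boundM d e F G : decay_bound d F -> poly_bound e G ->
  decay_bound (fun p => d p * e p) (fun p x => F p x * G p x).
Proof.
move=> HF [C' [N [C0' HG]]] n; have [C C0 hF] := HF (n + N)%N.
exists (C * C' * 2 ^+ N); first by rewrite !mulr_ge0.
move=> p z; rewrite normrM; apply: (le_trans (ler_pM _ _ (hF p z) (HG p z))) => //.
have e1 := enorm1_dec z; have e0 := enorm1_ge1 z; have d0 := dec_gt0 z.
have Cd : 0 <= C * d p * dec z ^+ n.
  have := le_trans (normr_ge0 _) (hF p z); rewrite exprD mulrA.
  by rewrite pmulr_lge0 // exprn_gt0.
have Ce : 0 <= C' * e p.
  have := le_trans (normr_ge0 _) (HG p z).
  rewrite mulrAC pmulr_lge0 // exprn_gt0; lra.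
rewrite exprD (_ : C * d p * (dec z ^+ n * dec z ^+ N) * (C' * (1 + enorm z) ^+ N * e p) =
  (C * d p * dec z ^+ n) * (C' * e p) * ((1 + enorm z) * dec z) ^+ N); last first.
  by rewrite exprMn; set u := (1 + enorm z) ^+ N; set v := dec z ^+ N; set w := dec z ^+ n; ring.
rewrite (_ : C * C' * 2 ^+ N * (d p * e p) * dec z ^+ n =
  (C * d p * dec z ^+ n) * (C' * e p) * 2 ^+ N); last by ring.
apply: ler_wpM2l; first exact: mulr_ge0.
by rewrite lerXn2r ?nnegrE // mulr_ge0 //; lra.
Qed.

Lemma BD_OS d F : BD d F -> OS d F.
Proof.
move=> H n; apply: cls_sub (H n) => G [C C0 HC]; exists C, 0%N.
by split=> // p x; rewrite expr0 mulr1.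
Qed.

Lemma OSD d F G : nonneg d -> OS d F -> OS d G -> OS d (fun p x => F p x + G p x).
Proof. by move=> d0 HF HG n; apply: clsD => // F' G'; exact: poly_boundD. Qed.

Lemma nonnegM d e : nonneg d -> nonneg e -> nonneg (fun p => d p * e p).
Proof. by move=> d0 e0 p; exact: mulr_ge0. Qed.

Lemma OSM d e F G : nonneg d -> nonneg e -> OS d F -> OS e G ->
  OS (fun p => d p * e p) (fun p x => F p x * G p x).
Proof.
move=> d0 e0 HF HG n; apply: (clsM _ _ (HF n) (HG n)) => F' G'.
  exact: (poly_boundD (nonnegM d0 e0)).
exact: poly_boundM.
Qed.

Lemma RDD d F G : RD d F -> RD d G -> RD d (fun p x => F p x + G p x).
Proof. by move=> HF HG n; apply: clsD => // F' G'; exact: decay_boundD. Qed.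

Lemma RDM d e F G : RD d F -> OS e G -> RD (fun p => d p * e p) (fun p x => F p x * G p x).
Proof.
by move=> HF HG n; apply: (clsM _ _ (HF n) (HG n)) => F' G'; [exact: decay_boundD|exact: decay_boundM].
Qed.

Lemma BD_shift1 d F (s : I -> R) : BD d F -> BD d (fun p x => F p (shift1 (s p) x)).
Proof. by move=> HF n; apply: cls_shift1 (HF n) => G [C C0 HC]; exists C. Qed.

Lemma OS_dd b d F : OS d F -> OS d (fun p => dd b (F p)).
Proof. by move=> HF n; have [_ _ HF1] := HF n.+1; exact: HF1. Qed.

Lemma RD_dd b d F : RD d F -> RD d (fun p => dd b (F p)).
Proof. by move=> HF n; have [_ _ HF1] := HF n.+1; exact: HF1. Qed.

Lemma OS_diffable d F p : OS d F -> diffable (F p).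
Proof. by move=> HF; have [_ HF1 _] := HF 1%N; exact: HF1. Qed.

Lemma RD_diffable d F p : RD d F -> diffable (F p).
Proof. by move=> HF; have [_ HF1 _] := HF 1%N; exact: HF1. Qed.

Lemma OS_cst d (k : I -> R) (C : R) : 0 <= C -> (forall p, `|k p| <= C * d p) ->
  OS d (fun p _ => k p).
Proof.
move=> C0 kd n; apply: cls_cst.
  by exists C, 0%N; split => // p x; rewrite expr0 mulr1.
exists C, 0%N; split => // p x; rewrite expr0 mulr1 normr0.
exact: le_trans (kd p).
Qed.

Lemma OS_le d e F (C : R) : 0 <= C -> (forall p, d p <= C * e p) -> OS d F -> OS e F.
Proof.
move=> C0 de HF n; apply: cls_sub (HF n) => G [C' [N [C0' HG]]].
exists (C' * C), N; split=> [|p x]; first exact: mulr_ge0.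
apply: (le_trans (HG p x)); rewrite (_ : C' * C * _ * _ = C' * (1 + enorm x) ^+ N * (C * e p)).
  by apply: ler_wpM2l => //; rewrite mulr_ge0 // exprn_ge0 // addr_ge0 // enorm_ge0.
by ring.
Qed.

Lemma OS_coord1 : OS (fun=> 1) (fun (_ : I) x => x.1).
Proof.
case=> [|n] /=.
  exists 1, 1%N; split=> // p x; rewrite expr1 mul1r mulr1.
  by have [h _] := norm_le_enorm x; lra.
split.
- exists 1, 1%N; split=> // p x; rewrite expr1 mul1r mulr1.
  by have [h _] := norm_le_enorm x; lra.
- by move=> p x; case: (hasD_coord1 x).
- move=> b; have -> : (fun _ : I => dd b (fun x : plane R => x.1)) = (fun _ _ => if b then 0 else 1).
    by apply/funext => p; apply/funext => x; case: (hasD_coord1 x) => _; case: b.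
  apply: (@OS_cst (fun=> 1) (fun=> if b then 0 else 1) 1) => // p.
  by case: b; rewrite ?normr0 ?normr1 mulr1.
Qed.

Lemma OS_coord2 : OS (fun=> 1) (fun (_ : I) x => x.2).
Proof.
case=> [|n] /=.
  exists 1, 1%N; split=> // p x; rewrite expr1 mul1r mulr1.
  by have [_ h] := norm_le_enorm x; lra.
split.
- exists 1, 1%N; split=> // p x; rewrite expr1 mul1r mulr1.
  by have [_ h] := norm_le_enorm x; lra.
- by move=> p x; case: (hasD_coord2 x).
- move=> b; have -> : (fun _ : I => dd b (fun x : plane R => x.2)) = (fun _ _ => if b then 1 else 0).
    by apply/funext => p; apply/funext => x; case: (hasD_coord2 x) => _; case: b.
  apply: (@OS_cst (fun=> 1) (fun=> if b then 1 else 0) 1) => // p.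
  by case: b; rewrite ?normr0 ?normr1 mulr1.
Qed.

Lemma OSZ d (k : I -> R) (C : R) e F : nonneg d -> nonneg e -> 0 <= C ->
  (forall p, `|k p| <= C * e p) -> OS d F -> OS (fun p => e p * d p) (fun p x => k p * F p x).
Proof. by move=> d0 e0 C0 kC HF; apply: OSM => //; exact: OS_cst kC. Qed.

Lemma dmulti_rcons (s : seq bool) b (f : plane R -> R) :
  dmulti (rcons s b) f = dmulti s (dd b f).
Proof. by rewrite /dmulti foldr_rcons. Qed.

(** The recursion in [cls] peels off the derivative applied first, which is the last entry of the
    list; hence the induction from the right end. *)
Lemma OS_dmultiP d F : nonneg d ->
  OS d F <->
  ((forall p, smooth (F p)) /\
   forall s : seq bool, exists (C : R) (N : nat), forall p x,
     `|dmulti s (F p) x| <= C * (1 + enorm x) ^+ N * d p).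
Proof.
move=> d0; split.
  move=> HF; split.
    move=> p s; elim/last_ind: s F HF => [|s b IH] F HF.
      exact: OS_diffable HF.
    by rewrite dmulti_rcons; apply: (IH (fun p => dd b (F p))); exact: OS_dd.
  move=> s; elim/last_ind: s F HF => [|s b IH] F HF.
    by have /cls_bound[C [N [_ H]]] := HF 0%N; exists C, N.
  by have [C [N H]] := IH _ (OS_dd b HF); exists C, N => p x; rewrite dmulti_rcons.
move=> [sF HF] n; elim: n F sF HF => [|n IH] F sF HF.
  have [C [N H]] := HF [::]; exists `|C|, N; split => // p x.
  apply: (le_trans (H p x)); apply: ler_wpM2r => //.
  by apply: ler_wpM2r; [rewrite exprn_ge0 // addr_ge0 // enorm_ge0|exact: ler_norm].
split.
- have [C [N H]] := HF [::]; exists `|C|, N; split => // p x.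
  apply: (le_trans (H p x)); apply: ler_wpM2r => //.
  by apply: ler_wpM2r; [rewrite exprn_ge0 // addr_ge0 // enorm_ge0|exact: ler_norm].
- by move=> p; exact: (sF p [::]).
- move=> b; apply: IH => [p s|s]; first by rewrite -dmulti_rcons; exact: sF.
  by have [C [N H]] := HF (rcons s b); exists C, N => p x; rewrite -dmulti_rcons.
Qed.

End Classes.

Lemma cls_reindex {R : realType} {I J : Type} (g : J -> I)
  (B : (I -> plane R -> R) -> Prop) (B' : (J -> plane R -> R) -> Prop) n F :
  (forall F, B F -> B' (F \o g)) -> cls B n F -> cls B' n (F \o g).
Proof.
move=> BB'; elim: n F => [|n IH] F /=; first exact: BB'.
move=> [BF dF cF]; split; [exact: BB'|by move=> p; exact: dF|].
by move=> b; exact: (IH (fun p => dd b (F p))).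
Qed.

Lemma OS_reindex {R : realType} {I J : Type} (g : J -> I) (d : I -> R) F :
  OS d F -> OS (d \o g) (F \o g).
Proof.
move=> HF n; apply: cls_reindex (HF n) => G [C [N [C0 H]]].
by exists C, N; split => // p x; exact: H.
Qed.

(** * Gaussian-weighted classes and the potentials of their members *)

Section GaussianClasses.
Context {R : realType} {I : Type}.
Implicit Types (F G H a : I -> plane R -> R) (d e : I -> R) (n : nat) (b c : bool) (p : I).

Definition coord b (x : plane R) : R := if b then x.2 else x.1.

Lemma OS_coord b : OS (fun=> 1) (fun (_ : I) => coord b).
Proof. by case: b; [exact: OS_coord2|exact: OS_coord1]. Qed.

Lemma OS_half_coord b : OS (fun=> 1) (fun (_ : I) x => - 2^-1 * coord b x).
Proof.
have h1 : nonneg (fun _ : I => 1 : R) by move=> p; exact: ler01.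
have k : forall p : I, `|- 2^-1 : R| <= 1 * 1.
  by move=> _; rewrite normrN ger0_norm ?invr_ge0 // mul1r invf_le1 // ler1n.
have := OSZ h1 h1 ler01 k (OS_coord b); congr OS.
by apply/funext => p; rewrite mulr1.
Qed.

Lemma Gauss_gt0 (x : plane R) : 0 < Gauss x.
Proof. by rewrite /Gauss mulr_gt0 ?expR_gt0 // invr_gt0 mulr_gt0 // pi_gt0. Qed.

Lemma diffable_nsq : diffable (@nsq R) /\ forall b x, dd b (@nsq R) x = 2 * coord b x.
Proof.
have dc x : differentiable ((fun y => y.1) : R * R -> R) x by case: (hasD_coord1 x).
have dc' x : differentiable ((fun y => y.2) : R * R -> R) x by case: (hasD_coord2 x).
have E : @nsq R = (fun x => x.1 * x.1 + x.2 * x.2).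
  by apply/funext => x; rewrite /nsq !expr2.
rewrite E; split=> [x|b x].
  by apply: differentiableD_plane; apply: differentiableM_plane.
rewrite (ddD (differentiableM_plane (dc x) (dc x)) (differentiableM_plane (dc' x) (dc' x))).
rewrite (ddM (dc x) (dc x)) (ddM (dc' x) (dc' x)).
have [_ h1 h2] := hasD_coord1 x; have [_ h3 h4] := hasD_coord2 x.
by case: b; rewrite /dd /= ?h1 ?h2 ?h3 ?h4; ring.
Qed.

Lemma GaussE : @Gauss R = fun x => (4 * pi)^-1 * expR (- 4^-1 * nsq x).
Proof. by apply/funext => x; rewrite /Gauss enorm_sqr mulNr mulrC [_ * 4^-1]mulrC [4^-1 * _]mulrC mulrC. Qed.

Lemma Gauss_dd : diffable (@Gauss R) /\
  forall b, dd b (@Gauss R) = fun x => Gauss x * (- 2^-1 * coord b x).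
Proof.
have [dn en] := diffable_nsq.
have dq (x : plane R) := differentiableZ_plane (- 4^-1) (dn x).
have he x := hasD_comp (is_derive_expR (- 4^-1 * nsq x)) (dq x).
rewrite GaussE; split=> [x|b].
  by apply: differentiableZ_plane; case: (he x).
apply/funext => x; have [d1x d2x] := he x.
rewrite (ddZ b _ d1x) d2x (ddZ b _ (dn x)) en.
by set k := (4 * pi)^-1; set E := expR _; field.
Qed.

(** With s = |x|^2 and m the positive exponent, exp(s/4) = exp(s/(4m))^m >= (1 + s/(4m))^m >= ((1 +
    s)/(4m))^m. *)
Lemma Gauss_decay n : exists2 C : R, 0 <= C & dec_bound n C (@Gauss R).
Proof.
case: n => [|n].
  exists (4 * pi)^-1; first by rewrite invr_ge0 mulr_ge0 // pi_ge0.
  move=> x; rewrite expr0 mulr1 (ger0_norm (ltW (Gauss_gt0 x))) /Gauss ler_piMr //.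
    by rewrite invr_ge0 mulr_ge0 // pi_ge0.
  by rewrite -expR0 ler_expR oppr_le0 divr_ge0 // sqr_ge0.
pose m : R := n.+1%:R; pose c : R := (4 * pi)^-1.
have m1 : 1 <= m by rewrite /m ler1n.
have c0 : 0 <= c by rewrite invr_ge0 mulr_ge0 // pi_ge0.
exists (c * (4 * m) ^+ n.+1); first by rewrite mulr_ge0 // exprn_ge0 //; lra.
move=> x; rewrite (ger0_norm (ltW (Gauss_gt0 x))) /Gauss -/c -mulrA; apply: ler_wpM2l => //.
rewrite enorm_sqr expRN -exprMn /dec.
have x0 := nsq_ge0 x; have s0 : 0 < 1 + nsq x by lra.
have -> : nsq x / 4 = nsq x / (4 * m) * m by field; lra.
have k0 : 0 < 4 * m * (1 + nsq x)^-1 by apply: mulr_gt0; rewrite ?invr_gt0; lra.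
rewrite [X in expR X]mulrC expRM_natl -exprVn.
rewrite lerXn2r ?nnegrE ?invr_ge0 ?expR_ge0 ?(ltW k0) // -[leRHS]invrK.
rewrite lef_pV2 ?posrE ?expR_gt0 ?invr_gt0 // invf_div.
apply: le_trans (expR_ge1Dx _).
rewrite ler_pdivrMr; last lra.
by rewrite mulrDl divfK; [nra|lra].
Qed.

Lemma RD_Gauss : RD (fun=> 1) (fun _ : I => @Gauss R).
Proof.
have B0 : decay_bound (fun=> 1) (fun _ : I => @Gauss R).
  by move=> n; have [C C0 HC] := Gauss_decay n; exists C => // p; rewrite mulr1.
have [dG eG] := Gauss_dd.
elim=> [|n IH] //=; split => // b; rewrite eG.
have HS := OS_half_coord b.
have := clsM (@decay_boundD _ _ (fun=> 1)) _ IH (HS n).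
apply=> F' G' HF HG; have := decay_boundM HF HG.
by congr decay_bound; apply/funext => p; rewrite mulr1.
Qed.

Definition OZ d F : Prop := OS d (fun p x => (Gauss x)^-1 * F p x).

Lemma OZ_intro d H : OS d H -> OZ d (fun p x => Gauss x * H p x).
Proof.
rewrite /OZ (_ : (fun p x => _) = H) //; apply/funext => p; apply/funext => x.
by rewrite mulKf // gt_eqF // Gauss_gt0.
Qed.

Lemma OZ_elim d F : OZ d F -> exists2 H, OS d H & F = (fun p x => Gauss x * H p x).
Proof.
move=> HF; exists (fun p x => (Gauss x)^-1 * F p x) => //.
by apply/funext => p; apply/funext => x; rewrite mulVKf // gt_eqF // Gauss_gt0.
Qed.

Lemma OZD d F G : nonneg d -> OZ d F -> OZ d G -> OZ d (fun p x => F p x + G p x).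
Proof.
move=> d0 /OZ_elim[H HH ->] /OZ_elim[K HK ->].
rewrite (_ : (fun p x => Gauss x * H p x + Gauss x * K p x) = (fun p x => Gauss x * (H p x + K p x))).
  by apply: OZ_intro; exact: OSD.
by apply/funext => p; apply/funext => x; rewrite mulrDr.
Qed.

Lemma OZM d e F G : nonneg d -> nonneg e -> OS d F -> OZ e G ->
  OZ (fun p => d p * e p) (fun p x => F p x * G p x).
Proof.
move=> d0 e0 HF /OZ_elim[K HK ->].
rewrite (_ : (fun p x => F p x * (Gauss x * K p x)) = (fun p x => Gauss x * (F p x * K p x))).
  by apply: OZ_intro; exact: OSM.
by apply/funext => p; apply/funext => x; rewrite mulrCA.
Qed.

Lemma OZ_RD d F : OZ d F -> RD d F.
Proof.
move=> /OZ_elim[H HH ->]; have := RDM RD_Gauss HH; congr RD.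
by apply/funext => p; rewrite mul1r.
Qed.

Lemma OZZ d (k : I -> R) (C : R) e F : nonneg d -> nonneg e -> 0 <= C ->
  (forall p, `|k p| <= C * e p) -> OZ d F -> OZ (fun p => e p * d p) (fun p x => k p * F p x).
Proof. by move=> d0 e0 C0 kC HF; apply: OZM => //; exact: OS_cst kC. Qed.

Lemma OZ_le d e F (C : R) : 0 <= C -> (forall p, d p <= C * e p) -> OZ d F -> OZ e F.
Proof. exact: OS_le. Qed.

(** Differentiating the Gaussian factor produces the polynomial factor -xi_b/2, which S_star
    absorbs. *)
Lemma OZ_dd b d F : nonneg d -> OZ d F -> OZ d (fun p => dd b (F p)).
Proof.
move=> d0 /OZ_elim[H HH ->]; have [dG eG] := Gauss_dd.
rewrite (_ : (fun p => dd b (fun x => Gauss x * H p x)) = (fun p x => Gauss x * (dd b (H p) x + (- 2^-1 * coord b x) * H p x))).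
  apply: OZ_intro; apply: OSD => //; first exact: OS_dd.
  have h1 : nonneg (fun _ : I => 1 : R) by move=> p; exact: ler01.
  have HS := OS_half_coord b.
  have := OSM h1 d0 HS HH; congr OS; by apply/funext => p; rewrite mul1r.
apply/funext => p; apply/funext => x.
rewrite (ddM (dG x) (OS_diffable p HH x)) eG; ring.
Qed.

(** The natural class for the first argument of a bracket: the value of [a] is left
    unconstrained. *)
Definition GOS d a : Prop :=
  (forall p, diffable (a p)) /\ forall b, OS d (fun p => dd b (a p)).

Lemma OS_GOS d F : OS d F -> GOS d F.
Proof. by move=> HF; split=> [p|b]; [exact: (OS_diffable p HF)|exact: OS_dd]. Qed.

Lemma GOSD d F G : nonneg d -> GOS d F -> GOS d G -> GOS d (fun p x => F p x + G p x).
Proof.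
move=> d0 [dF HF] [dG HG]; split=> [p x|b]; first exact: (differentiableD_plane (dF p x) (dG p x)).
rewrite (_ : (fun p => dd b (fun x => F p x + G p x)) = (fun p x => dd b (F p) x + dd b (G p) x)); first exact: OSD.
by apply/funext => p; apply/funext => x; rewrite (ddD (dF p x) (dG p x)).
Qed.

Lemma GOS_cst (k : I -> R) d : nonneg d -> GOS d (fun p _ => k p).
Proof.
move=> d0; split=> [p x|b]; first exact: differentiable_cst.
rewrite (_ : (fun p => dd b (fun _ => k p)) = (fun _ _ => 0)).
  by apply: (@OS_cst _ _ d (fun=> 0) 0) => // p; rewrite normr0 mul0r.
by apply/funext => p; apply/funext => x; rewrite dd_cst.
Qed.

Lemma OZ_bracket d e a F : nonneg d -> nonneg e -> GOS d a -> OZ e F ->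
  OZ (fun p => d p * e p) (fun p => bracket (a p) (F p)).
Proof.
move=> d0 e0 [da Ha] HF.
rewrite (_ : (fun p => bracket (a p) (F p)) = (fun p x => dd false (a p) x * dd true (F p) x +
   dd true (a p) x * (-1 * dd false (F p) x))); last first.
  by apply/funext => p; apply/funext => x; rewrite /bracket /dd; ring.
apply: OZD; first exact: nonnegM.
  by apply: OZM => //; exact: OZ_dd.
apply: OZM => //.
have h1 : nonneg (fun _ : I => 1 : R) by move=> p; exact: ler01.
have := @OZZ e (fun=> -1) 1 (fun=> 1) _ e0 h1 ler01 _ (OZ_dd false e0 HF).
move=> /(_ ltac:(by move=> p; rewrite normrN normr1 mulr1)).
by congr OZ; apply/funext => p; rewrite mul1r.
Qed.

Lemma RD_decC2 d F n : nonneg d -> RD d F ->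
  exists2 C, 0 <= C & forall p, decC2 n (C * d p) (F p).
Proof.
move=> d0 HF; have [B0 dF cF] := HF 2%N.
have B1 b : decay_bound d (fun p => dd b (F p)) by case: (cF b).
have D1 b p : diffable (dd b (F p)) by case: (cF b) => _ D _; exact: D.
have B2 b c : decay_bound d (fun p => dd b (dd c (F p))) by case: (cF c) => _ _ B; exact: B.
have [C C0 H] := B0 n; have [C1 C10 H1] := B1 false n; have [C2 C20 H2] := B1 true n.
have [C3 C30 H3] := B2 false false n; have [C4 C40 H4] := B2 false true n.
have [C5 C50 H5] := B2 true false n; have [C6 C60 H6] := B2 true true n.
exists (C + C1 + C2 + C3 + C4 + C5 + C6); first by rewrite !addr_ge0.
have w (K L : R) p (g : plane R -> R) : K <= L -> dec_bound n (K * d p) g -> dec_bound n (L * d p) g.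
  move=> KL gK z; apply: (le_trans (gK z)); apply: ler_wpM2r; last exact: ler_wpM2r.
  by rewrite exprn_ge0 // ltW // dec_gt0.
move=> p; split=> //.
- by apply: w (H p); lra.
- by case; [apply: w (H2 p)|apply: w (H1 p)]; lra.
- by case; case; [apply: w (H6 p)|apply: w (H5 p)|apply: w (H4 p)|apply: w (H3 p)]; lra.
Qed.

Section Potential.
Variables (d : I -> R) (F : I -> plane R -> R).
Hypotheses (d0 : nonneg d) (HF : RD d F).

Lemma diffable_invlap p : diffable (invlap (F p)).
Proof. by have [C C0 H] := RD_decC2 3 d0 HF; move=> x; case: (invlap_diff x (H p)). Qed.

Lemma dd_invlap b p : dd b (invlap (F p)) = invlap (dd b (F p)).
Proof.
have [C C0 H] := RD_decC2 3 d0 HF; apply/funext => x.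
have [_ e1 e2] := invlap_diff x (H p); case: b; [exact: e2|exact: e1].
Qed.

Lemma invlap_rotation p x : invlap (fun z => z.1 * d2 (F p) z - z.2 * d1 (F p) z) x =
  x.1 * d2 (invlap (F p)) x - x.2 * d1 (invlap (F p)) x.
Proof. by have [C C0 H] := RD_decC2 5 d0 HF; exact: invlap_rot (H p). Qed.

Lemma RD_tame p : tame (F p).
Proof. by have [C C0 H] := RD_decC2 3 d0 HF; case: (decC2_tame (leqnn 3) (H p)). Qed.

End Potential.

(** Derivatives pass into the density, so each derivative of the gradient is again the gradient of
    the potential of a rapidly decaying density, and the same bound applies. *)
Lemma BD_dd_invlap b d F : nonneg d -> RD d F -> BD d (fun p => dd b (invlap (F p))).
Proof.
move=> d0 HF n; elim: n b F HF => [|n IH] b F HF.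
  have [C C0 H] := RD_decC2 3 d0 HF; exists (204 * C); first exact: mulr_ge0 (ler0n _ _) C0.
  move=> p x; have := dd_invlap_bound b x (H p); rewrite mulrA; exact.
split.
- exact: cls_bound (IH b F HF).
- by move=> p; rewrite (dd_invlap d0 HF); apply: (diffable_invlap d0 (RD_dd b HF) p).
- move=> c; rewrite (_ : (fun p => dd c (dd b (invlap (F p)))) = (fun p => dd c (invlap (dd b (F p))))).
    by apply: (IH c (fun p => dd b (F p))); exact: RD_dd.
  by apply/funext => p; rewrite (dd_invlap d0 HF).
Qed.

Lemma GOS_invlap_shift d F (s : I -> R) : nonneg d -> RD d F ->
  GOS d (fun p x => invlap (F p) (shift1 (s p) x)).
Proof.
move=> d0 HF; have dF := diffable_invlap d0 HF; split=> [p x|b].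
  by case: (hasD_shift1 (dF p (shift1 (s p) x))).
rewrite (_ : (fun p => dd b (fun x => invlap (F p) (shift1 (s p) x))) = (fun p x => dd b (invlap (F p)) (shift1 (s p) x))).
  exact: BD_OS (BD_shift1 s (BD_dd_invlap b d0 HF)).
by apply/funext => p; apply/funext => x; case: (hasD_shift1 (dF p (shift1 (s p) x))) => _ ->.
Qed.

Lemma GOS_invlap d F : nonneg d -> RD d F -> GOS d (fun p => invlap (F p)).
Proof.
move=> d0 HF; split; first exact: diffable_invlap.
by move=> b; apply: BD_OS; exact: BD_dd_invlap.
Qed.

End GaussianClasses.

(** * Symmetry of second derivatives and the Jacobi identity *)

Section Jacobi.
Context {R : realType}.
Implicit Types (x y z : plane R) (f g k : plane R -> R) (b c : bool).

Definition diff3 f : Prop :=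
  [/\ diffable f, forall b, diffable (dd b f) & forall b c, diffable (dd b (dd c f))].

Definition along b (t : R) z : plane R := padd z (t * (dir b).1, t * (dir b).2).

Lemma is_derive_along f b z (t : R) : diffable f ->
  is_derive t 1 (fun s : R => f (along b s z)) (dd b f (along b t z)).
Proof.
move=> df; have := @is_derive_line R f z (dir b) t (df _).
by case: b; rewrite /= !(mul0r, mul1r, add0r, addr0).
Qed.

Lemma along0 b z : along b 0 z = z.
Proof. by case: z => p q; rewrite /along /padd /= !mul0r !addr0. Qed.

Lemma along_comm b c (s t : R) z : along b s (along c t z) = along c t (along b s z).
Proof. by rewrite /along /padd /=; congr pair; ring. Qed.

Lemma along_mvt f b z (h : R) : 0 <= h -> diffable f ->
  exists2 t, 0 <= t <= h & f (along b h z) - f z = dd b f (along b t z) * h.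
Proof.
move=> h0 df; have D t := is_derive_along b z t df.
have cF : {within `[0, h], continuous (fun s : R => f (along b s z))}.
  by apply: continuous_subspaceT => t; apply: differentiable_continuous; apply/derivable1_diffP.
have [t] := MVT_segment h0 (fun t _ => D t) cF.
by rewrite in_itv /= along0 subr0 => t0 E; exists t.
Qed.

(** The mean value theorem is applied to the difference of [f] along two parallel segments, so that
    one intermediate point serves both. *)
Lemma along_mvt2 f b z z' (h : R) : 0 <= h -> diffable f ->
  exists2 t, 0 <= t <= h & f (along b h z') - f (along b h z) - (f z' - f z) =
    (dd b f (along b t z') - dd b f (along b t z)) * h.
Proof.
move=> h0 df; have D t := is_derive_comb 1 (-1) (is_derive_along b z' t df) (is_derive_along b z t df).
set F := (fun s => _) in D.
have cF : {within `[0, h], continuous F}.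
  by apply: continuous_subspaceT => t; apply: differentiable_continuous; apply/derivable1_diffP.
have [t] := MVT_segment h0 (fun t _ => D t) cF.
rewrite in_itv /= /F !along0 subr0 => t0 E; exists t => //.
by move: E; rewrite !mul1r !mulN1r.
Qed.

Lemma second_difference f b c x (h : R) : 0 < h -> diffable f -> (forall b, diffable (dd b f)) ->
  exists s t : R, [/\ 0 <= s <= h, 0 <= t <= h &
    f (along b h (along c h x)) - f (along b h x) - (f (along c h x) - f x) =
    dd c (dd b f) (along c t (along b s x)) * h * h].
Proof.
move=> h0 df ddf; have hle := ltW h0.
have [s s0 ->] := along_mvt2 b x (along c h x) hle df.
rewrite along_comm; have [t t0 ->] := along_mvt c (along b s x) hle (ddf b).
by exists s, t.
Qed.

Lemma rdist_along2 b c (s t h : R) x : 0 <= s <= h -> 0 <= t <= h -> b != c ->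
  rdist x (along c t (along b s x)) <= h.
Proof.
move=> /andP[s0 sh] /andP[t0 th]; rewrite /rdist ge_max /along /padd /=.
have e (u v w : R) : u + v + w - u = v + w by ring.
rewrite !e; case: b; case: c => //= _; rewrite !(mulr0, mulr1, addr0, add0r) !ger0_norm //;
  by apply/andP.
Qed.

Lemma continuous_rdist f x (e : R) : 0 < e -> differentiable (f : R * R -> R) x ->
  exists2 r, 0 < r & forall y, rdist x y < r -> `|f x - f y| < e.
Proof.
move=> e0 /differentiable_continuous cf.
have := cf _ (nbhsx_ballx (f x) e e0) => /nbhs_ballP[r /= r0 H].
exists r => // y; rewrite /rdist gt_max => /andP[h1 h2].
by apply: (H y); split; rewrite /ball /= distrC.
Qed.

(** The second difference over a square of side h is symmetric in the two directions, and it equals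
    h^2 times either mixed derivative at some point of the square. Continuity of both at [x] makes
    them agree there. *)
Lemma schwarz f b c x : diff3 f -> dd b (dd c f) x = dd c (dd b f) x.
Proof.
move=> [df ddf dddf]; have [<- //|bc] := eqVneq b c.
apply/eqP; rewrite -subr_eq0 -normr_le0; apply/ler_addgt0Pr => e e0; rewrite add0r.
have e2 : 0 < e / 2 by lra.
have [r1 r10 H1] := continuous_rdist e2 (dddf b c x).
have [r2 r20 H2] := continuous_rdist e2 (dddf c b x).
pose h := Num.min r1 r2 / 2.
have m0 : 0 < Num.min r1 r2 by rewrite lt_min r10.
have h0 : 0 < h by rewrite /h; lra.
have [hr1 hr2] : h < r1 /\ h < r2.
  have : Num.min r1 r2 <= r1 by rewrite ge_min lexx.
  have : Num.min r1 r2 <= r2 by rewrite ge_min lexx orbT.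
  by rewrite /h; lra.
have [s [t [s0 t0 E]]] := second_difference b c x h0 df ddf.
have [s' [t' [s0' t0' E']]] := second_difference c b x h0 df ddf.
set P := along c t (along b s x) in E; set Q := along b t' (along c s' x) in E'.
have EE : dd c (dd b f) P = dd b (dd c f) Q.
  have hn : h != 0 by rewrite gt_eqF.
  have E2 : dd c (dd b f) P * h * h = dd b (dd c f) Q * h * h.
    by rewrite -E' -[LHS]E (along_comm b c h h x); ring.
  exact: (mulIf hn (mulIf hn E2)).
have cb : c != b by rewrite eq_sym.
have bP := H2 P (le_lt_trans (rdist_along2 x s0 t0 bc) hr2).
have bQ := H1 Q (le_lt_trans (rdist_along2 x s0' t0' cb) hr1).
rewrite EE distrC in bP.
have := ler_distD (dd b (dd c f) Q) (dd b (dd c f) x) (dd c (dd b f) x).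
lra.
Qed.

Lemma bracketE f g : bracket f g = fun x => dd false f x * dd true g x - dd true f x * dd false g x.
Proof. by []. Qed.

Lemma bracket_at f g x :
  bracket f g x = dd false f x * dd true g x - dd true f x * dd false g x.
Proof. by []. Qed.

Lemma diffable_bracket f g : (forall b, diffable (dd b f)) -> (forall b, diffable (dd b g)) ->
  diffable (bracket f g).
Proof.
move=> df dg x; rewrite bracketE.
have -> : (fun x => dd false f x * dd true g x - dd true f x * dd false g x) =
  (fun x => dd false f x * dd true g x + (-1) * (dd true f x * dd false g x)).
  by apply/funext => y; rewrite mulN1r.
apply: differentiableD_plane; first exact: (differentiableM_plane (df false x) (dg true x)).
exact/differentiableZ_plane/(differentiableM_plane (df true x) (dg false x)).
Qed.

Lemma dd_bracket b f g x : (forall b, diffable (dd b f)) -> (forall b, diffable (dd b g)) ->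
  dd b (bracket f g) x = (dd b (dd false f) x * dd true g x + dd false f x * dd b (dd true g) x)
    - (dd b (dd true f) x * dd false g x + dd true f x * dd b (dd false g) x).
Proof.
move=> df dg; rewrite bracketE.
have -> : (fun x => dd false f x * dd true g x - dd true f x * dd false g x) =
  (fun x => dd false f x * dd true g x + (-1) * (dd true f x * dd false g x)).
  by apply/funext => y; rewrite mulN1r.
have D1 := differentiableM_plane (df false x) (dg true x).
have D2 := differentiableM_plane (df true x) (dg false x).
rewrite (ddD D1 (differentiableZ_plane (-1) D2)) (ddZ b _ D2).
by rewrite (ddM (df false x) (dg true x)) (ddM (df true x) (dg false x)) mulN1r.
Qed.

(** The derivation form, in which {f, .} obeys the Leibniz rule on {g, k}. Once mixed derivatives
    are symmetrised, it is a polynomial identity in the derivatives. *)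
Lemma jacobi f g k x : diff3 f -> diff3 g -> diff3 k ->
  bracket f (bracket g k) x = bracket (bracket f g) k x + bracket g (bracket f k) x.
Proof.
move=> Cf Cg Ck; have [_ df _] := Cf; have [_ dg _] := Cg; have [_ dk _] := Ck.
rewrite [LHS]bracket_at [X in _ = X + _]bracket_at [X in _ = _ + X]bracket_at.
rewrite !dd_bracket // (schwarz true false x Cf) (schwarz true false x Cg) (schwarz true false x Ck).
move: (dd false (dd false f) x) (dd false (dd true f) x) (dd true (dd true f) x).
move: (dd false (dd false g) x) (dd false (dd true g) x) (dd true (dd true g) x).
move: (dd false (dd false k) x) (dd false (dd true k) x) (dd true (dd true k) x).
move: (dd false f x) (dd true f x) (dd false g x) (dd true g x) (dd false k x) (dd true k x).
move=> *; ring.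
Qed.

Lemma bracketDr f g k x : diffable g -> diffable k ->
  bracket f (fun y => g y + k y) x = bracket f g x + bracket f k x.
Proof.
move=> dg dk; rewrite !bracket_at !(ddD (dg x) (dk x)).
move: (dd false f x) (dd true f x) (dd false g x) (dd true g x) (dd false k x) (dd true k x).
by move=> *; ring.
Qed.

Lemma bracketDl f g k x : diffable f -> diffable g ->
  bracket (fun y => f y + g y) k x = bracket f k x + bracket g k x.
Proof.
move=> df dg; rewrite !bracket_at !(ddD (df x) (dg x)).
move: (dd false f x) (dd true f x) (dd false g x) (dd true g x) (dd false k x) (dd true k x).
by move=> *; ring.
Qed.

Lemma bracketZl (a : R) f g x : diffable f -> bracket (fun y => a * f y) g x = a * bracket f g x.
Proof.
move=> df; rewrite !bracket_at !(ddZ _ _ (df x)).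
move: (dd false f x) (dd true f x) (dd false g x) (dd true g x).
by move=> *; ring.
Qed.

Lemma bracketZr (a : R) f g x : diffable g -> bracket f (fun y => a * g y) x = a * bracket f g x.
Proof.
move=> dg; rewrite !bracket_at !(ddZ _ _ (dg x)).
move: (dd false f x) (dd true f x) (dd false g x) (dd true g x).
by move=> *; ring.
Qed.

Lemma bracketC f g x : bracket f g x = - bracket g f x.
Proof.
rewrite !bracket_at; move: (dd false f x) (dd true f x) (dd false g x) (dd true g x).
by move=> *; ring.
Qed.

Lemma bracket_cstl (a : R) f x : bracket (fun _ => a) f x = 0.
Proof. by rewrite bracket_at !dd_cst !mul0r subrr. Qed.

Lemma OS_diff3 {I : Type} (d : I -> R) F (p : I) : OS d F -> diff3 (F p).
Proof.
move=> H; split=> [|b|b c]; first exact: (OS_diffable p H).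
  exact: (OS_diffable p (OS_dd b H)).
exact: (OS_diffable p (OS_dd b (OS_dd c H))).
Qed.

Lemma GOS_diff3 {I : Type} (d : I -> R) F (p : I) : GOS d F -> diff3 (F p).
Proof.
move=> [dF H]; split=> [|b|b c]; first exact: dF.
  exact: (OS_diffable p (H b)).
exact: (OS_diffable p (OS_dd b (H c))).
Qed.

Lemma RD_diff3 {I : Type} (d : I -> R) F (p : I) : RD d F -> diff3 (F p).
Proof.
move=> H; split=> [|b|b c]; first exact: (RD_diffable p H).
  exact: (RD_diffable p (RD_dd b H)).
exact: (RD_diffable p (RD_dd b (RD_dd c H))).
Qed.

End Jacobi.

(** * Exact identities at fixed epsilon *)

Section ExactIdentities.
Context {R : realType}.
Implicit Types (x y z : plane R) (f g : plane R -> R) (w rho : vfun R) (i : 'I_2) (b : bool).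

(** A one-point parameter space makes the uniform calculus available for a single function. *)
Definition RD1 f : Prop := RD (fun _ : unit => 1) (fun _ => f).

Lemma nonneg1 {I : Type} : nonneg (fun _ : I => 1 : R).
Proof. by move=> p; exact: ler01. Qed.

Lemma OSM1 {I : Type} (F H : I -> plane R -> R) : OS (fun=> 1) F -> OS (fun=> 1) H ->
  OS (fun=> 1) (fun p x => F p x * H p x).
Proof.
move=> HF HH; have := OSM nonneg1 nonneg1 HF HH; congr OS.
by apply/funext => p; rewrite mulr1.
Qed.

Lemma RD1_diff3 f : RD1 f -> diff3 f.
Proof. exact: (@RD_diff3 _ _ _ (fun _ => f) tt). Qed.

Lemma RD1_tame f : RD1 f -> tame f.
Proof. by move=> H; exact: (RD_tame nonneg1 H tt). Qed.

Lemma RD1_dd b f : RD1 f -> RD1 (dd b f).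
Proof. exact: RD_dd. Qed.

Lemma RD1D f g : RD1 f -> RD1 g -> RD1 (fun x => f x + g x).
Proof. exact: RDD. Qed.

Lemma RD1M f g : RD1 f -> OS (fun _ : unit => 1) (fun _ => g) -> RD1 (fun x => f x * g x).
Proof. by move=> Hf Hg; have := RDM Hf Hg; congr RD; apply/funext => p; rewrite mulr1. Qed.

Lemma OS1_cst (k : R) : OS (fun _ : unit => 1) (fun _ _ => k).
Proof. by apply: (@OS_cst _ _ _ (fun=> k) `|k|) => // p; rewrite mulr1. Qed.

Lemma RD1Z (k : R) f : RD1 f -> RD1 (fun x => k * f x).
Proof.
move=> Hf; have := RD1M Hf (OS1_cst k); congr RD.
by apply/funext => p; apply/funext => x; rewrite mulrC.
Qed.

Lemma RD1_diffable_invlap f : RD1 f -> diffable (invlap f).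
Proof. by move=> H; exact: (diffable_invlap nonneg1 H tt). Qed.

Lemma RD1_dd_invlap b f : RD1 f -> dd b (invlap f) = invlap (dd b f).
Proof. by move=> H; exact: (dd_invlap nonneg1 H b tt). Qed.

Lemma RD1_rot f : RD1 f -> RD1 (fun z => z.1 * d2 f z - z.2 * d1 f z).
Proof.
move=> Hf; have H1 := RD1M (RD1_dd true Hf) (@OS_coord1 R unit).
have H2 := RD1Z (-1) (RD1M (RD1_dd false Hf) (@OS_coord2 R unit)).
have := RD1D H1 H2; congr RD; apply/funext => p; apply/funext => z.
by rewrite mulN1r mulrC [X in _ - X]mulrC.
Qed.

Lemma I2_cases i : i = ord0 \/ i = ord_max.
Proof. by case: i => [[|[|m]] Hm] //; [left|right]; apply/val_inj. Qed.

Lemma rev_ord0 : rev_ord (ord0 : 'I_2) = ord_max.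
Proof. exact/val_inj. Qed.

Lemma rev_ord_max : rev_ord (ord_max : 'I_2) = ord0.
Proof. exact/val_inj. Qed.

Lemma vec20 (a c : R) : vec2 a c ord0 = a. Proof. by []. Qed.
Lemma vec21 (a c : R) : vec2 a c ord_max = c. Proof. by []. Qed.

Lemma Bop_diffable (e al : R) w i : (forall j, RD1 (w j)) ->
  diffable (Bop e al w i) /\
  forall b x, dd b (Bop e al w i) x =
    dd b (invlap (w i)) x + dd b (invlap (w (rev_ord i))) (shift1 (kappa i * e^-1 * al) x).
Proof.
move=> Hw; set s := kappa i * e^-1 * al.
have D1 := RD1_diffable_invlap (Hw i); have D2 := RD1_diffable_invlap (Hw (rev_ord i)).
have S x := hasD_shift1 (D2 (shift1 s x)).
split=> [x|b x]; first exact: (differentiableD_plane (D1 x) (proj1 (S x))).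
by have [S1 S2] := S x; rewrite -S2; exact: (ddD (D1 x) S1 b).
Qed.

Lemma Bop_diff3 (e al : R) w i : (forall j, RD1 (w j)) -> diff3 (Bop e al w i).
Proof.
move=> Hw; have H1 := GOS_invlap nonneg1 (Hw i).
have H2 := GOS_invlap_shift (fun=> kappa i * e^-1 * al) nonneg1 (Hw (rev_ord i)).
exact: (GOS_diff3 tt (GOSD nonneg1 H1 H2)).
Qed.

Lemma BopD (e al : R) w w' i x : (forall j, RD1 (w j)) -> (forall j, RD1 (w' j)) ->
  Bop e al (fun j y => w j y + w' j y) i x = Bop e al w i x + Bop e al w' i x.
Proof.
move=> Hw Hw'; rewrite /Bop.
rewrite (invlapD x (RD1_tame (Hw i)) (RD1_tame (Hw' i))).
rewrite (invlapD _ (RD1_tame (Hw (rev_ord i))) (RD1_tame (Hw' (rev_ord i)))).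
by rewrite addrACA.
Qed.

Variables (Gam : 'I_2 -> R) (c : @coefficients R) (M : nat) (e : R).
Let al := ala c M e.
Let Om := OmEa c M e.
Let th := dthEa c M e.
Let G := Gtot Gam.
Hypotheses (e0 : e != 0) (al0 : al != 0) (G0 : G != 0).
Hypothesis HOm : forall i, RD1 (Om i).

Let k := e * G / al.

(** The change of centre: a shift by s adds k s to the translation part of the rotation field, and
    here k s = kappa_i Gamma, exactly the difference of the two coefficients [Y2]. Both components
    thus rotate about the same point. *)
Lemma Y2_rev i : Y2 Gam (rev_ord i) + k * (kappa i * e^-1 * al) = Y2 Gam i.
Proof.
have -> : k * (kappa i * e^-1 * al) = kappa i * G by rewrite /k; field; apply/andP.
rewrite /G /Gtot /Y2 /kappa.
by have [->|->] := I2_cases i; rewrite ?rev_ord0 ?rev_ord_max !vec20 !vec21; ring.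
Qed.

Lemma hatXE i : hatX Gam c M e i = fun x => Y2 Gam i * x.1 + k / 2 * nsq x.
Proof.
apply/funext => x; rewrite /hatX enorm_sqr -/G -/al /Y1 /k.
have -> : vec2 1 1 i = 1 :> R by have [->|->] := I2_cases i.
by rewrite mulr1 [x.1 * _]mulrC; congr (_ + _ * _); field.
Qed.

Lemma OS_hatX i : OS (fun _ : unit => 1) (fun _ => hatX Gam c M e i).
Proof.
rewrite hatXE; apply: OSD; first exact: nonneg1.
  by apply: OSM1; [exact: OS1_cst|exact: OS_coord1].
apply: OSM1; first exact: OS1_cst.
by rewrite /nsq; apply: OSD; [exact: nonneg1|apply: OSM1; exact: OS_coord1|apply: OSM1; exact: OS_coord2].
Qed.

Lemma diff3_hatX i : diff3 (hatX Gam c M e i).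
Proof. exact: (OS_diff3 tt (OS_hatX i)). Qed.

Lemma dd_hatX i x : dd false (hatX Gam c M e i) x = Y2 Gam i + k * x.1 /\
  dd true (hatX Gam c M e i) x = k * x.2.
Proof.
have [c1 h1 h2] := hasD_coord1 x; have [dn en] := diffable_nsq (R := R).
rewrite hatXE.
have D1 := differentiableZ_plane (Y2 Gam i) c1; have D2 := differentiableZ_plane (k / 2) (dn x).
rewrite !(ddD D1 D2) !(ddZ _ _ c1) !(ddZ _ _ (dn x)) !en /dd /= h1 h2 mulr1 mulr0 add0r.
by split; [congr (_ + _); field|field].
Qed.

Lemma bracket_hatX i g : bracket (hatX Gam c M e i) g =
  fun x => Y2 Gam i * d2 g x + k * (x.1 * d2 g x - x.2 * d1 g x).
Proof.
apply/funext => x; have [h1 h2] := dd_hatX i x.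
rewrite bracket_at h1 h2 /dd; move: (d1 g x) (d2 g x) => u v; ring.
Qed.

Lemma RD1_bracket_hatX i f : RD1 f -> RD1 (bracket (hatX Gam c M e i) f).
Proof.
move=> Hf; rewrite bracket_hatX.
by apply: RD1D; apply: RD1Z; [exact: (RD1_dd true Hf)|exact: RD1_rot].
Qed.

Lemma invlap_bracket_hatX i f y : RD1 f -> invlap (bracket (hatX Gam c M e i) f) y =
  Y2 Gam i * d2 (invlap f) y + k * (y.1 * d2 (invlap f) y - y.2 * d1 (invlap f) y).
Proof.
move=> Hf; have T2 := RD1_tame (RD1_dd true Hf); have Tr := RD1_tame (RD1_rot Hf).
rewrite bracket_hatX (invlapD y (tameZ (Y2 Gam i) T2) (tameZ k Tr)).
rewrite (invlapZ _ y T2) (invlapZ _ y Tr) (invlap_rotation nonneg1 Hf tt).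
by rewrite -(RD1_dd_invlap true Hf).
Qed.

(** The potential commutes with translations and with rotations; for the shifted component, [Y2_rev]
    turns the field of the other index into that of [i]. *)
Lemma Bop_bracket_hatX w i x : (forall j, RD1 (w j)) ->
  Ba c M e (bracketV (hatX Gam c M e) w) i x =
  bracket (hatX Gam c M e i) (Ba c M e w i) x.
Proof.
move=> Hw; have [_ D] := Bop_diffable e al i Hw.
rewrite bracket_hatX -[d2 _]/(dd true (Bop e al w i)) -[d1 _]/(dd false (Bop e al w i)) !D.
rewrite /Ba -/al /Bop /bracketV !invlap_bracket_hatX // -(Y2_rev i) /=.
set s := kappa i * e^-1 * al.
move: (d2 (invlap (w i)) x) (d1 (invlap (w i)) x).
move: (d2 (invlap (w (rev_ord i))) (shift1 s x)) (d1 (invlap (w (rev_ord i))) (shift1 s x)).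
move=> a1 a2 a3 a4; rewrite /shift1 /=; ring.
Qed.

(** The rotating-frame terms of Psi form a multiple of [hatX] plus a constant, so they drop out of
    the bracket with [hatX] and only the potential part remains. *)
Lemma PsiEaE i : exists m : R, PsiEa Gam c M e i =
  fun x => Ba c M e Om i x + (e * th * al / G * hatX Gam c M e i x + m).
Proof.
exists ((2 * pi)^-1 * ln `|e / al| * vec2 (Gam ord_max) (Gam ord0) i).
apply/funext => x; rewrite hatXE /PsiEa -/Om -/th -/al -/G enorm_sqr /Y1.
have -> : vec2 1 1 i = 1 :> R by have [->|->] := I2_cases i.
rewrite -!addrA; congr (_ + _); rewrite !addrA; congr (_ + _).
by rewrite /k; field; apply/andP.
Qed.

Lemma diff3D f g : diff3 f -> diff3 g -> diff3 (fun x => f x + g x).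
Proof.
move=> [df ddf dddf] [dg ddg dddg].
have E b : dd b (fun x => f x + g x) = fun x => dd b f x + dd b g x.
  by apply/funext => x; rewrite (ddD (df x) (dg x)).
split=> [x|b x|b a x].
- exact: (differentiableD_plane (df x) (dg x)).
- by rewrite E; exact: (differentiableD_plane (ddf b x) (ddg b x)).
- rewrite E; have -> : dd b (fun x => dd a f x + dd a g x) = fun x => dd b (dd a f) x + dd b (dd a g) x.
    by apply/funext => y; rewrite (ddD (ddf a y) (ddg a y)).
  exact: (differentiableD_plane (dddf b a x) (dddg b a x)).
Qed.

Lemma OS_affine_hatX (q m : R) i :
  OS (fun _ : unit => 1) (fun _ x => q * hatX Gam c M e i x + m).
Proof.
apply: OSD; [exact: nonneg1| |exact: OS1_cst].
have := OSM nonneg1 nonneg1 (OS1_cst q) (OS_hatX i); congr OS.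
by apply/funext => p; rewrite mulr1.
Qed.

Lemma diff3_Psi i : diff3 (PsiEa Gam c M e i).
Proof.
have [m ->] := PsiEaE i; apply: diff3D; first exact: Bop_diff3.
exact: (OS_diff3 tt (OS_affine_hatX _ m i)).
Qed.

Lemma bracket_Psi_hatX i : bracket (PsiEa Gam c M e i) (hatX Gam c M e i) =
  fun x => - Ba c M e (bracketV (hatX Gam c M e) Om) i x.
Proof.
have [m E] := PsiEaE i; have [dB _ _] := Bop_diff3 e al i HOm.
have [dX _ _] := diff3_hatX i.
have dZ : diffable (fun y => e * th * al / G * hatX Gam c M e i y).
  by move=> y; exact: (differentiableZ_plane _ (dX y)).
have dA : diffable (fun y => e * th * al / G * hatX Gam c M e i y + m).
  by case: (OS_diff3 tt (OS_affine_hatX (e * th * al / G) m i)).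
have dm : diffable (fun _ : plane R => m) by move=> y; exact: differentiable_cst_plane.
have XX x : bracket (hatX Gam c M e i) (hatX Gam c M e i) x = 0.
  by rewrite bracket_at; move: (dd false _ _) (dd true _ _) => u v; rewrite mulrC subrr.
apply/funext => x; rewrite E (bracketDl _ x dB dA) (bracketDl _ x dZ dm) (bracketZl _ _ x dX).
by rewrite XX bracket_cstl mulr0 !addr0 (Bop_bracket_hatX i x HOm); exact: bracketC.
Qed.

(** Jacobi splits {Psi, {hatX, Omega}}. The term {{Psi, hatX}, Omega} cancels the nonlocal part of
    Lambda^E and leaves {hatX, {Psi, Omega}}. *)
Lemma LambdaE_X i x : LambdaE Gam c M e (Xop Gam c M e Om) i x = Xop Gam c M e (REa Gam c M e) i x.
Proof.
have CO := RD1_diff3 (HOm i); have CX := diff3_hatX i; have CP := diff3_Psi i.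
rewrite /LambdaE /Xop /bracketV /REa /bracketV -/Om (jacobi x CP CX CO).
have HB j : RD1 (bracketV (hatX Gam c M e) Om j) by exact: RD1_bracket_hatX.
have [dB _ _] := Bop_diff3 e al i HB.
rewrite bracket_Psi_hatX.
have -> : (fun x => - Ba c M e (bracketV (hatX Gam c M e) Om) i x) =
   (fun x => -1 * Ba c M e (bracketV (hatX Gam c M e) Om) i x).
  by apply/funext => y; rewrite mulN1r.
by rewrite bracketZl // mulN1r addrAC addNr add0r.
Qed.

Lemma LambdaED w w' i x : (forall j, RD1 (w j)) -> (forall j, RD1 (w' j)) ->
  LambdaE Gam c M e (fun j y => w j y + w' j y) i x =
  LambdaE Gam c M e w i x + LambdaE Gam c M e w' i x.
Proof.
move=> Hw Hw'; rewrite /LambdaE /bracketV.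
have [dw _ _] := RD1_diff3 (Hw i); have [dw' _ _] := RD1_diff3 (Hw' i).
have [dB _ _] := Bop_diff3 e al i Hw; have [dB' _ _] := Bop_diff3 e al i Hw'.
rewrite (bracketDr _ x dw dw').
have -> : Ba c M e (fun j y => w j y + w' j y) i = fun y => Ba c M e w i y + Ba c M e w' i y.
  by apply/funext => y; exact: BopD.
by rewrite (bracketDl _ x dB dB') addrACA.
Qed.

(** The map rho -> {rho, Omega} intertwines [LambdaEstar] with minus [LambdaE], up to the residual:
    by Jacobi, {{Psi, rho}, Omega} joins the nonlocal term to form the bracket of Lambda^{E,star}
    rho with Omega. *)
Lemma LambdaE_bracket rho i x : diff3 (rho i) -> (forall j, RD1 (bracket (rho j) (Om j))) ->
  LambdaE Gam c M e (bracketV rho Om) i x =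
  bracket (rho i) (REa Gam c M e i) x - bracket (LambdaEstar Gam c M e rho i) (Om i) x.
Proof.
move=> Cr HB; have CO := RD1_diff3 (HOm i); have CP := diff3_Psi i.
have [_ ddr _] := Cr; have [_ ddP _] := CP.
have [dB _ _] := @Bop_diff3 e al (bracketV rho Om) i HB.
have -> : LambdaEstar Gam c M e rho i = (fun y => -1 * (bracket (PsiEa Gam c M e i) (rho i) y +
    Ba c M e (bracketV rho Om) i y)).
  by apply/funext => y; rewrite mulN1r opprD.
have dPr := diffable_bracket ddP ddr.
rewrite bracketZl; last by move=> y; exact: (differentiableD_plane (dPr y) (dB y)).
rewrite (bracketDl _ x dPr dB) mulN1r opprK.
rewrite /LambdaE /bracketV -/Om (jacobi x CP Cr CO) /REa /bracketV.
by rewrite [X in X + _]addrC -addrA.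
Qed.

End ExactIdentities.

(** * Germs at 0+ as families over a small interval *)

Section UniformClasses.
Context {R : realType}.
Implicit Types (r : R) (b : bool).

Definition small r : Type := {e : R | 0 < e < r}.

Lemma near0P (P : R -> Prop) :
  (\forall e \near 0^'+, P e) <-> exists2 r, 0 < r & forall e, 0 < e < r -> P e.
Proof.
split=> [|[r r0 H]].
  move=> [r /= r0 H]; exists r => // e /andP[e0 er].
  by apply: H => //; rewrite /ball_ /= sub0r normrN gtr0_norm.
exists r => //= e; rewrite /ball_ /= sub0r normrN => er e0.
by apply: H; rewrite e0 -(gtr0_norm e0).
Qed.

Definition inside {r r'} (h : r' <= r) (p : small r') : small r :=
  let: exist e he := p in
  exist _ e (introT andP (conj (proj1 (andP he)) (lt_le_trans (proj2 (andP he)) h))).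

Lemma sval_inside r r' (h : r' <= r) (p : small r') : sval (inside h p) = sval p.
Proof. by case: p. Qed.

Lemma OS_shrink r r' (d : R -> R) (f : R -> plane R -> R) : r' <= r ->
  OS (fun p : small r => d (sval p)) (fun p => f (sval p)) ->
  OS (fun p : small r' => d (sval p)) (fun p => f (sval p)).
Proof.
move=> h H; have := OS_reindex (inside h) H; congr OS.
  by apply/funext => p /=; rewrite sval_inside.
by apply/funext => p /=; rewrite sval_inside.
Qed.

Lemma bigOS_small (f : R -> plane R -> R) (d : R -> R) : (forall e, 0 < e -> 0 <= d e) ->
  bigOS 0^'+ f d ->
  exists2 r, 0 < r & OS (fun p : small r => d (sval p)) (fun p => f (sval p)).
Proof.
move=> d0 [A /near0P[r r0 rA] [sA bA]]; exists r => //.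
have nd : nonneg (fun p : small r => d (sval p)) by case=> e he /=; have /andP[e0 _] := he; exact: d0.
apply: (OS_dmultiP _ nd).2; split=> [[e he]|s]; first exact: sA (rA _ he).
by have [C [N H]] := bA s; exists C, N => -[e he] x; apply: H; exact: rA.
Qed.

Lemma small_bigOS (f : R -> plane R -> R) (d : R -> R) r : (forall e, 0 < e -> 0 <= d e) ->
  0 < r -> OS (fun p : small r => d (sval p)) (fun p => f (sval p)) -> bigOS 0^'+ f d.
Proof.
move=> d0 r0 H; exists [set e | 0 < e < r].
  by apply/near0P; exists r.
have nd : nonneg (fun p : small r => d (sval p)) by case=> e he /=; have /andP[e0 _] := he; exact: d0.
have [sf bf] := (OS_dmultiP _ nd).1 H; split=> [e he|s]; first by exact: (sf (exist _ e he)).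
by have [C [N K]] := bf s; exists C, N => e he x; exact: (K (exist _ e he)).
Qed.

Lemma inZ_OZ {I : Type} (f : plane R -> R) : inZ f -> OZ (fun _ : I => 1) (fun _ => f).
Proof.
move=> [h [sh bh] /funext ->]; apply: OZ_intro; apply: (OS_dmultiP _ nonneg1).2; split=> // s; have [C [N H]] := bh s; exists C, N => p x; rewrite mulr1; exact: H.
Qed.

Lemma OZ_sum {I : Type} (d : I -> R) (F : nat -> I -> plane R -> R) (n : nat) : nonneg d ->
  (forall k, OZ d (F k)) -> OZ d (fun p x => \sum_(k < n) F k p x).
Proof.
move=> d0 HF; elim: n => [|n IH].
  have := OZZ (e := fun=> 1) d0 nonneg1 (lexx 0) _ (HF 0%N) (k := fun=> 0).
  move=> /(_ ltac:(by move=> p; rewrite normr0 mul0r)).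
  congr OZ; first by apply/funext => p; rewrite mul1r.
  by apply/funext => p; apply/funext => x; rewrite big_ord0 mul0r.
have := OZD d0 IH (HF n); congr OZ.
by apply/funext => p; apply/funext => x; rewrite big_ord_recr.
Qed.

Lemma unit_mul (I : Type) (d : I -> R) : (fun p => 1 * d p) = d.
Proof. by apply/funext => p; rewrite mul1r. Qed.

Lemma OZ_scale {I : Type} (d : I -> R) (q : I -> R) (C : R) F : nonneg d -> 0 <= C ->
  (forall p, `|q p| <= C) -> OZ d F -> OZ d (fun p x => q p * F p x).
Proof.
move=> d0 C0 qC HF.
have qC1 p : `|q p| <= C * 1 by rewrite mulr1.
by have := OZZ d0 nonneg1 C0 qC1 HF; rewrite unit_mul.
Qed.

Lemma OS_scale {I : Type} (d : I -> R) (q : I -> R) (C : R) F : nonneg d -> 0 <= C ->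
  (forall p, `|q p| <= C) -> OS d F -> OS d (fun p x => q p * F p x).
Proof.
move=> d0 C0 qC HF.
have qC1 p : `|q p| <= C * 1 by rewrite mulr1.
by have := OSZ d0 nonneg1 C0 qC1 HF; rewrite unit_mul.
Qed.

Lemma OZ_bracket1 {I : Type} (d : I -> R) a F : nonneg d -> GOS (fun=> 1) a -> OZ d F ->
  OZ d (fun p => bracket (a p) (F p)).
Proof. by move=> d0 Ha HF; have := OZ_bracket nonneg1 d0 Ha HF; rewrite unit_mul. Qed.

Lemma OZ_bracket1r {I : Type} (d : I -> R) a F : nonneg d -> GOS d a -> OZ (fun=> 1) F ->
  OZ d (fun p => bracket (a p) (F p)).
Proof.
move=> d0 Ha HF; have := OZ_bracket d0 nonneg1 Ha HF; congr OZ.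
by apply/funext => p; rewrite mulr1.
Qed.

Lemma shift1_along (s : R) (x : plane R) : shift1 s x = along false s x.
Proof. by case: x => u v; rewrite /shift1 /along /padd /= mulr1 mulr0 addr0. Qed.

Lemma shift1_lipschitz (f : plane R -> R) (C s t : R) (x : plane R) : diffable f ->
  (forall y, `|d1 f y| <= C) -> `|f (shift1 s x) - f (shift1 t x)| <= C * `|s - t|.
Proof.
move=> df fC; wlog ts : s t / t <= s => [H|].
  by have [/H//|/ltW/H] := leP t s; rewrite distrC [`|t - s|]distrC.
have h0 : 0 <= s - t by lra.
have [u _] := along_mvt false (shift1 t x) h0 df.
have -> : along false (s - t) (shift1 t x) = shift1 s x.
  by rewrite shift1_along /along /padd /=; congr pair; ring.
by move=> ->; rewrite normrM; apply: ler_wpM2r => //; exact: fC.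
Qed.

(** One derivative is traded for the factor |s - t|, without loss since all derivatives are bounded.
    This compares the shifts given by two truncations of alpha. *)
Lemma BD_shift_diff {I : Type} (d : I -> R) (s t : I -> R) F : nonneg d -> BD d F ->
  BD (fun p => d p * `|s p - t p|)
     (fun p x => F p (shift1 (s p) x) - F p (shift1 (t p) x)).
Proof.
move=> d0 HF n; elim: n F HF => [|n IH] F HF.
  have [_ dF /(_ false) [C C0 HC]] := HF 1%N.
  exists C => // p x; rewrite mulrA; apply: shift1_lipschitz => //.
  by move=> y; exact: HC.
have dF p : diffable (F p) by have [_ D _] := HF 1%N; exact: D.
have dS p := hasD_shift1 (dF p _).
split.
- by have [_ _ /(_ false) [C C0 HC]] := HF 1%N; exists C => // p x; rewrite mulrA;
    apply: shift1_lipschitz => // y; exact: HC.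
- move=> p x; have [S _] := hasD_shift1 (dF p (shift1 (s p) x)).
  have [T _] := hasD_shift1 (dF p (shift1 (t p) x)).
  by have := differentiableD_plane S (differentiableZ_plane (-1) T); congr (differentiable _ _);
    apply/funext => y; rewrite mulN1r.
- move=> b; have -> : (fun p => dd b (fun x => F p (shift1 (s p) x) - F p (shift1 (t p) x))) =
      (fun p x => dd b (F p) (shift1 (s p) x) - dd b (F p) (shift1 (t p) x)).
    apply/funext => p; apply/funext => x.
    have [S SE] := hasD_shift1 (dF p (shift1 (s p) x)).
    have [T TE] := hasD_shift1 (dF p (shift1 (t p) x)).
    have -> : (fun x => F p (shift1 (s p) x) - F p (shift1 (t p) x)) =
       (fun x => F p (shift1 (s p) x) + (-1) * F p (shift1 (t p) x)).
      by apply/funext => y; rewrite mulN1r.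
    by rewrite (ddD S (differentiableZ_plane (-1) T)) (ddZ b _ T) SE TE mulN1r.
  apply: (IH (fun p => dd b (F p))) => m; have [_ _ H] := HF m.+1; exact: H.
Qed.

End UniformClasses.

(** * Powers of sqrt(nu t): time derivative and time integral *)

Section ResidualInNu.
Context {R : realType}.
Implicit Types (x y : plane R) (i : 'I_2) (a : nat -> R).

Notation mu := (@lebesgue_measure R).

Lemma is_derive_powsum (g : R -> R) (g' : R) a (n : nat) (t : R) : is_derive t 1 g g' ->
  is_derive t 1 (fun s => \sum_(k < n) g s ^+ k * a k)
    (\sum_(k < n) k%:R * g t ^+ k.-1 * g' * a k).
Proof.
move=> dg; elim: n => [|n IH].
  rewrite big_ord0 (_ : (fun s => _) = cst 0); first exact: is_derive_cst.
  by apply/funext => s; rewrite big_ord0.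
have dX : is_derive (g t) 1 (fun y : R => y ^+ n) (n%:R * g t ^+ n.-1).
  apply: DeriveDef; first exact: exprn_derivable.
  by rewrite exp_derive /GRing.scale /= mulr1.
have dc := is_derive1_comp dX dg.
have := is_derive_comb 1 (a n) IH dc; rewrite big_ord_recr /=.
have -> : (fun s => 1 * (\sum_(k < n) g s ^+ k * a k) + a n * ((fun y : R => y ^+ n) \o g) s) =
    (fun s => \sum_(k < n.+1) g s ^+ k * a k).
  by apply/funext => s; rewrite big_ord_recr /= mul1r [a n * _]mulrC.
by rewrite mul1r [a n * _]mulrC.
Qed.

Lemma continuous_powsum (g : R -> R) a (n : nat) : continuous g ->
  continuous (fun s : R => \sum_(k < n) g s ^+ k * a k).
Proof.
move=> cg; elim: n => [|n IH] s.
  rewrite (_ : (fun s => _) = cst 0); first exact: cvg_cst.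
  by apply/funext => u; rewrite big_ord0.
rewrite (_ : (fun s => _) = (fun s => \sum_(k < n) g s ^+ k * a k + g s ^+ n * a n)); last first.
  by apply/funext => u; rewrite big_ord_recr.
apply: cvgD; first exact: IH.
apply: cvgM; last exact: cvg_cst.
exact: (continuous_comp (cg s) (@exprn_continuous R n _)).
Qed.

Section FixedNu.
Variables (nu : R) (nu0 : 0 < nu).

Definition sqnu (s : R) : R := Num.sqrt (nu * s).

Lemma continuous_sqnu : continuous sqnu.
Proof.
move=> s; apply: (continuous_comp (f := fun s => nu * s)); last exact: sqrt_continuous.
by apply: cvgM; [exact: cvg_cst|exact: cvg_id].
Qed.

Lemma is_derive_sqnu (t : R) : 0 < t -> is_derive t 1 sqnu (nu / (2 * sqnu t)).
Proof.
move=> t0; have nt : 0 < nu * t by exact: mulr_gt0.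
have d1 : is_derive t 1 (fun s : R => nu * s) nu.
  have := is_derive_comb nu 0 (is_derive_id t 1) (is_derive_id t 1).
  rewrite mulr1 mul0r addr0; congr is_derive; apply/funext => s.
  by rewrite mul0r addr0.
have := is_derive1_comp (is_derive1_sqrt nt) d1.
by rewrite mulrC.
Qed.

Lemma sqnu_time (e : R) : 0 < e -> sqnu (e ^+ 2 / nu) = e.
Proof.
by move=> e0; rewrite /sqnu mulrCA divff ?gt_eqF // mulr1 sqrtr_sqr gtr0_norm.
Qed.

(** The operator t d/dt multiplies sqrt(nu t)^k by k/2, so at t = e^2/nu it introduces no further
    dependence on nu. *)
Lemma time_derive_powsum a (n : nat) (e : R) : 0 < e ->
  e ^+ 2 / nu * derive1 (fun s => \sum_(k < n) sqnu s ^+ k * a k) (e ^+ 2 / nu) =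
  \sum_(k < n) k%:R / 2 * e ^+ k * a k.
Proof.
move=> e0; have t0 : 0 < e ^+ 2 / nu by rewrite divr_gt0 ?exprn_gt0.
have D := is_derive_powsum a n (is_derive_sqnu t0).
rewrite derive1E (@derive_val _ _ _ _ _ _ _ D) sqnu_time // mulr_sumr.
apply: eq_bigr => -[[|k] hk] _ /=; first by rewrite !mul0r mulr0.
rewrite [e ^+ k.+1]exprS; set E := e ^+ k; set K := k.+1%:R.
by field; rewrite !gt_eqF.
Qed.

(* Coefficients of the antiderivative of [s |-> nu * sum_k sqrt (nu s)^k b_k]
   in powers of [sqrt (nu s)]. *)
Definition antider (b : nat -> R) (j : nat) : R :=
  if j is k.+2 then 2 / j%:R * b k else 0.

(** The prefactor nu is exactly what makes the integral over [0, e^2/nu] a polynomial in e free of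
    nu; hence alpha does not depend on nu at fixed e. *)
Lemma integral_powsum (b : nat -> R) (n : nat) (e : R) : 0 < e ->
  (\int[mu]_(s in `[0, e ^+ 2 / nu]) (nu * \sum_(k < n) sqnu s ^+ k * b k))%R =
  \sum_(j < n.+2) e ^+ j * antider b j.
Proof.
move=> e0; have t0 : 0 < e ^+ 2 / nu by rewrite divr_gt0 ?exprn_gt0.
pose F (s : R) := \sum_(j < n.+2) sqnu s ^+ j * antider b j.
have cF : continuous F by apply: continuous_powsum; exact: continuous_sqnu.
have dF (s : R) : 0 < s -> is_derive s 1 F (nu * \sum_(k < n) sqnu s ^+ k * b k).
  move=> s0; have := is_derive_powsum (antider b) n.+2 (is_derive_sqnu s0).
  congr is_derive; rewrite !big_ord_recl /= !mulr0 !add0r mulr_sumr.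
  have q0 : sqnu s != 0 by rewrite gt_eqF // sqrtr_gt0 mulr_gt0.
  apply: eq_bigr => k _; rewrite /bump /= !add1n /=.
  rewrite [sqnu s ^+ k.+1]exprS; set E := sqnu s ^+ k; have K0 : k.+2%:R != 0 :> R by rewrite pnatr_eq0.
  by set K := k.+2%:R in K0 *; field; apply/andP.
(* The square root is not differentiable at 0, so [F] is used as an antiderivative in the open
   interval, with one-sided continuity at its ends. *)
rewrite /Rintegral (@continuous_FTC2 _ _ F) //=.
- rewrite /F sqnu_time // [X in _ - X](_ : _ = 0) ?subr0 //.
  rewrite big_ord_recl big_ord_recl /= !mulr0 !add0r big1 // => k _.
  by rewrite /sqnu mulr0 sqrtr0 expr0n /= mul0r.
- apply: continuous_subspaceT => s; apply: cvgM; first exact: cvg_cst.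
  by apply: continuous_powsum; exact: continuous_sqnu.
- split.
  + by move=> s; rewrite in_itv /= => /andP[s0 _]; have := dF s s0; case.
  + by apply: cvg_at_right_filter; exact: cF.
  + by apply: cvg_at_left_filter; exact: cF.
- move=> s; rewrite in_itv /= => /andP[s0 _].
  by rewrite derive1E (@derive_val _ _ _ _ _ _ _ (dF s s0)).
Qed.

End FixedNu.

Lemma Lop_lin (f g : plane R -> R) (q : R) x : diff3 f -> diff3 g ->
  Lop (fun y => f y + q * g y) x = Lop f x + q * Lop g x.
Proof.
move=> [df ddf _] [dg ddg _].
have E b : dd b (fun y => f y + q * g y) = fun y => dd b f y + q * dd b g y.
  apply/funext => y; rewrite (ddD (df y) (differentiableZ_plane q (dg y))).
  by rewrite (ddZ b q (dg y)).
have E2 b : dd b (dd b (fun y => f y + q * g y)) x = dd b (dd b f) x + q * dd b (dd b g) x.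
  rewrite E (ddD (ddf b x) (differentiableZ_plane q (ddg b x))).
  by rewrite (ddZ b q (ddg b x)).
rewrite /Lop /lap -![d1 _]/(dd false _) -![d2 _]/(dd true _) !E2 !E.
move: (dd false (dd false f) x) (dd true (dd true f) x) (dd false f x) (dd true f x) (f x).
move: (dd false (dd false g) x) (dd true (dd true g) x) (dd false g x) (dd true g x) (g x).
by move=> *; field.
Qed.

End ResidualInNu.

(** * The residual as a polynomial in nu at fixed epsilon *)

Section ResidualExpansion.
Context {R : realType}.
Implicit Types (x y : plane R) (i : 'I_2).
Variables (Gam : 'I_2 -> R) (c : @coefficients R) (M : nat).
Hypotheses (hE : forall n i, inZ (OmE c n i)) (hN : forall n i, inZ (OmNS c n i)).

Lemma OZ_powsum {I : Type} (q : I -> R) (Z : nat -> plane R -> R) n :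
  (forall k, inZ (Z k)) -> (forall k, exists2 C, 0 <= C & forall p, `|q p ^+ k| <= C) ->
  OZ (fun _ : I => 1) (fun p x => \sum_(k < n) q p ^+ k * Z k x).
Proof.
move=> hZ qC; apply: (OZ_sum (F := fun k p x => q p ^+ k * Z k x)); first exact: nonneg1.
move=> k; have [C C0 H] := qC k.
exact: OZ_scale nonneg1 C0 H (inZ_OZ (hZ k)).
Qed.

Lemma OS_quad {I : Type} (d u v w : I -> R) (C : R) : nonneg d -> 0 <= C ->
  (forall p, `|u p| <= C * d p) -> (forall p, `|v p| <= C * d p) -> (forall p, `|w p| <= C * d p) ->
  OS d (fun p y => u p * enorm y ^+ 2 + (v p * y.1 + w p * y.2)).
Proof.
move=> d0 C0 uC vC wC.
have n2 : OS (fun _ : I => 1 : R) (fun _ y => enorm y ^+ 2).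
  have := OSD nonneg1 (OSM1 (@OS_coord1 R I) (@OS_coord1 R I)) (OSM1 (@OS_coord2 R I) (@OS_coord2 R I)).
  by congr OS; apply/funext => p; apply/funext => y; rewrite enorm_sqr /nsq !expr2.
have m q F : (forall p, `|q p| <= C * d p) -> OS (fun _ : I => 1 : R) F ->
    OS d (fun p y => q p * F p y).
  move=> qC HF; have := OSM d0 nonneg1 (OS_cst C0 qC) HF; congr OS.
  by apply/funext => p; rewrite mulr1.
apply: OSD => //; first exact: m.
by apply: OSD => //; apply: m => //; [exact: OS_coord1|exact: OS_coord2].
Qed.

Definition OmNSa (e : R) : vfun R := fun i x => \sum_(k < M.+1) e ^+ k * OmNS c k i x.
(** The alpha that the residual of order M itself produces. It has one term more than [ala], just as
    [thM] has one term more than [dthEa]. *)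
Definition alM (e : R) : R := 1 + \sum_(j < M.+3) e ^+ j * antider (dalNS c) j.
Definition thM (e : R) : R := \sum_(k < M.+1) e ^+ k * dthE c k.
Definition thN (e : R) : R := \sum_(k < M.+1) e ^+ k * dthNS c k.
Definition daM (e : R) : R := \sum_(k < M.+1) e ^+ k * dalNS c k.

(** [psi0] and [psi1] are the coefficients of nu^0 and nu^1 in the stream function. The derivative
    of alpha carries a factor nu and enters [psi1] only; the term [0 * y.2] gives both the same
    quadratic shape. *)
Definition psi0 (e : R) i y : R := Bop e (alM e) (OmEa c M e) i y +
  (e ^+ 2 / 2 * thM e * enorm y ^+ 2 +
   (e * kappa i * Gam (rev_ord i) / Gtot Gam * (thM e * alM e) * y.1 + 0 * y.2)).
Definition psi1 (e : R) i y : R := Bop e (alM e) (OmNSa e) i y +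
  (e ^+ 2 / 2 * thN e * enorm y ^+ 2 +
   (e * kappa i * Gam (rev_ord i) / Gtot Gam * (thN e * alM e) * y.1 +
    e * kappa i * Gam (rev_ord i) / Gtot Gam * daM e * y.2)).

Lemma RD1_powsum (e : R) (Z : nat -> plane R -> R) n : (forall k, inZ (Z k)) ->
  RD1 (fun x => \sum_(k < n) e ^+ k * Z k x).
Proof.
move=> hZ; apply: OZ_RD; apply: (OZ_powsum (q := fun=> e)) => // k.
by exists `|e ^+ k|.
Qed.

Lemma RD1_OmEa e i : RD1 (OmEa c M e i).
Proof. exact: (RD1_powsum e M.+1 (fun k => hE k i)). Qed.

Lemma RD1_OmNSa e i : RD1 (OmNSa e i).
Proof. exact: (RD1_powsum e M.+1 (fun k => hN k i)). Qed.

Lemma diffable_quad (u v w : R) : diffable (fun y : plane R => u * enorm y ^+ 2 + (v * y.1 + w * y.2)).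
Proof.
have C0 : 0 <= `|u| + `|v| + `|w| by rewrite !addr_ge0.
have H := @OS_quad unit (fun=> 1) (fun=> u) (fun=> v) (fun=> w) (`|u| + `|v| + `|w|) nonneg1 C0.
have {}H := H ltac:(by move=> _; rewrite mulr1 -addrA lerDl addr_ge0)
  ltac:(by move=> _; rewrite mulr1 addrAC lerDr addr_ge0) ltac:(by move=> _; rewrite mulr1 lerDr addr_ge0).
exact: (OS_diffable tt H).
Qed.

Lemma diffable_psi0 e i : diffable (psi0 e i).
Proof.
have [dB _ _] := Bop_diff3 e (alM e) i (RD1_OmEa e).
by move=> x; exact: (differentiableD_plane (dB x) (diffable_quad _ _ _ x)).
Qed.

Lemma diffable_psi1 e i : diffable (psi1 e i).
Proof.
have [dB _ _] := Bop_diff3 e (alM e) i (RD1_OmNSa e).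
by move=> x; exact: (differentiableD_plane (dB x) (diffable_quad _ _ _ x)).
Qed.

Lemma Om_sumE (nu e : R) : 0 < nu -> 0 < e ->
  Om_sum c nu M (e ^+ 2 / nu) = fun j y => OmEa c M e j y + nu * OmNSa e j y.
Proof.
move=> nu0 e0; apply/funext => j; apply/funext => y.
rewrite /Om_sum -/(sqnu nu _) sqnu_time // mulr_sumr -big_split /=.
by apply: eq_bigr => k _; rewrite mulrDr; congr (_ + _); rewrite mulrCA.
Qed.

Lemma dth_sumE (nu e : R) : 0 < nu -> 0 < e ->
  dth_sum c nu M (e ^+ 2 / nu) = thM e + nu * thN e.
Proof.
move=> nu0 e0; rewrite /dth_sum -/(sqnu nu _) sqnu_time // mulr_sumr -big_split /=.
by apply: eq_bigr => k _; rewrite mulrDr; congr (_ + _); rewrite mulrCA.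
Qed.

(** At t = e^2/nu the vorticity and the stream function are affine in nu, so their bracket is
    quadratic; the linear terms are affine and are multiplied by nu. Nothing is claimed on the size
    of [q1] and [q2], which are to be eliminated. *)
Lemma resid_quadratic e i x : 0 < e -> exists q1 q2 : R, forall nu, 0 < nu ->
  nu * resid Gam nu (Om_sum c nu M) (dal_sum c nu M) (dth_sum c nu M) i (e ^+ 2 / nu) x =
  bracket (psi0 e i) (OmEa c M e i) x + nu * q1 + nu ^+ 2 * q2.
Proof.
move=> e0.
pose tE := \sum_(k < M.+1) k%:R / 2 * e ^+ k * OmE c k i x.
pose tN := \sum_(k < M.+1) k%:R / 2 * e ^+ k * OmNS c k i x.
have CE := RD1_diff3 (RD1_OmEa e i); have CN := RD1_diff3 (RD1_OmNSa e i).
have [dE _ _] := CE; have [dN _ _] := CN.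
exists (tE - Lop (OmEa c M e i) x + bracket (psi0 e i) (OmNSa e i) x +
  bracket (psi1 e i) (OmEa c M e i) x),
  (tN - Lop (OmNSa e i) x + bracket (psi1 e i) (OmNSa e i) x).
move=> nu nu0; have st := sqnu_time nu0 e0.
have al : 1 + (\int[lebesgue_measure]_(s in `[0%R, (e ^+ 2 / nu)%R]) dal_sum c nu M s)%R = alM e.
  by rewrite /alM -(integral_powsum nu0 (dalNS c) M.+1 e0).
have tdt : e ^+ 2 / nu * derive1 (fun s : R => Om_sum c nu M s i x) (e ^+ 2 / nu) = tE + nu * tN.
  have := time_derive_powsum nu0 (fun k => OmE c k i x + nu * OmNS c k i x) M.+1 e0.
  rewrite /tE /tN mulr_sumr -big_split /= => ->; apply: eq_bigr => k _.
  by rewrite mulrDr; congr (_ + _); rewrite mulrCA.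
have Lg : Lop (Om_sum c nu M (e ^+ 2 / nu) i) x = Lop (OmEa c M e i) x + nu * Lop (OmNSa e i) x.
  by rewrite Om_sumE // Lop_lin.
have dal : dal_sum c nu M (e ^+ 2 / nu) = nu * daM e by rewrite /dal_sum -/(sqnu nu _) st.
have psi : (fun y =>
      invlap (Om_sum c nu M (e ^+ 2 / nu) i) y
      + invlap (Om_sum c nu M (e ^+ 2 / nu) (rev_ord i)) (shift1 (kappa i * e^-1 * alM e) y)
      + e ^+ 2 / 2 * dth_sum c nu M (e ^+ 2 / nu) * enorm y ^+ 2
      + e * kappa i * Gam (rev_ord i) / Gtot Gam
        * (dth_sum c nu M (e ^+ 2 / nu) * alM e * y.1 + dal_sum c nu M (e ^+ 2 / nu) * y.2)) =
    (fun y => psi0 e i y + nu * psi1 e i y).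
  apply/funext => y; rewrite dal dth_sumE // Om_sumE //.
  have T j := RD1_tame (RD1_OmEa e j); have T' j := RD1_tame (RD1_OmNSa e j).
  rewrite (invlapD y (T i) (tameZ nu (T' i))) (invlapZ nu y (T' i)).
  rewrite (invlapD _ (T (rev_ord i)) (tameZ nu (T' (rev_ord i)))) (invlapZ nu _ (T' (rev_ord i))).
  rewrite /psi0 /psi1 /Bop.
  move: (invlap _ _) (invlap _ _) (invlap _ _) (invlap _ _) (_ / Gtot Gam) => a1 a2 a3 a4 a5.
  move: (thM e) (thN e) (alM e) (daM e) (enorm y ^+ 2) => b1 b2 b3 b4 b5.
  ring.
rewrite /resid -/(sqnu nu _) st al tdt Lg psi Om_sumE //.
have P0 := diffable_psi0 e i; have P1 := diffable_psi1 e i.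
have nP1 : diffable (fun y => nu * psi1 e i y) by move=> y; exact: (differentiableZ_plane nu (P1 y)).
have nN : diffable (fun y => nu * OmNSa e i y) by move=> y; exact: (differentiableZ_plane nu (dN y)).
rewrite (bracketDl _ x P0 nP1) (bracketZl nu _ x P1) !(bracketDr _ x dE nN) !(bracketZr nu _ x dN).
move: (bracket _ _ _) (bracket _ _ _) (bracket _ _ _) (bracket _ _ _) => a1 a2 a3 a4.
move: (Lop _ _) (Lop _ _) => l1 l2.
by field; rewrite gt_eqF.
Qed.

End ResidualExpansion.

(** * Uniform bounds on the Eulerian coefficients and the stream function *)

Section EulerResidual.
Context {R : realType}.
Implicit Types (x y : plane R) (i : 'I_2) (e r : R).
Variables (Gam : 'I_2 -> R) (c : @coefficients R) (M : nat).

Lemma OZ_inZ (f : plane R -> R) : OZ (fun _ : unit => 1) (fun _ => f) -> inZ f.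
Proof.
move=> H; exists (fun x => (Gauss x)^-1 * f x); last first.
  by move=> x; rewrite mulVKf // gt_eqF // Gauss_gt0.
have [sf bf] := (OS_dmultiP _ nonneg1).1 H; split; first exact: (sf tt).
by move=> s; have [C [N K]] := bf s; exists C, N => x; have := K tt x; rewrite mulr1.
Qed.

Lemma inZ_cstGauss (k : R) : inZ (fun x => k * Gauss x).
Proof.
apply: OZ_inZ; have := OZ_intro (OS1_cst k); congr OZ.
by apply/funext => p; apply/funext => x; rewrite mulrC.
Qed.

Lemma inZ0 (f : plane R -> R) : (forall x, f x = 0) -> inZ f.
Proof.
by move=> f0; rewrite (_ : f = fun x => 0 * Gauss x); [exact: inZ_cstGauss|apply/funext => x; rewrite f0 mul0r].
Qed.

(** Index 0 is a multiple of G and index 1 vanishes; from index 2 on, membership is part of each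
    step of the recursion. *)
Lemma approx_inZ : approx_solution Gam c ->
  forall n i, inZ (OmE c n i) /\ inZ (OmNS c n i).
Proof.
case=> E0 N0 E1 N1 _ _ _ step [|[|n]] i.
- split; last exact: inZ0.
  by rewrite (_ : OmE c 0 i = fun x => Gam i * Gauss x); [exact: inZ_cstGauss|apply/funext].
- by split; exact: inZ0.
have [H0 [H1 [_ /(_ i) [A [B [P0 [_ [[ZA _ _] [[ZB _ _] [EAB [ZN _ _]]]]]]]]]]] := step n.+1 isT.
split=> //; have := OZD nonneg1 (@inZ_OZ R unit _ ZA) (inZ_OZ ZB).
by move=> /OZ_inZ; congr inZ; apply/funext => x; rewrite EAB.
Qed.

Hypothesis hc : approx_solution Gam c.
Hypothesis G0 : Gtot Gam != 0.

Let hE n i : inZ (OmE c n i) := proj1 (approx_inZ hc n i).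
Let hN n i : inZ (OmNS c n i) := proj2 (approx_inZ hc n i).

Lemma small_bounds r (p : small r) : r <= 1 -> 0 < sval p <= 1.
Proof. by case: p => e /= /andP[-> er] r1 /=; rewrite ltW // (lt_le_trans er). Qed.

Lemma powsum_bound (a : nat -> R) n e : 0 < e <= 1 ->
  `|\sum_(k < n) e ^+ k * a k| <= \sum_(k < n) `|a k|.
Proof.
move=> /andP[e0 e1]; apply: (le_trans (ler_norm_sum _ _ _)); apply: ler_sum => k _.
rewrite normrM ger0_norm ?exprn_ge0 ?(ltW e0) // ler_piMl //.
by rewrite exprn_ile1 // ltW.
Qed.

Lemma powsum_ge0 (a : nat -> R) n : 0 <= \sum_(k < n) `|a k|.
Proof. by apply: sumr_ge0. Qed.

Lemma OZ_OmEa r i : r <= 1 -> OZ (fun _ : small r => 1) (fun p => OmEa c M (sval p) i).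
Proof.
move=> r1; apply: (OZ_powsum (q := fun p : small r => sval p) M.+1 (fun k => hE k i)) => k.
exists 1 => // p; have /andP[p0 p1] := small_bounds p r1.
by rewrite ger0_norm ?exprn_ge0 ?(ltW p0) // exprn_ile1 // ltW.
Qed.

Lemma GOS_Bop {I : Type} (d : I -> R) (e al : I -> R) (w : I -> vfun R) i : nonneg d ->
  (forall j, OZ d (fun p => w p j)) -> GOS d (fun p => Bop (e p) (al p) (w p) i).
Proof.
move=> d0 Hw; apply: (GOSD d0 (GOS_invlap d0 (OZ_RD (Hw i)))).
exact: (GOS_invlap_shift (fun p => kappa i * (e p)^-1 * al p) d0 (OZ_RD (Hw (rev_ord i)))).
Qed.

Lemma alaE e : ala c M e = 1 + \sum_(j < M.+2) e ^+ j * antider (dalNS c) j.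
Proof.
rewrite /ala; congr (1 + _).
rewrite -(big_mkord xpredT (fun j => e ^+ j * antider (dalNS c) j)).
rewrite big_ltn // big_ltn //= !mulr0 !add0r !big_nat.
apply: eq_bigr => -[|[|k]] //= _; rewrite subn2 /=.
by rewrite mulrCA !mulrA; congr (_ * _); rewrite mulrAC.
Qed.

Lemma alM_ala e : alM c M e = ala c M e + e ^+ M.+2 * antider (dalNS c) M.+2.
Proof. by rewrite alaE /alM big_ord_recr /= addrA. Qed.

Lemma ala_near1 : exists2 r, 0 < r <= 1 & forall e, 0 < e < r -> 2^-1 <= ala c M e <= 2.
Proof.
pose K := \sum_(k < M.+1) `|antider (dalNS c) k.+1|.
have K0 : 0 <= K by exact: (powsum_ge0 (fun k => antider (dalNS c) k.+1)).
have K1 : 0 < 2 * (K + 1) by lra.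
pose r := (2 * (K + 1))^-1.
have r0 : 0 < r by rewrite invr_gt0.
have r1 : r <= 1 by rewrite invf_le1 //; lra.
have rK : K * r <= 2^-1.
  rewrite /r ler_pdivrMr //; lra.
exists r; first by rewrite r0.
move=> e /andP[e0 er]; have e1 : 0 < e <= 1 by rewrite e0 ltW // (lt_le_trans er).
(* [antider] vanishes at index 0, so a factor e splits off and a small radius controls the deviation
   from 1. *)
have E : ala c M e = 1 + e * \sum_(k < M.+1) e ^+ k * antider (dalNS c) k.+1.
  rewrite alaE big_ord_recl /= mulr0 add0r mulr_sumr; congr (1 + _).
  by apply: eq_bigr => k _; rewrite /bump /= add1n exprS mulrA.
have := powsum_bound (fun k => antider (dalNS c) k.+1) M.+1 e1.
rewrite -/K E; set S := \sum_(_ < _) _ => SK.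
have eS : `|e * S| <= 2^-1.
  rewrite normrM (gtr0_norm e0); apply: le_trans rK; rewrite mulrC.
  by apply: ler_pM => //; exact: ltW.
by move: eS; rewrite ler_norml => /andP[h1 h2]; apply/andP; split; lra.
Qed.

Definition thK : R := \sum_(k < M) `|dthE c k|.

Lemma dthEa_bound e : 0 < e <= 1 -> `|dthEa c M e| <= thK.
Proof. exact: powsum_bound. Qed.

(** The logarithmic term is set apart as [m]: it is not bounded as e tends to 0, but it has no
    gradient. *)
Lemma PsiEa_quad e i : exists m : R, PsiEa Gam c M e i = fun x =>
  Bop e (ala c M e) (OmEa c M e) i x + (e ^+ 2 / 2 * dthEa c M e * enorm x ^+ 2 +
    (e / Gtot Gam * dthEa c M e * ala c M e * Y2 Gam i * x.1 + 0 * x.2)) + m.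
Proof.
exists ((2 * pi)^-1 * ln `|e / ala c M e| * vec2 (Gam ord_max) (Gam ord0) i).
apply/funext => x; rewrite /PsiEa /Ba /Y1.
have -> : vec2 1 1 i = 1 :> R by have [->|->] := I2_cases i.
move: (Bop _ _ _ _ _) (ln `|e / ala c M e|) (enorm x ^+ 2) => a1 a2 a3.
move: (dthEa c M e) (ala c M e) (Y2 Gam i) (Gtot Gam)^-1 => a4 a5 b2 b3.
by rewrite mulr1 mul0r addr0 !addrA; congr (_ + _ + _ + _); ring.
Qed.

Lemma GOS_PsiEa r i : r <= 1 -> (forall e, 0 < e < r -> 2^-1 <= ala c M e <= 2) ->
  GOS (fun _ : small r => 1) (fun p => PsiEa Gam c M (sval p) i).
Proof.
move=> r1 al.
pose m p := sval (cid (PsiEa_quad p i)).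
have mE p : PsiEa Gam c M p i = _ := svalP (cid (PsiEa_quad p i)).
have -> : (fun p : small r => PsiEa Gam c M (sval p) i) = (fun p : small r => fun x =>
  Bop (sval p) (ala c M (sval p)) (OmEa c M (sval p)) i x +
  ((sval p) ^+ 2 / 2 * dthEa c M (sval p) * enorm x ^+ 2 +
    ((sval p) / Gtot Gam * dthEa c M (sval p) * ala c M (sval p) * Y2 Gam i * x.1 + 0 * x.2)) + m (sval p)).
  by apply/funext => p; exact: mE.
have n1 := @nonneg1 R (small r).
have HB : forall j, OZ (fun _ : small r => 1) (fun p => OmEa c M (sval p) j).
  by move=> j; exact: OZ_OmEa.
have H1 := GOS_Bop (fun p : small r => sval p) (fun p : small r => ala c M (sval p)) i n1 HB.
apply: (GOSD n1 _ (GOS_cst (fun p : small r => m (sval p)) n1)).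
apply: (GOSD n1 H1); apply: OS_GOS.
have T0 : 0 <= thK by exact: powsum_ge0.
have B0 : 0 <= `|(Gtot Gam)^-1| * thK * 2 * `|Y2 Gam i| by rewrite !mulr_ge0.
apply: (@OS_quad R _ _ _ _ _ (thK + `|(Gtot Gam)^-1| * thK * 2 * `|Y2 Gam i|)) => //.
- exact: addr_ge0.
- move=> p; have /andP[p0 p1] := small_bounds p r1; have T := dthEa_bound (small_bounds p r1).
  rewrite mulr1; apply: (@le_trans _ _ thK); last by rewrite lerDl.
  rewrite normrM -[leRHS]mul1r; apply: ler_pM => //.
  rewrite ger0_norm ?divr_ge0 ?sqr_ge0 // ler_pdivrMr // mul1r.
  by have := exprn_ile1 2 (ltW p0) p1; lra.
- move=> p; have /andP[p0 p1] := small_bounds p r1; have T := dthEa_bound (small_bounds p r1).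
  have /andP[a1 a2] := al _ (svalP p).
  rewrite mulr1; apply: (@le_trans _ _ (`|(Gtot Gam)^-1| * thK * 2 * `|Y2 Gam i|)); last by rewrite lerDr.
  rewrite !normrM; apply: ler_wpM2r => //; apply: ler_pM => //; last by rewrite ger0_norm; lra.
  apply: ler_pM => //; rewrite -[leRHS]mul1r; apply: ler_pM => //.
  by rewrite gtr0_norm.
- by move=> p; rewrite normr0 mulr1 addr_ge0.
Qed.

Lemma GOS_hatX r i : r <= 1 -> (forall e, 0 < e < r -> 2^-1 <= ala c M e <= 2) ->
  OS (fun _ : small r => 1) (fun p => hatX Gam c M (sval p) i).
Proof.
move=> r1 al.
have -> : (fun p : small r => hatX Gam c M (sval p) i) = (fun p : small r => fun x =>
  (sval p * Gtot Gam / (2 * ala c M (sval p))) * enorm x ^+ 2 + (Y2 Gam i * x.1 + 0 * x.2)).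
  apply/funext => p; apply/funext => x; rewrite /hatX /Y1.
  have -> : vec2 1 1 i = 1 :> R by have [->|->] := I2_cases i.
  by rewrite mulr1 mul0r addr0 addrC [Y2 Gam i * _]mulrC.
have n1 := @nonneg1 R (small r).
apply: (@OS_quad R _ _ _ _ _ (`|Gtot Gam| + `|Y2 Gam i|)) => //.
- move=> p; have /andP[p0 p1] := small_bounds p r1; have /andP[a1 a2] := al _ (svalP p).
  rewrite mulr1; apply: (@le_trans _ _ `|Gtot Gam|); last by rewrite lerDl.
  have a0 : 0 < 2 * ala c M (sval p) by lra.
  rewrite normrM normfV (gtr0_norm a0) ler_pdivrMr // normrM (gtr0_norm p0) mulrC.
  by apply: ler_wpM2l => //; lra.
- by move=> p; rewrite mulr1 lerDr.
- by move=> p; rewrite normr0 mulr1 addr_ge0.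
Qed.

End EulerResidual.

(** * The Eulerian residual is of order epsilon^(M+1) *)

Section EulerResidualBound.
Context {R : realType}.
Implicit Types (x y : plane R) (i : 'I_2) (e r : R).
Variables (Gam : 'I_2 -> R) (c : @coefficients R) (M : nat).
Hypotheses (hc : approx_solution Gam c) (hM : (1 <= M)%N).

Let hE n i : inZ (OmE c n i) := proj1 (approx_inZ hc n i).
Let hN n i : inZ (OmNS c n i) := proj2 (approx_inZ hc n i).

Lemma nonneg_powsval r n : nonneg (fun p : small r => sval p ^+ n).
Proof. by case=> e he /=; have /andP[e0 _] := he; rewrite exprn_ge0 // ltW. Qed.

Lemma OZ_pow r n (f : plane R -> R) : inZ f ->
  OZ (fun p : small r => sval p ^+ n) (fun p x => sval p ^+ n * f x).
Proof.
move=> zf; have d0 := @nonneg_powsval r n.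
have b (p : small r) : `|sval p ^+ n| <= 1 * sval p ^+ n by rewrite mul1r ger0_norm //; exact: d0.
have := OZZ nonneg1 d0 ler01 b (inZ_OZ zf); congr OZ.
by apply/funext => p; rewrite mulr1.
Qed.

(* [nu * resid] is a quadratic polynomial in [nu] whose constant coefficient is
   the Eulerian residual; it is recovered from the values at [nu = e^M],
   [2 e^M] and [3 e^M], where the expansion of [resid] gives O(e^(M+1)). *)
Lemma psi0_bracket_O i : exists2 r, 0 < r <= 1 &
  OZ (fun p : small r => sval p ^+ M.+1)
     (fun p => bracket (psi0 Gam c M (sval p) i) (OmEa c M (sval p) i)).
Proof.
have [H0 [H1 [/(_ i) Hres _]]] := approx_step hc hM.
have [zH0 zH1 _ _ [A [[Q1 Q2] [/= /near0P[r1 r10 HQ1] /near0P[r2 r20 HQ2]] sub] [sA bA]]] := Hres.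
(* The division by 3 leaves room for the largest node: 3 e^M <= 3 e < r1, where the first inequality
   uses 1 <= M. *)
pose r := Num.min (r1 / 3) (Num.min r2 1).
have r0 : 0 < r by rewrite !lt_min r20 ltr01 andbT divr_gt0.
have [rr1 [rr2 rr3]] : r <= r1 / 3 /\ r <= r2 /\ r <= 1.
  by rewrite /r !ge_min !lexx !orbT.
exists r; first by rewrite r0.
have d0 := @nonneg_powsval r M.+1.
pose P (j : R) (p : small r) x := (j * sval p ^+ M) *
  resid Gam (j * sval p ^+ M) (Om_sum c (j * sval p ^+ M) M) (dal_sum c (j * sval p ^+ M) M)
    (dth_sum c (j * sval p ^+ M) M) i (sval p ^+ 2 / (j * sval p ^+ M)) x.
have OP (j : R) : 0 < j <= 3 -> OZ (fun p : small r => sval p ^+ M.+1) (P j).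
  move=> /andP[j0 j3].
  pose nu (p : small r) := j * sval p ^+ M.
  have inA p : A (nu p, sval p).
    apply: sub; have /andP[p0 p1] := small_bounds p rr3; have /andP[_ pr] := svalP p.
    have pM : sval p ^+ M <= sval p.
      by case: (M) hM => // m _; rewrite exprS ler_piMr ?(ltW p0) // exprn_ile1 // ltW.
    have pM0 : 0 < sval p ^+ M by rewrite exprn_gt0.
    split=> /=; [apply: HQ1|apply: HQ2]; rewrite ?p0 /=; last exact: lt_le_trans pr rr2.
    rewrite /nu mulr_gt0 //=; apply: (@le_lt_trans _ _ (3 * sval p)); last by lra.
    by apply: ler_pM => //; exact: ltW.
  pose f (p : small r) x := resid Gam (nu p) (Om_sum c (nu p) M) (dal_sum c (nu p) M)
    (dth_sum c (nu p) M) i (sval p ^+ 2 / nu p) x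
    - ((nu p)^-1 * sval p ^+ M.+1 * H0 i x + sval p ^+ M.+1 * H1 i x).
  pose de (p : small r) := (nu p)^-1 * sval p ^+ M.+2 + nu p * sval p ^+ 2.
  have nu0 p : 0 < nu p.
    by have /andP[p0 p1] := small_bounds p rr3; rewrite /nu mulr_gt0 // exprn_gt0.
  have de0 : nonneg de.
    move=> p; have /andP[p0 p1] := small_bounds p rr3.
    by apply: addr_ge0; apply: mulr_ge0; rewrite ?invr_ge0 ?exprn_ge0 ?(ltW p0) ?(ltW (nu0 p)).
  have Of : OZ de f.
    apply: (OS_dmultiP _ de0).2; split=> [p|s]; first exact: (sA _ (inA p)).
    by have [C [N K]] := bA s; exists C, N => p x; exact: (K _ (inA p)).
  (* For nu = j e^M, the error nu^-1 e^(M+2) + nu e^2 times nu equals e^(M+2) + j^2 e^(2M+2). The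
     class calculus bounds it by e^M times the error, at most (1/j + j) e^(M+1). *)
  have O1 : OZ (fun p : small r => sval p ^+ M.+1) (fun p x => nu p * f p x).
    have nuM (p : small r) : `|nu p| <= 3 * sval p ^+ M.
      by rewrite gtr0_norm // /nu; apply: ler_wpM2r => //; exact: (@nonneg_powsval r M p).
    have := OZZ de0 (@nonneg_powsval r M) (ler0n _ 3) nuM Of.
    apply: (@OZ_le _ _ _ _ _ (j^-1 + j)); first by apply: addr_ge0; rewrite ?invr_ge0; exact: ltW.
    move=> p; have /andP[p0 p1] := small_bounds p rr3.
    have pM : 0 < sval p ^+ M by rewrite exprn_gt0.
    rewrite /de /nu [sval p ^+ M.+2]exprSr [sval p ^+ M.+1]exprSr.
    set q := sval p ^+ M in pM *; set t := sval p in p0 p1 *.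
    have q1 : q <= 1 by rewrite /q exprn_ile1 // ltW.
    have -> : q * ((j * q)^-1 * (q * t * t) + j * q * t ^+ 2) = j^-1 * (q * t) * t + j * (q * t) * (q * t).
      by field; rewrite !gt_eqF.
    have qt : 0 <= q * t by rewrite mulr_ge0 ?ltW.
    have qt1 : q * t <= 1 by rewrite mulr_ile1 // ltW.
    have ji : 0 <= j^-1 by rewrite invr_ge0 ltW.
    rewrite mulrDl; apply: lerD; first by rewrite ler_piMr // mulr_ge0.
    by rewrite ler_piMr // mulr_ge0 // ltW.
  have O2 := OZ_pow r M.+1 zH0.
  have O3 : OZ (fun p : small r => sval p ^+ M.+1) (fun p x => nu p * (sval p ^+ M.+1 * H1 i x)).
    apply: (OZ_scale d0 (ler0n _ 3) _ (OZ_pow r M.+1 zH1)) => p.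
    have /andP[p0 p1] := small_bounds p rr3.
    rewrite gtr0_norm // /nu -[leRHS]mulr1; apply: ler_pM => //; first exact: ltW.
      exact: (@nonneg_powsval r M p).
    by rewrite exprn_ile1 // ltW.
  have := OZD d0 (OZD d0 O1 O2) O3; congr OZ.
  apply/funext => p; apply/funext => x; rewrite /P /f -/(nu p).
  have n0 : nu p != 0 by rewrite gt_eqF.
  move: (resid _ _ _ _ _ _ _ _) (H0 i x) (H1 i x) => a1 a2 a3.
  move: (nu p) (sval p ^+ M.+1) n0 => a4 a5 n0.
  by field.
have s3 (j q : R) : `|q| <= 3 -> 0 < j <= 3 ->
    OZ (fun p : small r => sval p ^+ M.+1) (fun p x => q * P j p x).
  by move=> q3 j3; exact: (OZ_scale (q := fun=> q) d0 (ler0n _ 3) (fun=> q3) (OP j j3)).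
have b1 : `|3 : R| <= 3 by rewrite ger0_norm.
have b2 : `|- 3 : R| <= 3 by rewrite normrN ger0_norm.
have b3 : `|1 : R| <= 3 by rewrite normr1 ler1n.
(* The weights 3, -3, 1 at the nodes 1, 2, 3 are those of Lagrange extrapolation to 0: they sum to 1
   and annihilate the linear and the quadratic term. *)
have S1 := s3 1 3 b1 ltac:(by rewrite ltr01 ler1n).
have S2 := s3 2 (- 3) b2 ltac:(by rewrite ltr0n ler_nat).
have S3 := s3 3 1 b3 ltac:(by rewrite ltr0n lexx).
have := OZD d0 (OZD d0 S1 S2) S3; congr OZ.
apply/funext => p; apply/funext => x.
have /andP[p0 p1] := small_bounds p rr3.
have [q1 [q2 HQ]] := resid_quadratic Gam M hE hN i x p0.
have pM : 0 < sval p ^+ M by rewrite exprn_gt0.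
rewrite /P (HQ (1 * sval p ^+ M)) ?mul1r // (HQ (2 * sval p ^+ M)) ?mulr_gt0 //.
rewrite (HQ (3 * sval p ^+ M)) ?mulr_gt0 //.
move: (bracket _ _ _) (sval p ^+ M) => a1 a2; ring.
Qed.

Lemma GOS_shift_diff {I : Type} (d s t : I -> R) (C : R) F : RD (fun _ : I => 1) F ->
  0 <= C -> (forall p, `|s p - t p| <= C * d p) ->
  GOS d (fun p x => invlap (F p) (shift1 (s p) x) - invlap (F p) (shift1 (t p) x)).
Proof.
move=> HF C0 st; have dF := diffable_invlap nonneg1 HF.
have S p x := hasD_shift1 (dF p (shift1 (s p) x)).
have T p x := hasD_shift1 (dF p (shift1 (t p) x)).
have E p : (fun x => invlap (F p) (shift1 (s p) x) - invlap (F p) (shift1 (t p) x)) =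
  (fun x => invlap (F p) (shift1 (s p) x) + (-1) * invlap (F p) (shift1 (t p) x)).
  by apply/funext => x; rewrite mulN1r.
split=> [p x|b].
  rewrite E; exact: (differentiableD_plane (proj1 (S p x)) (differentiableZ_plane (-1) (proj1 (T p x)))).
have -> : (fun p => dd b (fun x => invlap (F p) (shift1 (s p) x) - invlap (F p) (shift1 (t p) x))) =
  (fun p x => dd b (invlap (F p)) (shift1 (s p) x) - dd b (invlap (F p)) (shift1 (t p) x)).
  apply/funext => p; apply/funext => x; rewrite E.
  have [S1 S2] := S p x; have [T1 T2] := T p x.
  have e1 := ddD S1 (differentiableZ_plane (-1) T1) b.
  have e2 := ddZ b (-1) T1.
  by apply: (etrans e1); rewrite e2 mulN1r; congr (_ - _); [exact: (S2 b)|exact: (T2 b)].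
have := BD_OS (BD_shift_diff s t nonneg1 (BD_dd_invlap b nonneg1 HF)).
by apply: (OS_le C0) => p; rewrite mul1r.
Qed.

Lemma Y2_kappa i : Y2 Gam i = kappa i * Gam (rev_ord i).
Proof.
by rewrite /Y2 /kappa; have [->|->] := I2_cases i; rewrite ?rev_ord0 ?rev_ord_max ?vec20 ?vec21 ?mul1r ?mulN1r.
Qed.

(** The quantity is th * al - (th + q b)(al + q2 a), the error in the product theta alpha when both
    factors are truncated; q and q2 stand for e^M and e^(M+2). *)
Lemma truncation_coef_bound (th K al a b q q2 : R) : `|th| <= K -> 0 <= al -> al <= 2 ->
  0 <= q2 -> q2 <= q -> q2 <= 1 ->
  `|- (th * (q2 * a)) - q * b * (al + q2 * a)| <= (K * `|a| + `|b| * (2 + `|a|)) * q.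
Proof.
move=> thK al0 al2 q20 q2q q21; have q0 : 0 <= q by exact: le_trans q2q.
apply: (le_trans (ler_normB _ _)); rewrite mulrDl; apply: lerD.
  rewrite normrN normrM normrM (ger0_norm q20) -mulrA [`|a| * q]mulrC.
  by apply: ler_pM => //; [exact: mulr_ge0|exact: ler_wpM2r].
have aB : `|al + q2 * a| <= 2 + `|a|.
  apply: (le_trans (ler_normD _ _)); apply: lerD; first by rewrite ger0_norm.
  by rewrite normrM (ger0_norm q20) ler_piMl.
rewrite normrM normrM (ger0_norm q0) -[q * _ * _]mulrA [q * _]mulrC.
by apply: ler_wpM2r => //; exact: ler_wpM2l.
Qed.

(** Psi and [psi0] differ by truncation and a constant only. The missing term of theta carries e^M
    and a prefactor e or e^2; the missing term e^(M+2) of alpha moves the shift by a multiple of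
    e^(M+1), because the shift divides alpha by e. *)
Lemma REa_O i : exists2 r, 0 < r <= 1 &
  OZ (fun p : small r => sval p ^+ M.+1) (fun p => REa Gam c M (sval p) i).
Proof.
have [r1 /andP[r10 r11] O1] := psi0_bracket_O i; have [r2 /andP[r20 _] al] := ala_near1 c M.
pose r := Num.min r1 r2.
have r0 : 0 < r by rewrite lt_min r10.
have [rr1 rr2] : r <= r1 /\ r <= r2 by rewrite /r !ge_min !lexx orbT.
have r1' : r <= 1 := le_trans rr1 r11.
have {}al (p : small r) : 2^-1 <= ala c M (sval p) <= 2.
  by apply: al; have /andP[-> pr] := svalP p; exact: lt_le_trans pr rr2.
exists r; first by rewrite r0.
have d0 := @nonneg_powsval r M.+1.
have {}O1 : OZ (fun p : small r => sval p ^+ M.+1)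
     (fun p => bracket (psi0 Gam c M (sval p) i) (OmEa c M (sval p) i)).
  exact: (OS_shrink (d := fun e => e ^+ M.+1)
    (f := fun e x => (Gauss x)^-1 * bracket (psi0 Gam c M e i) (OmEa c M e i) x) rr1 O1).
have [a aE] : {a | antider (dalNS c) M.+2 = a} by exists (antider (dalNS c) M.+2).
pose b := dthE c M.
pose D1 (p : small r) x :=
  invlap (OmEa c M (sval p) (rev_ord i)) (shift1 (kappa i * (sval p)^-1 * ala c M (sval p)) x) -
  invlap (OmEa c M (sval p) (rev_ord i)) (shift1 (kappa i * (sval p)^-1 * alM c M (sval p)) x).
pose U (p : small r) := sval p ^+ 2 / 2 * (- (sval p ^+ M * b)).
pose V (p : small r) := sval p * Y2 Gam i / Gtot Gam *
  (- (dthEa c M (sval p) * (sval p ^+ M.+2 * a)) - sval p ^+ M * b * (ala c M (sval p) + sval p ^+ M.+2 * a)).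
have thE e : thM c M e = dthEa c M e + e ^+ M * b by rewrite /thM big_ord_recr.
have PsiD p : exists m : R, PsiEa Gam c M (sval p) i =
    fun x => psi0 Gam c M (sval p) i x + (D1 p x + (U p * enorm x ^+ 2 + (V p * x.1 + 0 * x.2)) + m).
  have [m ->] := PsiEa_quad Gam c M (sval p) i; exists m; apply/funext => x.
  rewrite /psi0 /D1 /U /V /Bop thE alM_ala aE Y2_kappa.
  move: (invlap _ _) (invlap _ _) (invlap _ _) (Gtot Gam)^-1 => a1 a2 a3 a4.
  move: (dthEa _ _ _) (ala _ _ _) (sval p ^+ M) (sval p ^+ M.+2) (enorm x ^+ 2) => a5 a6 a7 a8 a9.
  ring.
pose m p := sval (cid (PsiD p)).
have mE p : PsiEa Gam c M (sval p) i = _ := svalP (cid (PsiD p)).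
have HD : GOS (fun p : small r => sval p ^+ M.+1)
    (fun p x => D1 p x + (U p * enorm x ^+ 2 + (V p * x.1 + 0 * x.2)) + m p).
  apply: (GOSD d0 _ (GOS_cst m d0)); apply: (GOSD d0).
    have ORD := OZ_RD (@OZ_OmEa R Gam c M hc r (rev_ord i) r1').
    apply: (@GOS_shift_diff (small r) (fun p => sval p ^+ M.+1)
      (fun p => kappa i * (sval p)^-1 * ala c M (sval p))
      (fun p => kappa i * (sval p)^-1 * alM c M (sval p)) `|a| _ ORD (normr_ge0 a)).
    move=> p; have /andP[p0 p1] := small_bounds p r1'.
    rewrite alM_ala aE -mulrBr opprD addNKr !normrM normrN normrM.
    have -> : `|kappa i| = 1 :> R.
      by rewrite /kappa; have [->|->] := I2_cases i; rewrite ?vec20 ?vec21 ?normrN normr1.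
    rewrite mul1r (ger0_norm (exprn_ge0 _ (ltW p0))) gtr0_norm ?invr_gt0 // exprS.
    have tn : sval p != 0 by rewrite gt_eqF.
    move: (sval p ^+ M.+1) => T; move: (sval p) `|a| tn => t A tn.
    by rewrite -mulrA mulKf // mulrC.
  pose Kv := `|Y2 Gam i / Gtot Gam| * (thK c M * `|a| + `|b| * (2 + `|a|)).
  have T0 : 0 <= thK c M by exact: powsum_ge0.
  have Kv0 : 0 <= Kv by rewrite mulr_ge0 // addr_ge0 // mulr_ge0 // addr_ge0.
  apply: OS_GOS; apply: (@OS_quad R _ _ _ _ _ (`|b| + Kv)) => //; first exact: addr_ge0.
  - move=> p; have /andP[p0 p1] := small_bounds p r1'; have pM := @nonneg_powsval r M p.
    apply: (@le_trans _ _ (`|b| * sval p ^+ M.+1)); last first.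
      by apply: ler_wpM2r; [exact: d0|rewrite lerDl].
    rewrite /U normrM normrN [`|_ ^+ M * b|]normrM (ger0_norm pM) ger0_norm ?divr_ge0 ?sqr_ge0 //.
    rewrite [sval p ^+ M.+1]exprS; set q := sval p ^+ M in pM *; set t := sval p in p0 p1 *.
    have -> : t ^+ 2 / 2 * (q * `|b|) = `|b| * (t * q) * (t / 2) by field.
    rewrite ler_piMr //; [|lra].
    by rewrite !mulr_ge0 // ltW.
  - move=> p; have /andP[p0 p1] := small_bounds p r1'; have pM := @nonneg_powsval r M p.
    have T := dthEa_bound c M (small_bounds p r1'); have /andP[a1 a2] := al p.
    apply: (@le_trans _ _ (Kv * sval p ^+ M.+1)); last first.
      by apply: ler_wpM2r; [exact: d0|rewrite lerDr].
    have pM2 : sval p ^+ M.+2 <= sval p ^+ M.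
      by apply: ler_wiXn2l; [exact: ltW|exact: p1|rewrite -addn2 leq_addr].
    have pM20 := @nonneg_powsval r M.+2 p.
    have pM21 : sval p ^+ M.+2 <= 1 by rewrite exprn_ile1 // ltW.
    rewrite /V /Kv [sval p ^+ M.+1]exprS (_ : sval p * Y2 Gam i / Gtot Gam = sval p * (Y2 Gam i / Gtot Gam)); last by rewrite mulrA.
    rewrite -[X in `|X|]mulrA normrM (gtr0_norm p0) normrM.
    rewrite (_ : forall u v : R, u * v * (sval p * sval p ^+ M) = sval p * (u * (v * sval p ^+ M)));
      last by move=> u v; ring.
    apply: ler_wpM2l; first exact: ltW.
    apply: ler_wpM2l => //; apply: truncation_coef_bound => //; lra.
  - by move=> p; rewrite normr0 mulr_ge0 ?addr_ge0 //; exact: d0.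
have OB := OZ_bracket1r d0 HD (@OZ_OmEa R Gam c M hc r i r1').
have := OZD d0 O1 OB; congr OZ; apply/funext => p; apply/funext => x.
have P0 := diffable_psi0 Gam M hE (sval p) i; have [DD _] := HD.
by rewrite /REa /bracketV mE (bracketDl _ x P0 (DD p)).
Qed.

End EulerResidualBound.

(** * The identities and estimates for the pseudo-momenta *)

Section Assembly.
Context {R : realType}.
Implicit Types (x y : plane R) (i j : 'I_2) (e r : R).

Lemma OZ_at {I : Type} (d : I -> R) F p : 0 <= d p -> OZ d F -> RD1 (F p).
Proof.
move=> d0 H; apply: OZ_RD; have := OS_reindex (fun _ : unit => p) H.
by apply: (@OS_le _ _ _ _ _ (d p)) => // u; rewrite mulr1.
Qed.

Lemma bigOS_all (f : 'I_2 -> R -> plane R -> R) (d : R -> R) : (forall e, 0 < e -> 0 <= d e) ->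
  (forall i, bigOS 0^'+ (f i) d) ->
  exists2 r0, 0 < r0 & forall r, r <= r0 ->
    forall i, OS (fun p : small r => d (sval p)) (fun p => f i (sval p)).
Proof.
move=> d0 H; have [r1 r10 H1] := bigOS_small d0 (H ord0).
have [r2 r20 H2] := bigOS_small d0 (H ord_max).
exists (Num.min r1 r2); first by rewrite lt_min r10.
move=> r; rewrite le_min => /andP[rr1 rr2] i.
by have [->|->] := I2_cases i; [exact: OS_shrink rr1 H1|exact: OS_shrink rr2 H2].
Qed.

Variables (Gam : 'I_2 -> R) (c : @coefficients R) (M : nat).
Hypotheses (hc : approx_solution Gam c) (hM : (1 <= M)%N) (G0 : Gtot Gam != 0).
Variables (rhoe rhoo : R -> vfun R) (lame : R -> R) (Rez Res Ros : R -> vfun R).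
Hypothesis hrho : pseudo_momenta Gam c M rhoe rhoo lame Rez Res Ros.

Let pow_ge0 (e : R) : 0 < e -> 0 <= e ^+ M.+1.
Proof. by move=> e0; rewrite exprn_ge0 // ltW. Qed.

Lemma REa_bigOZ i : bigOZ 0^'+ (fun e => REa Gam c M e i) (fun e => e ^+ M.+1).
Proof. by have [r /andP[r0 _] H] := REa_O hc hM i; exact: small_bigOS pow_ge0 r0 H. Qed.

(** All germs are restricted to one interval: estimates can be added only over a common index
    type. *)
Record common_radius (C : R -> 'I_2 -> R) r : Prop := CommonRadius {
  radius_gt0 : 0 < r;
  radius_le1 : r <= 1;
  radius_al : forall e, 0 < e < r -> 2^-1 <= ala c M e <= 2;
  radius_RE : forall i, OZ (fun p : small r => sval p ^+ M.+1) (fun p => REa Gam c M (sval p) i);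
  radius_Rez : forall i, OZ (fun p : small r => sval p ^+ M.+1) (fun p => Rez (sval p) i);
  radius_Ros : forall i, OS (fun p : small r => sval p ^+ M.+1)
    (fun p x => Ros (sval p) i x - C (sval p) i);
  radius_rhoo : forall i, OS (fun p : small r => sval p)
    (fun p x => rhoo (sval p) i x - x.2 * Y2 Gam i);
  radius_rhoe : forall e, 0 < e < r -> forall i, inS (rhoe e i);
  radius_fe : forall e, 0 < e < r -> forall i x,
    bracketV (rhoe e) (OmEa c M e) i x = Xop Gam c M e (OmEa c M e) i x + Rez e i x;
  radius_star : forall e, 0 < e < r -> forall i x,
    LambdaEstar Gam c M e (rhoo e) i x = lame e * rhoe e i x + Ros e i x
}.

Lemma common_radius_exists : exists C r, common_radius C r.
Proof.
have [C HC] := Ros_O hrho; exists C.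
have [r1 r10 H1] := bigOS_all (f := fun i e x => (Gauss x)^-1 * REa Gam c M e i x) pow_ge0 REa_bigOZ.
have [r2 r20 H2] := bigOS_all (f := fun i e x => (Gauss x)^-1 * Rez e i x) pow_ge0 (Rez_O hrho).
have [r3 r30 H3] := bigOS_all (f := fun i e x => Ros e i x - C e i) pow_ge0 HC.
have [r4 r40 H4] := bigOS_all (f := fun i e x => rhoo e i x - x.2 * Y2 Gam i) (fun e => @ltW _ _ 0 e) (rhoo_lead hrho).
have [r5 /andP[r50 r51] H5] := ala_near1 c M.
have /near0P[r6 r60 H6] := rhoe_S hrho.
have /near0P[r7 r70 H7] := rhoe_bracket hrho.
have /near0P[r8 r80 H8] := rhoo_star hrho.
pose r := Num.min (Num.min (Num.min r1 r2) (Num.min r3 r4)) (Num.min (Num.min r5 r6) (Num.min r7 r8)).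
have : r <= r by [].
rewrite {2}/r !le_min => /andP[/andP[/andP[a1 a2] /andP[a3 a4]] /andP[/andP[a5 a6] /andP[a7 a8]]].
have sub r' e : r <= r' -> 0 < e < r -> 0 < e < r'.
  by move=> rr /andP[-> er]; exact: lt_le_trans er rr.
exists r; split.
- by rewrite /r !lt_min r10 r20 r30 r40 r50 r60 r70.
- exact: le_trans a5 r51.
- by move=> e he; exact: H5 (sub _ _ a5 he).
- exact: H1.
- exact: H2.
- exact: H3.
- exact: H4.
- by move=> e he; exact: H6 (sub _ _ a6 he).
- by move=> e he; exact: H7 (sub _ _ a7 he).
- by move=> e he; exact: H8 (sub _ _ a8 he).
Qed.

Variables (C : R -> 'I_2 -> R) (r : R).
Hypothesis hr : common_radius C r.

Let r1 : r <= 1 := radius_le1 hr.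
Let d0 : nonneg (fun p : small r => sval p ^+ M.+1) := @nonneg_powsval R r M.+1.
Let n1 : nonneg (fun _ : small r => 1 : R) := nonneg1.

Lemma radius_neq0 e : 0 < e < r -> e != 0 /\ ala c M e != 0.
Proof.
move=> he; have /andP[a1 _] := radius_al hr he; have /andP[e0 _] := he.
by split; rewrite gt_eqF //; lra.
Qed.

Lemma RD1_Om e i : RD1 (OmEa c M e i).
Proof. exact: (RD1_OmEa M (fun n j => proj1 (approx_inZ hc n j)) e i). Qed.

Lemma OS_rhoo i : OS (fun _ : small r => 1) (fun p => rhoo (sval p) i).
Proof.
have H1 : OS (fun _ : small r => 1) (fun p x => rhoo (sval p) i x - x.2 * Y2 Gam i).
  apply: (OS_le ler01 _ (radius_rhoo hr i)) => p; rewrite mulr1.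
  by have /andP[] := small_bounds p r1.
have H2 := OS_scale n1 (normr_ge0 (Y2 Gam i)) (fun _ => lexx _) (@OS_coord2 R (small r)) (q := fun=> Y2 Gam i).
have := OSD n1 H1 H2; congr OS; apply/funext => p; apply/funext => x.
by rewrite [Y2 Gam i * _]mulrC subrK.
Qed.

(** C(t) has zero gradient, so in a bracket the remainder counts as O(e^(M+1)). *)
Lemma GOS_Ros i : GOS (fun p : small r => sval p ^+ M.+1) (fun p => Ros (sval p) i).
Proof.
have := GOSD d0 (OS_GOS (radius_Ros hr i)) (GOS_cst (fun p : small r => C (sval p) i) d0).
by congr GOS; apply/funext => p; apply/funext => x; rewrite subrK.
Qed.

Lemma OZ_fo i : OZ (fun _ : small r => 1) (fun p => bracket (rhoo (sval p) i) (OmEa c M (sval p) i)).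
Proof. exact: OZ_bracket1 n1 (OS_GOS (OS_rhoo i)) (@OZ_OmEa R Gam c M hc r i r1). Qed.

Lemma LambdaE_fe e i x : 0 < e < r ->
  LambdaE Gam c M e (bracketV (rhoe e) (OmEa c M e)) i x =
  Xop Gam c M e (REa Gam c M e) i x + LambdaE Gam c M e (Rez e) i x.
Proof.
move=> he; have [e0 al0] := radius_neq0 he; have HO := RD1_Om e.
have -> : bracketV (rhoe e) (OmEa c M e) = fun j y => Xop Gam c M e (OmEa c M e) j y + Rez e j y.
  by apply/funext => j; apply/funext => y; exact: (radius_fe hr he).
have HX j : RD1 (Xop Gam c M e (OmEa c M e) j) by exact: (RD1_bracket_hatX Gam al0 j (HO j)).
have HR j : RD1 (Rez e j).
  by have := OZ_at (p := exist _ e he) (d0 _) (radius_Rez hr j).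
by rewrite (LambdaED _ _ _ _ _ _ HX HR) (LambdaE_X e0 al0 G0 HO).
Qed.

(** Three brackets with one small factor each: [hatX] with R^E, Psi with R^{e,z}, and the potential
    of R^{e,z} with Omega. The last uses that the gradient of a shifted potential inherits the size
    of its density. *)
Lemma LambdaE_fe_O i : OZ (fun p : small r => sval p ^+ M.+1)
  (fun p => LambdaE Gam c M (sval p) (bracketV (rhoe (sval p)) (OmEa c M (sval p))) i).
Proof.
have HO j := @OZ_OmEa R Gam c M hc r j r1.
have O1 := OZ_bracket1 d0 (OS_GOS (GOS_hatX Gam i r1 (radius_al hr))) (radius_RE hr i).
have O2 := OZ_bracket1 d0 (GOS_PsiEa hc i r1 (radius_al hr)) (radius_Rez hr i).
have O3 := OZ_bracket1r d0 (GOS_Bop (fun p : small r => sval p)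
  (fun p : small r => ala c M (sval p)) i d0 (radius_Rez hr)) (HO i).
have := OZD d0 O1 (OZD d0 O2 O3); congr OZ; apply/funext => p; apply/funext => x.
by rewrite (LambdaE_fe i x (svalP p)).
Qed.

(** The general identity for {rho, Omega}, with Lambda^{E,star} rho^o expanded: its part lambda^e
    rho^e turns back into f^e under the bracket. Up to the remainders, f^e and f^o span a Jordan
    block of Lambda^E. *)
Lemma LambdaE_fo e i x : 0 < e < r ->
  LambdaE Gam c M e (bracketV (rhoo e) (OmEa c M e)) i x =
  - (lame e * bracketV (rhoe e) (OmEa c M e) i x) - bracketV (Ros e) (OmEa c M e) i x
  + bracketV (rhoo e) (REa Gam c M e) i x.
Proof.
move=> he; have [e0 al0] := radius_neq0 he; have HO := RD1_Om e.
pose p : small r := exist _ e he.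
have Cr : diff3 (rhoo e i) by have := OS_diff3 p (OS_rhoo i).
have HB j : RD1 (bracket (rhoo e j) (OmEa c M e j)) by have := OZ_at (p := p) ler01 (OZ_fo j).
rewrite (LambdaE_bracket al0 G0 HO x Cr HB).
have -> : LambdaEstar Gam c M e (rhoo e) i = fun y => lame e * rhoe e i y + Ros e i y.
  by apply/funext => y; exact: (radius_star hr he).
have dr : diffable (rhoe e i).
  by have [sm _] := radius_rhoe hr he i; move=> y; exact: (sm [::] y).
have dl : diffable (fun y => lame e * rhoe e i y) by move=> y; exact: (differentiableZ_plane _ (dr y)).
have dR : diffable (Ros e i) by have [D _] := GOS_Ros i; exact: (D p).
rewrite (bracketDl _ x dl dR) (bracketZl _ _ x dr) /bracketV opprD addrC.
by [].
Qed.

Lemma LambdaE_fo_O i : OZ (fun p : small r => sval p ^+ M.+1)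
  (fun p x => LambdaE Gam c M (sval p) (bracketV (rhoo (sval p)) (OmEa c M (sval p))) i x +
     lame (sval p) * bracketV (rhoe (sval p)) (OmEa c M (sval p)) i x).
Proof.
have O1 := OZ_bracket1 d0 (OS_GOS (OS_rhoo i)) (radius_RE hr i).
have O2 := OZ_bracket1r d0 (GOS_Ros i) (@OZ_OmEa R Gam c M hc r i r1).
have k1 (p : small r) : `|-1 : R| <= 1 by rewrite normrN normr1.
have O3 := OZ_scale d0 ler01 k1 O2.
have := OZD d0 O3 O1; congr OZ; apply/funext => p; apply/funext => x.
rewrite (LambdaE_fo i x (svalP p)) /bracketV.
move: (bracket _ _ x) (bracket _ _ x) (bracket _ _ x) (lame _) => a1 a2 a3 a4.
ring.
Qed.

End Assembly.

Theorem proposition5p3 (R : realType) (Gamma2 : R)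
  (hG : -1 < Gamma2 <= 1) (hG0 : Gamma2 != 0)
  (M : nat) (hM : (3 <= M)%N)
  (c : coefficients) (hc : approx_solution (vec2 1 Gamma2) c)
  (rhoe rhoo : R -> vfun R) (lame : R -> R) (Rez Res Ros : R -> vfun R)
  (hrho : pseudo_momenta (vec2 1 Gamma2) c M rhoe rhoo lame Rez Res Ros) :
  let OmE := OmEa c M in
  let LamE := LambdaE (vec2 1 Gamma2) c M in
  let LamEs := LambdaEstar (vec2 1 Gamma2) c M in
  let X := Xop (vec2 1 Gamma2) c M in
  let RE := REa (vec2 1 Gamma2) c M in
  let fo := fun e => bracketV (rhoo e) (OmE e) in
  let fe := fun e => bracketV (rhoe e) (OmE e) in
  (forall i, bigOZ (0 : R)^'+ (fun e => RE e i) (fun e => e ^+ M.+1)) /\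
  (\forall e \near (0 : R)^'+, forall i x,
     fe e i x = X e (OmE e) i x + Rez e i x) /\
  ((\forall e \near (0 : R)^'+, forall i x,
      LamE e (fe e) i x = X e (RE e) i x + LamE e (Rez e) i x) /\
   (forall i, bigOZ (0 : R)^'+ (fun e => LamE e (fe e) i)
                (fun e => e ^+ M.+1))) /\
  ((\forall e \near (0 : R)^'+, forall i x,
      LamE e (fo e) i x
      = - (lame e * fe e i x) - bracketV (Ros e) (OmE e) i x
        + bracketV (rhoo e) (RE e) i x) /\
   (forall i, bigOZ (0 : R)^'+
      (fun e x => LamE e (fo e) i x + lame e * fe e i x)
      (fun e => e ^+ M.+1))) /\
  (\forall e \near (0 : R)^'+, forall i x,
     LamEs e (rhoe e) i x = Res e i x) /\
  (\forall e \near (0 : R)^'+, forall i x,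
     LamEs e (rhoo e) i x = lame e * rhoe e i x + Ros e i x).
Proof.
move=> OmE LamE LamEs X RE fo fe.
have hM1 : (1 <= M)%N by apply: leq_trans hM.
(* Gamma2 > -1 excludes zero total circulation, for which the centre of vorticity would lie at
   infinity. *)
have G0 : Gtot (vec2 1 Gamma2) != 0.
  by rewrite /Gtot vec20 vec21 gt_eqF //; have /andP[h _] := hG; lra.
have [C [r hr]] := common_radius_exists hc hM1 hrho.
have r0 := radius_gt0 hr.
have pow_ge0 (e : R) : 0 < e -> 0 <= e ^+ M.+1 by move=> e0; rewrite exprn_ge0 // ltW.
split; first exact: (REa_bigOZ hc hM1).
split; first exact: (rhoe_bracket hrho).
split; first split.
- by apply/near0P; exists r => // e he i x; exact: (LambdaE_fe hc G0 hr i x he).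
- move=> i; apply: (small_bigOS pow_ge0 r0
    (f := fun e x => (Gauss x)^-1 * LamE e (fe e) i x)).
  exact: (LambdaE_fe_O hc G0 hr i).
split; first split.
- by apply/near0P; exists r => // e he i x; exact: (LambdaE_fo hc G0 hr i x he).
- move=> i; apply: (small_bigOS pow_ge0 r0
    (f := fun e x => (Gauss x)^-1 * (LamE e (fo e) i x + lame e * fe e i x))).
  exact: (LambdaE_fo_O hc G0 hr i).
by split; [exact: (rhoe_star hrho)|exact: (rhoo_star hrho)].
Qed.
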